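(* Let $k$ be an algebraically closed field. Let $\mathcal{G}$ be a finite subgroup scheme of a reduced group scheme $\mathcal{H}$ over $k$ and let $\mathcal{N}\subseteq\mathcal{G}^0$ be a normal subgroup scheme of $\mathcal{H}$ such that $\mathcal{G}/\mathcal{N}$ is linearly reductive. Let $X$ and $M$ be indecomposable $\mathcal{G}$-modules such that there is an almost split exact sequence $$\mathcal{E}:\ 0\to\tau_{\mathcal{N}}(M)\to X^n\to M\to 0$$ of $\mathcal{N}$-modules, and let $$\tilde{\mathcal{E}}:\ 0\to N\to X\otimes_k\operatorname{Irr}_{\mathcal{N}}(X,M)\to M\to 0$$ be the associated short exact sequence of $\mathcal{G}$-modules with $\operatorname{res}_{\mathcal{N}}^{\mathcal{G}}\tilde{\mathcal{E}}=\mathcal{E}$. Assume that $M$ and $N$ are $\mathcal{G}^0/\mathcal{N}$-regular. Let $S$ be a simple $\mathcal{G}/\mathcal{N}$-module. Then the short exact sequence $\tilde{\mathcal{E}}\otimes_kS$ is almost split.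
   Context: For a finite group scheme $\mathcal{N}$, $k\mathcal{N}:=k[\mathcal{N}]^*$ (dual of the coordinate ring) is its group algebra, and $\mathcal{N}$-modules are $k\mathcal{N}$-modules. A finite group scheme is linearly reductive if its group algebra is semisimple. $\tau_{\mathcal{N}}$ is the Auslander-Reiten translation of $k\mathcal{N}$, $\operatorname{res}_{\mathcal{N}}^{\mathcal{G}}$ is restriction from $\mathcal{G}$-modules to $\mathcal{N}$-modules, and $\mathcal{G}^0$ is the identity component of $\mathcal{G}$. For $\mathcal{N}$-modules $X,Y$, put $\operatorname{Rad}_{\mathcal{N}}(X,Y):=\{\phi\in\operatorname{Hom}_{\mathcal{N}}(X,Y)\mid\phi\text{ is not an isomorphism}\}$, let $\operatorname{Rad}^2_{\mathcal{N}}(X,Y)$ be the set of all composites $\psi\circ\phi$ with $\phi\in\operatorname{Rad}_{\mathcal{N}}(X,Z)$ and $\psi\in\operatorname{Rad}_{\mathcal{N}}(Z,Y)$ for some $\mathcal{N}$-module $Z$, and put $\operatorname{Irr}_{\mathcal{N}}(X,Y):=\operatorname{Rad}_{\mathcal{N}}(X,Y)/\operatorname{Rad}^2_{\mathcal{N}}(X,Y)$. These are regarded as $k$-vector spaces. $\operatorname{Irr}_{\mathcal{N}}(X,M)$ is regarded as a $\mathcal{G}$-module via the structure induced by the conjugation action $(g.\phi)(x)=g\phi(g^{-1}x)$ on $\operatorname{Hom}_{\mathcal{N}}(X,M)$. The sequence $\tilde{\mathcal{E}}$ exists in this situation. Its surjection is the restriction of the evaluation map $X\otimes_k\operatorname{Hom}_{\mathcal{N}}(X,M)\to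 M$, $x\otimes f\mapsto f(x)$, to $X\otimes_k\operatorname{Irr}_{\mathcal{N}}(X,M)$, where $\operatorname{Irr}_{\mathcal{N}}(X,M)$ is embedded as a $\mathcal{G}$-complement of $\operatorname{Rad}^2_{\mathcal{N}}(X,M)$ in $\operatorname{Rad}_{\mathcal{N}}(X,M)$; $N$ is its kernel. Regularity: the infinitesimal linearly reductive group scheme $\mathcal{G}^0/\mathcal{N}$ is multiplicative, with character group $X(\mathcal{G}^0/\mathcal{N})$. For $\lambda\in X(\mathcal{G}^0/\mathcal{N})$ let $k_\lambda$ be the corresponding one-dimensional $\mathcal{G}^0/\mathcal{N}$-module, viewed as a $\mathcal{G}^0$-module. A $\mathcal{G}^0$-module $V$ is called $\mathcal{G}^0/\mathcal{N}$-regular if its stabilizer $\{\lambda\in X(\mathcal{G}^0/\mathcal{N})\mid V\otimes_kk_\lambda\cong V\}$ is trivial; for $\mathcal{G}$-modules this refers to the restriction to $\mathcal{G}^0$. $\tilde{\mathcal{E}}\otimes_kS$ is the sequence obtained by applying $-\otimes_kS$, where $S$ is viewed as a $\mathcal{G}$-module.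
   Formalization: Group schemes are read as affine; Rad² is taken as finite sums of composites of non-isomorphisms through indecomposable Z, since with arbitrary Z every map X→Y factors as X→X⊕Y→Y, so Irr would be 0 and the sequence could not exist. *)

(* Defs.v *)
From HB Require Import structures.
From mathcomp Require Import all_boot all_order all_algebra falgebra.
From mathcomp Require Import mxtens.

Set Implicit Arguments.
Unset Strict Implicit.
Unset Printing Implicit Defensive.

Import GRing.Theory.
Local Open Scope ring_scope.

(* Conventions.  Group schemes over k are affine and are given by their       *)
(* coordinate rings, i.e. by commutative Hopf algebras; the finite ones by    *)
(* finite-dimensional commutative Hopf algebras.  A homomorphism of group     *)
(* schemes C -> B is a Hopf algebra homomorphism k[B] -> k[C].  Modules are   *)
(* finite-dimensional left modules.                                           *)

(******************************************************************************)
(*  Tensors                                                                   *)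
(******************************************************************************)

(* An element of U (x) V is written as a finite formal sum of pure tensors;   *)
(* by the universal property two sums denote the same tensor iff every        *)
(* bilinear map takes the same value on them.                                 *)
Section Tensor.
Variables (k : fieldType).

Definition bilinear_map (U V W : lmodType k) (b : U -> V -> W) : Prop :=
  (forall v, linear (b^~ v)) /\ (forall u, linear (b u)).

Definition trilinear_map (U V V' W : lmodType k) (b : U -> V -> V' -> W) : Prop :=
  [/\ forall v v', linear (fun u => b u v v'),
      forall u v', linear (fun v => b u v v')
    & forall u v, linear (b u v)].

Definition tens2_eq (U V : lmodType k) (s t : seq (U * V)) : Prop :=
  forall (W : lmodType k) (b : U -> V -> W), bilinear_map b ->
    \sum_(p <- s) b p.1 p.2 = \sum_(p <- t) b p.1 p.2.

Definition tens3_eq (U V V' : lmodType k) (s t : seq (U * V * V')) : Prop :=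
  forall (W : lmodType k) (b : U -> V -> V' -> W), trilinear_map b ->
    \sum_(p <- s) b p.1.1 p.1.2 p.2 = \sum_(p <- t) b p.1.1 p.1.2 p.2.

End Tensor.

Notation "s =t2 t" := (tens2_eq s t) (at level 70, no associativity).
Notation "s =t3 t" := (tens3_eq s t) (at level 70, no associativity).

(******************************************************************************)
(*  Affine group schemes                                                      *)
(******************************************************************************)

HB.mixin Record isCommHopfAlgebra (k : fieldType) B of GRing.ComAlgebra k B := {
  comul : B -> seq (B * B);
  counit : {lrmorphism B -> k^o};
  antipode : {linear B -> B};
  comul_linear : forall a x y,
    comul (a *: x + y) =t2 [seq (a *: p.1, p.2) | p <- comul x] ++ comul y;
  comul1 : comul 1 =t2 [:: (1, 1)];
  comulM : forall x y,
    comul (x * y) =t2 [seq (p.1 * q.1, p.2 * q.2) | p <- comul x, q <- comul y];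
  comulA : forall x,
    [seq (q.1, q.2, p.2) | p <- comul x, q <- comul p.1] =t3
    [seq (p.1, q.1, q.2) | p <- comul x, q <- comul p.2];
  counitl : forall x, \sum_(p <- comul x) (counit p.1 : k) *: p.2 = x;
  counitr : forall x, \sum_(p <- comul x) (counit p.2 : k) *: p.1 = x;
  antipodel : forall x,
    \sum_(p <- comul x) antipode p.1 * p.2 = (counit x : k) *: 1;
  antipoder : forall x,
    \sum_(p <- comul x) p.1 * antipode p.2 = (counit x : k) *: 1
}.

#[short(type="commHopfType")]
HB.structure Definition CommHopfAlgebra (k : fieldType) :=
  { B of GRing.ComAlgebra k B & isCommHopfAlgebra k B }.

#[short(type="finCommHopfType")]
HB.structure Definition FinCommHopfAlgebra (k : fieldType) :=
  { B of CommHopfAlgebra k B & Falgebra k B }.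

Section GroupSchemes.
Variable k : fieldType.

Record hopfMorphism (B C : commHopfType k) := HopfMorphism {
  hopf_fun :> {lrmorphism B -> C};
  hopf_comul : forall x,
    comul (hopf_fun x) =t2 [seq (hopf_fun p.1, hopf_fun p.2) | p <- comul x];
  hopf_counit : forall x, counit (hopf_fun x) = counit x
}.

Lemma hopf_comp_comul (B C D : commHopfType k)
    (g : hopfMorphism C D) (f : hopfMorphism B C) x :
  comul ((g \o f) x) =t2 [seq ((g \o f) p.1, (g \o f) p.2) | p <- comul x].
Proof.
move=> W b [bl br]; rewrite /= hopf_comul // !big_map /=.
pose b' u v := b (g u) (g v).
have b'P : bilinear_map b'.
  by split=> [v a u u'|u a v v']; rewrite /b' linearP ?bl ?br.
by rewrite (hopf_comul f x b'P) big_map.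
Qed.

Lemma hopf_comp_counit (B C D : commHopfType k)
    (g : hopfMorphism C D) (f : hopfMorphism B C) x :
  counit ((g \o f) x) = counit x.
Proof. by rewrite /= !hopf_counit. Qed.

Definition hopf_comp (B C D : commHopfType k)
    (g : hopfMorphism C D) (f : hopfMorphism B C) : hopfMorphism B D :=
  HopfMorphism (hopf_comp_comul g f) (hopf_comp_counit g f).

Definition reduced (B : commHopfType k) : Prop :=
  forall (x : B) n, x ^+ n = 0 -> x = 0.

Definition closed_subgroup (B C : commHopfType k) (f : hopfMorphism B C) : Prop :=
  forall y, exists x, f x = y.

(* For every commutative k-algebra R, the subgroup C(R) of B(R) is stable     *)
(* under conjugation; h * n * h^-1 is computed by convolution.                *)
Definition normal_subgroup (B C : commHopfType k) (f : hopfMorphism B C) : Prop :=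
  closed_subgroup f /\
  forall (R : comAlgType k) (h : {lrmorphism B -> R}) (n : {lrmorphism C -> R}),
  exists n' : {lrmorphism C -> R}, forall x,
    n' (f x) = \sum_(p <- comul x) \sum_(q <- comul p.2)
                 h p.1 * n (f q.1) * h (antipode q.2).

(* The connected component of a finite group scheme containing the identity:  *)
(* the closed subscheme Spec C is also open (cut out by an idempotent) and    *)
(* connected.  It contains the identity because it is a subgroup.             *)
Definition identity_component (B C : finCommHopfType k) (f : hopfMorphism B C) :
    Prop :=
  [/\ closed_subgroup f,
      exists e : B, e * e = e /\ forall x, f x = 0 <-> exists y, x = (1 - e) * y
    & forall c : C, c * c = c -> c = 0 \/ c = 1].

(* j : k[Q] -> k[G] exhibits Q as G/N, where f : k[G] -> k[N]: it identifies  *)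
(* k[Q] with the functions x on G such that x(gn) = x(g).                     *)
Definition quotient_by (Q G N : commHopfType k)
    (j : hopfMorphism Q G) (f : hopfMorphism G N) : Prop :=
  injective j /\
  forall x, (exists y, x = j y) <->
            [seq (p.1, f p.2) | p <- comul x] =t2 [:: (x, 1)].

Definition is_character (B : commHopfType k) (l : B) : Prop :=
  comul l =t2 [:: (l, l)] /\ counit l = 1.

End GroupSchemes.

(******************************************************************************)
(*  The group algebra                                                         *)
(******************************************************************************)

Definition galg (k : fieldType) (B : finCommHopfType k) := 'Hom(B, k^o).

HB.instance Definition _ (k : fieldType) (B : finCommHopfType k) :=
  Vector.on (galg B).

Section GroupAlgebra.
Variables (k : fieldType) (B : finCommHopfType k).
Implicit Types (mu nu : galg B) (x y : B).

Definition galg_app mu x : k := (mu : 'Hom(B, k^o)) x.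

Lemma galg_app_linear mu : linear (galg_app mu : B -> k^o).
Proof. by move=> a x y; rewrite /galg_app linearP. Qed.

HB.instance Definition _ mu := GRing.isLinear.Build k B k^o *:%R
  (galg_app mu : B -> k^o) (galg_app_linear mu).

Lemma galg_appZ mu a x : galg_app mu (a *: x) = a * galg_app mu x.
Proof. by rewrite [LHS]linearZ. Qed.

Lemma galgP mu nu : galg_app mu =1 galg_app nu -> mu = nu.
Proof. by move=> eq_mn; apply/lfunP => x; apply: eq_mn. Qed.

Lemma galgDE mu nu x : galg_app (mu + nu) x = galg_app mu x + galg_app nu x.
Proof. by rewrite /galg_app add_lfunE. Qed.

Lemma galgZE a mu x : galg_app (a *: mu) x = a * galg_app mu x.
Proof. by rewrite /galg_app scale_lfunE. Qed.

Lemma galg0E x : galg_app 0 x = 0.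
Proof. by rewrite /galg_app zero_lfunE. Qed.

Definition gmul_fun mu nu x : k^o :=
  \sum_(p <- comul x) galg_app mu p.1 * galg_app nu p.2.

Lemma mul_bilinear mu nu :
  bilinear_map (fun x y => galg_app mu x * galg_app nu y : k^o).
Proof.
split=> [y a u v|x a u v] /=; first by rewrite galg_app_linear mulrDl scalerAl.
by rewrite galg_app_linear mulrDr scalerAr.
Qed.

Lemma gmul_fun_linear mu nu : linear (gmul_fun mu nu).
Proof.
move=> a x y; rewrite /gmul_fun (comul_linear a x y _ _ (mul_bilinear mu nu)).
rewrite big_cat /= big_map scaler_sumr; congr (_ + _).
apply: eq_bigr => p _ /=; rewrite [galg_app mu (a *: _)]linearZ.
exact/esym/mulrA.
Qed.

HB.instance Definition _ mu nu := GRing.isLinear.Build k B k^o *:%R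
  (gmul_fun mu nu) (gmul_fun_linear mu nu).

(* The product of k[G]^* is the convolution product. *)
Definition gmul mu nu : galg B := linfun (gmul_fun mu nu).
Definition gone : galg B := linfun counit.

Lemma gmulE mu nu x :
  galg_app (gmul mu nu) x = \sum_(p <- comul x) galg_app mu p.1 * galg_app nu p.2.
Proof. by rewrite {1}/galg_app lfunE. Qed.

Lemma goneE x : galg_app gone x = counit x.
Proof. by rewrite {1}/galg_app lfunE. Qed.

Lemma gmulA : associative gmul.
Proof.
move=> mu nu xi; apply: galgP => x; rewrite !gmulE.
pose b u v w : k^o := galg_app mu u * galg_app nu v * galg_app xi w.
have bP : trilinear_map b.
  have scaleE (a c : k) : (a *: (c : k^o) : k^o) = a * c by [].
  split=> [v w a s t|u w a s t|u v a s t]; rewrite /b galg_app_linear !scaleE.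
  - by rewrite !mulrDl !mulrA.
  - by rewrite mulrDr mulrDl !mulrA [_ * a]mulrC.
  - by rewrite mulrDr mulrCA.
have := comulA x _ _ bP; rewrite !big_allpairs_dep /= => E.
under eq_bigr => p _ do rewrite gmulE mulr_sumr.
under [RHS]eq_bigr => p _ do rewrite gmulE mulr_suml.
rewrite [RHS]E; apply: eq_bigr => p _; apply: eq_bigr => q _.
by rewrite /b mulrA.
Qed.

Lemma gmul1 : left_id gone gmul.
Proof.
move=> mu; apply: galgP => x; rewrite gmulE -[in RHS](counitl x).
rewrite [RHS](raddf_sum (galg_app mu)) /=; apply: eq_bigr => p _.
by rewrite goneE [RHS]linearZ.
Qed.

Lemma gmulr1 : right_id gone gmul.
Proof.
move=> mu; apply: galgP => x; rewrite gmulE -[in RHS](counitr x).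
rewrite [RHS](raddf_sum (galg_app mu)) /=; apply: eq_bigr => p _.
by rewrite goneE mulrC [RHS]linearZ.
Qed.

Lemma gmulDl : left_distributive gmul +%R.
Proof.
move=> mu nu xi; apply: galgP => x; rewrite galgDE !gmulE -big_split /=.
by apply: eq_bigr => p _; rewrite galgDE mulrDl.
Qed.

Lemma gmulDr : right_distributive gmul +%R.
Proof.
move=> mu nu xi; apply: galgP => x; rewrite galgDE !gmulE -big_split /=.
by apply: eq_bigr => p _; rewrite galgDE mulrDr.
Qed.

Lemma gone_neq0 : gone != 0.
Proof.
apply/eqP => /(congr1 (fun mu => galg_app mu 1)).
by rewrite goneE rmorph1 galg0E => /eqP; rewrite oner_eq0.
Qed.

HB.instance Definition _ := GRing.Zmodule_isNzRing.Build (galg B)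
  gmulA gmul1 gmulr1 gmulDl gmulDr gone_neq0.

Lemma gscalerAl a mu nu : a *: (mu * nu) = a *: mu * nu.
Proof.
apply: galgP => x; rewrite galgZE !gmulE mulr_sumr.
by apply: eq_bigr => p _; rewrite galgZE mulrA.
Qed.

HB.instance Definition _ := GRing.Lmodule_isLalgebra.Build k (galg B) gscalerAl.

Lemma gscalerAr a mu nu : a *: (mu * nu) = mu * (a *: nu).
Proof.
apply: galgP => x; rewrite galgZE !gmulE mulr_sumr.
by apply: eq_bigr => p _; rewrite galgZE mulrCA.
Qed.

HB.instance Definition _ := GRing.Lalgebra_isAlgebra.Build k (galg B) gscalerAr.
HB.instance Definition _ := Algebra_isFalgebra.Build k (galg B).

End GroupAlgebra.

(******************************************************************************)
(*  Modules over a finite-dimensional algebra                                 *)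
(******************************************************************************)

Section Modules.
Variables (k : fieldType) (A : falgType k).

(* The underlying space is 'cV_mdim, and a acts by x |-> mact a *m x.         *)
Record fdmodule := FdModule {
  mdim : nat;
  mact : A -> 'M[k]_mdim;
  mact_linear : linear mact;
  mact1 : mact 1 = 1%:M;
  mactM : forall a b, mact (a * b) = mact a *m mact b
}.

HB.instance Definition _ (X : fdmodule) :=
  GRing.isLinear.Build k A 'M[k]_(mdim X) *:%R (mact X) (@mact_linear X).

Implicit Types X Y Z T M P Q : fdmodule.

Definition mod_hom X Y (f : 'M[k]_(mdim Y, mdim X)) : Prop :=
  forall a, f *m mact X a = mact Y a *m f.

Definition mod_iso X Y (f : 'M[k]_(mdim Y, mdim X)) : Prop :=
  mod_hom f /\
  exists g : 'M[k]_(mdim X, mdim Y),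
    [/\ mod_hom g, g *m f = 1%:M & f *m g = 1%:M].

Definition isomorphic X Y : Prop := exists f, @mod_iso X Y f.

Definition hom_inj X Y (f : 'M[k]_(mdim Y, mdim X)) : Prop :=
  forall x : 'cV_(mdim X), f *m x = 0 -> x = 0.

Definition hom_surj X Y (f : 'M[k]_(mdim Y, mdim X)) : Prop :=
  forall y : 'cV_(mdim Y), exists x : 'cV_(mdim X), f *m x = y.

Definition exact_at X Y Z (f : 'M[k]_(mdim Y, mdim X))
    (g : 'M[k]_(mdim Z, mdim Y)) : Prop :=
  forall y : 'cV_(mdim Y), g *m y = 0 <-> exists x : 'cV_(mdim X), f *m x = y.

Definition split_mono X Y (f : 'M[k]_(mdim Y, mdim X)) : Prop :=
  exists g : 'M[k]_(mdim X, mdim Y), mod_hom g /\ g *m f = 1%:M.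

Definition split_epi X Y (f : 'M[k]_(mdim Y, mdim X)) : Prop :=
  exists g : 'M[k]_(mdim X, mdim Y), mod_hom g /\ f *m g = 1%:M.

Definition left_almost_split X Y (f : 'M[k]_(mdim Y, mdim X)) : Prop :=
  [/\ mod_hom f, ~ split_mono f
    & forall Z (h : 'M[k]_(mdim Z, mdim X)), mod_hom h -> ~ split_mono h ->
      exists u : 'M[k]_(mdim Z, mdim Y), mod_hom u /\ h = u *m f].

Definition right_almost_split X Y (g : 'M[k]_(mdim Y, mdim X)) : Prop :=
  [/\ mod_hom g, ~ split_epi g
    & forall Z (h : 'M[k]_(mdim Y, mdim Z)), mod_hom h -> ~ split_epi h ->
      exists u : 'M[k]_(mdim X, mdim Z), mod_hom u /\ h = g *m u].

Record mod_seq := ModSeq {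
  seq1 : fdmodule;
  seq2 : fdmodule;
  seq3 : fdmodule;
  seq_inj : 'M[k]_(mdim seq2, mdim seq1);
  seq_surj : 'M[k]_(mdim seq3, mdim seq2)
}.

Definition short_exact (E : mod_seq) : Prop :=
  [/\ mod_hom (seq_inj E), mod_hom (seq_surj E), hom_inj (seq_inj E),
      exact_at (seq_inj E) (seq_surj E) & hom_surj (seq_surj E)].

Definition almost_split (E : mod_seq) : Prop :=
  [/\ short_exact E, left_almost_split (seq_inj E)
    & right_almost_split (seq_surj E)].

Definition seq_isomorphic (E E' : mod_seq) : Prop :=
  exists (u1 : 'M[k]_(mdim (seq1 E'), mdim (seq1 E)))
         (u2 : 'M[k]_(mdim (seq2 E'), mdim (seq2 E)))
         (u3 : 'M[k]_(mdim (seq3 E'), mdim (seq3 E))),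
    [/\ mod_iso u1, mod_iso u2, mod_iso u3,
        u2 *m seq_inj E = seq_inj E' *m u1
      & u3 *m seq_surj E = seq_surj E' *m u2].

Definition dsum_act X Y a := block_mx (mact X a) 0 0 (mact Y a).

Lemma dsum_linear X Y : linear (dsum_act X Y).
Proof.
by move=> c a b; rewrite /dsum_act !linearP scale_block_mx add_block_mx !scaler0 !addr0.
Qed.

Lemma dsum1 X Y : dsum_act X Y 1 = 1%:M.
Proof. by rewrite /dsum_act !mact1 -scalar_mx_block. Qed.

Lemma dsumM X Y a b : dsum_act X Y (a * b) = dsum_act X Y a *m dsum_act X Y b.
Proof. by rewrite /dsum_act mulmx_block !mactM !mul0mx !mulmx0 !addr0 !add0r. Qed.

Definition dsum X Y : fdmodule :=
  FdModule (@dsum_linear X Y) (dsum1 X Y) (@dsumM X Y).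

Definition dpow_act X n a : 'M[k]_(\sum_(i < n) mdim X) := \mxdiag_(i < n) mact X a.

Lemma mxdiag_mul n (p : 'I_n -> nat) (D E : forall i, 'M[k]_(p i)) :
  \mxdiag_i D i *m \mxdiag_i E i = \mxdiag_i (D i *m E i).
Proof.
rewrite [\mxdiag_i E i]/mxdiag mul_mxdiag_mxblock; apply: eq_mxblock => i j.
by case: eqVneq => [<-|_]; rewrite ?conform_mx_id ?mulmx0.
Qed.

Lemma dpow_linear X n : linear (dpow_act X n).
Proof.
move=> c a b; rewrite /dpow_act -mul_scalar_mx -mxdiagZ mxdiag_mul -mxdiagD.
by apply: eq_mxdiag => i; rewrite linearP mul_scalar_mx.
Qed.

Lemma dpow1 X n : dpow_act X n 1 = 1%:M.
Proof. by rewrite -mxdiagZ; apply: eq_mxdiag => i; rewrite mact1. Qed.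

Lemma dpowM X n a b : dpow_act X n (a * b) = dpow_act X n a *m dpow_act X n b.
Proof.
by rewrite /dpow_act mxdiag_mul; apply: eq_mxdiag => i; rewrite mactM.
Qed.

Definition dpow X n : fdmodule :=
  FdModule (@dpow_linear X n) (dpow1 X n) (@dpowM X n).

Definition indecomposable_mod X : Prop :=
  mdim X <> 0%N /\
  forall Y Z, isomorphic X (dsum Y Z) -> mdim Y = 0%N \/ mdim Z = 0%N.

Definition simple_mod X : Prop :=
  mdim X <> 0%N /\
  forall Y (f : 'M[k]_(mdim X, mdim Y)), mod_hom f -> hom_inj f ->
    mdim Y = 0%N \/ hom_surj f.

Definition left_ideal (U : {vspace A}) : Prop := forall a u, u \in U -> a * u \in U.

Definition semisimple_algebra : Prop :=
  forall U : {vspace A}, left_ideal U ->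
  exists W : {vspace A},
    [/\ left_ideal W, (U + W)%VS = fullv & (U :&: W)%VS = 0%VS].

(******************************************************************************)
(*  The Auslander-Reiten translation                                          *)
(******************************************************************************)

Definition projective_mod P : Prop :=
  forall Y Z (g : 'M[k]_(mdim Z, mdim Y)) (h : 'M[k]_(mdim Z, mdim P)),
    mod_hom g -> hom_surj g -> mod_hom h ->
    exists u : 'M[k]_(mdim Y, mdim P), mod_hom u /\ g *m u = h.

(* p induces an essential epimorphism from P onto its image. *)
Definition essential P M (p : 'M[k]_(mdim M, mdim P)) : Prop :=
  forall Y (h : 'M[k]_(mdim P, mdim Y)), mod_hom h ->
    (forall x : 'cV_(mdim P), exists y : 'cV_(mdim Y), p *m h *m y = p *m x) ->
    hom_surj h.

Definition minimal_projective_presentation P1 P0 M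
    (p1 : 'M[k]_(mdim P0, mdim P1)) (p0 : 'M[k]_(mdim M, mdim P0)) : Prop :=
  [/\ projective_mod P1 /\ projective_mod P0, mod_hom p1 /\ mod_hom p0,
      exact_at p1 p0 /\ hom_surj p0 & essential p1 /\ essential p0].

(* Hom_A(P, A), a right A-module via (h a)(x) = h(x) a. *)
Definition dual_elt P (h : 'Hom('cV[k]_(mdim P), A)) : Prop :=
  forall a x, h (mact P a *m x) = a * h x.

Definition dual_map P1 P0 (p : 'M[k]_(mdim P0, mdim P1))
    (h : 'Hom('cV[k]_(mdim P0), A)) : 'Hom('cV[k]_(mdim P1), A) :=
  (h \o linfun (mulmx p))%VF.

(* T is isomorphic to D Tr M, where, for a minimal projective presentation    *)
(* P1 -> P0 -> M -> 0, Tr M is the cokernel of Hom_A(P0, A) -> Hom_A(P1, A)   *)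
(* and D = Hom_k(-, k).  An element t of T corresponds to a linear form       *)
(* theta t on Hom_A(P1, A) vanishing on the image of Hom_A(P0, A); forms on   *)
(* the subspace Hom_A(P1, A) of Hom_k(P1, A) are written as restrictions of   *)
(* forms on Hom_k(P1, A).                                                     *)
Definition is_AR_translate T M : Prop :=
  exists P1 P0 (p1 : 'M[k]_(mdim P0, mdim P1)) (p0 : 'M[k]_(mdim M, mdim P0))
    (theta : {linear 'cV[k]_(mdim T) ->
                       'Hom('Hom('cV[k]_(mdim P1), A), k^o)}),
  [/\ minimal_projective_presentation p1 p0,
      forall a t h, dual_elt h ->
        theta (mact T a *m t) h = theta t (amulr a \o h)%VF,
      forall t h, dual_elt h -> theta t (dual_map p1 h) = 0,
      forall t, (forall h, dual_elt h -> theta t h = 0) -> t = 0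
    & forall xi : 'Hom('Hom('cV[k]_(mdim P1), A), k^o),
        (forall h, dual_elt h -> xi (dual_map p1 h) = 0) ->
        exists t, forall h, dual_elt h -> theta t h = xi h].

(******************************************************************************)
(*  Irreducible maps                                                          *)
(******************************************************************************)

Definition Rad X Y (f : 'M[k]_(mdim Y, mdim X)) : Prop :=
  mod_hom f /\ ~ mod_iso f.

(* The subspace of finite sums of composites g f of radical maps f : X -> Z   *)
(* and g : Z -> Y.  The description of the radical as the set of              *)
(* non-isomorphisms is meant for indecomposable modules, so Z is              *)
(* indecomposable: through Z = X (+) Y every map X -> Y would be a composite  *)
(* of non-isomorphisms.                                                       *)
Inductive Rad2 X Y : 'M[k]_(mdim Y, mdim X) -> Prop :=
| Rad2_0 : Rad2 0
| Rad2_add Z (f : 'M[k]_(mdim Z, mdim X)) (g : 'M[k]_(mdim Y, mdim Z)) h :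
    indecomposable_mod Z -> Rad f -> Rad g -> Rad2 h -> Rad2 (g *m f + h).

End Modules.

(******************************************************************************)
(*  Modules over group algebras                                               *)
(******************************************************************************)

Section GroupModules.
Variable k : fieldType.

Definition linearly_reductive (B : finCommHopfType k) : Prop :=
  semisimple_algebra (galg B).

Section Operations.
Variable B : finCommHopfType k.
Implicit Types (mu nu : galg B) (X Y : fdmodule (galg B)).

(* The comultiplication of k[G]^* is dual to the multiplication of k[G]; here *)
(* it is written in terms of a basis (e_i) of k[G] and its dual basis:        *)
(* Delta mu = \sum_(i, j) mu (e_i e_j) e_i^* (x) e_j^*.                       *)
Definition gbasis (i : 'I_(\dim {:B})) : B := (vbasis {:B})`_i.
Definition gdual (i : 'I_(\dim {:B})) : galg B := linfun (coord (vbasis {:B}) i : B -> k^o).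

Definition gcomul mu : seq (galg B * galg B) :=
  [seq (galg_app mu (gbasis i * gbasis j) *: gdual i, gdual j)
    | i <- enum 'I_(\dim {:B}), j <- enum 'I_(\dim {:B})].

Definition gantipode mu : galg B := (mu \o linfun antipode)%VF.

Lemma gdual_sum x : x = \sum_i galg_app (gdual i) x *: gbasis i.
Proof.
rewrite [LHS](coord_vbasis (memvf x)); apply: eq_bigr => i _.
by rewrite /galg_app lfunE.
Qed.

Lemma gcomulE mu x y :
  \sum_(p <- gcomul mu) galg_app p.1 x * galg_app p.2 y = galg_app mu (x * y).
Proof.
rewrite /gcomul big_allpairs_dep /= big_enum /=.
rewrite [in RHS](gdual_sum x) mulr_suml [RHS](raddf_sum (galg_app mu)) /=.
apply: eq_bigr => i _; rewrite big_enum /=.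
rewrite [in RHS](gdual_sum y) mulr_sumr [RHS](raddf_sum (galg_app mu)) /=.
apply: eq_bigr => j _; rewrite -scalerAl -scalerAr.
by rewrite !galg_appZ galgZE -mulrA mulrCA [X in _ * X]mulrC.
Qed.

(* The function on G whose value is the (i, j) matrix coefficient of X.       *)
Definition mcoef X i j : B := \sum_l mact X (gdual l) i j *: gbasis l.
Arguments mcoef : clear implicits.

Lemma mcoefE X mu i j : mact X mu i j = galg_app mu (mcoef X i j).
Proof.
have Emu : mu = \sum_l galg_app mu (gbasis l) *: gdual l.
  apply: galgP => x; rewrite {1}(gdual_sum x) (raddf_sum (galg_app mu)) /=.
  rewrite /galg_app sum_lfunE; apply: eq_bigr => l _.
  by rewrite scale_lfunE [LHS]galg_appZ mulrC.
rewrite {1}Emu linear_sum summxE /mcoef (raddf_sum (galg_app mu)) /=.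
by apply: eq_bigr => l _; rewrite linearZ mxE [RHS]galg_appZ mulrC.
Qed.

Definition tens_act X Y mu : 'M[k]_(mdim X * mdim Y) :=
  \sum_(p <- gcomul mu) mact X p.1 *t mact Y p.2.

Lemma tens_actE X Y mu i j i' j' :
  tens_act X Y mu (mxtens_index (i, i')) (mxtens_index (j, j')) =
  galg_app mu (mcoef X i j * mcoef Y i' j').
Proof.
rewrite /tens_act summxE -gcomulE; apply: eq_bigr => p _.
by rewrite tensmxE !mcoefE.
Qed.

Lemma tens_linear X Y : linear (tens_act X Y).
Proof.
move=> c mu nu; apply/matrixP => i j.
case: (mxtens_indexP i) => i1 i2; case: (mxtens_indexP j) => j1 j2.
by rewrite !mxE !tens_actE galgDE galgZE.
Qed.

Lemma tens1 X Y : tens_act X Y 1 = 1%:M.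
Proof.
apply/matrixP => i j.
case: (mxtens_indexP i) => i1 i2; case: (mxtens_indexP j) => j1 j2.
rewrite tens_actE goneE rmorphM /= -!goneE -!mcoefE !mact1 !mxE.
rewrite -natrM mulnb -xpair_eqE; congr (nat_of_bool _)%:R.
exact/esym/(inj_eq (can_inj (@mxtens_indexK _ _))).
Qed.

(* The functional x |-> mu (x y). *)
Definition gshift_fun mu y x : k^o := galg_app mu (x * y).

Lemma gshift_linear mu y : linear (gshift_fun mu y).
Proof. by move=> a u v; rewrite /gshift_fun mulrDl -scalerAl galg_app_linear. Qed.

HB.instance Definition _ mu y := GRing.isLinear.Build k B k^o *:%R
  (gshift_fun mu y) (gshift_linear mu y).

Lemma mcoef_comul X mu nu i j :
  \sum_(p <- comul (mcoef X i j)) galg_app mu p.1 * galg_app nu p.2 =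
  \sum_l galg_app mu (mcoef X i l) * galg_app nu (mcoef X l j).
Proof.
rewrite -gmulE -[gmul mu nu]/(mu * nu) -mcoefE mactM mxE.
by apply: eq_bigr => l _; rewrite !mcoefE.
Qed.

Lemma mcoef_comulM X Y mu nu i j i' j' :
  galg_app (mu * nu) (mcoef X i j * mcoef Y i' j') =
  \sum_l \sum_l' galg_app mu (mcoef X i l * mcoef Y i' l') *
                 galg_app nu (mcoef X l j * mcoef Y l' j').
Proof.
rewrite [LHS]gmulE (comulM _ _ _ _ (mul_bilinear mu nu)) big_allpairs_dep /=.
have shiftE xi y x : galg_app (linfun (gshift_fun xi y)) x = galg_app xi (x * y).
  by rewrite {1}/galg_app lfunE.
rewrite exchange_big /=.
under eq_bigr => q _.
  under eq_bigr => p _ do rewrite -!shiftE.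
  rewrite mcoef_comul.
  under eq_bigr => l _ do rewrite !shiftE ![mcoef X _ _ * _]mulrC -!shiftE.
  over.
rewrite exchange_big /=; apply: eq_bigr => l _.
rewrite mcoef_comul; apply: eq_bigr => l' _.
by rewrite !shiftE ![mcoef Y _ _ * _]mulrC.
Qed.

Lemma tensM X Y mu nu :
  tens_act X Y (mu * nu) = tens_act X Y mu *m tens_act X Y nu.
Proof.
apply/matrixP => i j.
case: (mxtens_indexP i) => i1 i2; case: (mxtens_indexP j) => j1 j2.
rewrite tens_actE mcoef_comulM mxE pair_big /=.
rewrite (reindex (@mxtens_unindex _ _)); last first.
  by exists (@mxtens_index _ _) => l _; rewrite ?mxtens_indexK ?mxtens_unindexK.
apply: eq_bigr => l _; case: (mxtens_indexP l) => l1 l2.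
by rewrite mxtens_indexK !tens_actE.
Qed.

Definition tens X Y : fdmodule (galg B) :=
  FdModule (@tens_linear X Y) (tens1 X Y) (@tensM X Y).

Definition tens_seq (E : mod_seq (galg B)) Y : mod_seq (galg B) :=
  @ModSeq _ _ (tens (seq1 E) Y) (tens (seq2 E) Y) (tens (seq3 E) Y)
    (seq_inj E *t 1%:M) (seq_surj E *t 1%:M).

(* The one-dimensional module k_l of a character l. *)
Section CharacterModule.
Variables (l : B) (char_l : is_character l).

Definition char_act mu : 'M[k]_1 := (galg_app mu l)%:M.

Lemma char_linear : linear char_act.
Proof.
move=> a mu nu; rewrite /char_act galgDE galgZE raddfD /=.
by rewrite scale_scalar_mx.
Qed.

Lemma char1 : char_act 1 = 1%:M.
Proof. by rewrite /char_act goneE; case: char_l => _ ->. Qed.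

Lemma charM mu nu : char_act (mu * nu) = char_act mu *m char_act nu.
Proof.
rewrite /char_act gmulE; case: char_l => comul_l _.
by rewrite (comul_l _ _ (mul_bilinear mu nu)) big_seq1 /= scalar_mxM.
Qed.

Definition char_mod : fdmodule (galg B) := FdModule char_linear char1 charM.

End CharacterModule.

(* The conjugation action (g.phi)(x) = g phi(g^-1 x) on Hom_k(X, Y).          *)
Definition conj_act X Y mu (phi : 'M[k]_(mdim Y, mdim X)) : 'M[k]_(mdim Y, mdim X) :=
  \sum_(p <- gcomul mu) mact Y p.1 *m phi *m mact X (gantipode p.2).

End Operations.

Section Restriction.
Variables (B C : finCommHopfType k) (f : hopfMorphism B C).

(* The algebra homomorphism of group algebras induced by a homomorphism of    *)
(* group schemes.                                                             *)
Definition galg_map (nu : galg C) : galg B := (nu \o linfun f)%VF.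

Lemma galg_mapE nu x : galg_app (galg_map nu) x = galg_app nu (f x).
Proof. by rewrite /galg_app /galg_map comp_lfunE lfunE. Qed.

Variable X : fdmodule (galg B).

Definition res_act (nu : galg C) := mact X (galg_map nu).

Lemma res_linear : linear res_act.
Proof.
move=> a mu nu; rewrite /res_act -linearP; congr (mact X _).
by apply: galgP => x; rewrite galgDE galgZE !galg_mapE galgDE galgZE.
Qed.

Lemma res1 : res_act 1 = 1%:M.
Proof.
rewrite /res_act -(mact1 X); congr (mact X _).
by apply: galgP => x; rewrite galg_mapE !goneE hopf_counit.
Qed.

Lemma resM mu nu : res_act (mu * nu) = res_act mu *m res_act nu.
Proof.
rewrite /res_act -mactM; congr (mact X _); apply: galgP => x.
rewrite galg_mapE !gmulE (hopf_comul f x (mul_bilinear mu nu)) big_map.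
by apply: eq_bigr => p _; rewrite !galg_mapE.
Qed.

(* For a subgroup scheme this is restriction; for a quotient G -> G/N it is   *)
(* inflation.                                                                 *)
Definition res : fdmodule (galg C) := FdModule res_linear res1 resM.

End Restriction.

Definition res_seq (B C : finCommHopfType k) (f : hopfMorphism B C)
    (E : mod_seq (galg B)) : mod_seq (galg C) :=
  @ModSeq _ _ (res f (seq1 E)) (res f (seq2 E)) (res f (seq3 E))
    (seq_inj E) (seq_surj E).

(* q0 : k[G0/N] -> k[G0].  V is a G0-module. *)
Definition regular (Q G0 : finCommHopfType k) (q0 : hopfMorphism Q G0)
    (V : fdmodule (galg G0)) : Prop :=
  forall (l : Q) (char_l : is_character l),
    isomorphic (tens V (res q0 (char_mod char_l))) V -> l = 1.

(* iota : I -> Hom_k(X, M) is G-equivariant and maps I isomorphically onto a  *)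
(* complement of Rad_N^2(X, M) in Rad_N(X, M); equivalently, I is             *)
(* Irr_N(X, M) embedded as such a complement.                                 *)
Definition irr_embedding (G N : finCommHopfType k) (f : hopfMorphism G N)
    (X M I : fdmodule (galg G))
    (iota : {linear 'cV[k]_(mdim I) -> 'M[k]_(mdim M, mdim X)}) : Prop :=
  [/\ forall mu v, iota (mact I mu *m v) = conj_act mu (iota v),
      forall v, @Rad k (galg N) (res f X) (res f M) (iota v),
      forall v, @Rad2 k (galg N) (res f X) (res f M) (iota v) -> v = 0
    & forall phi, @Rad k (galg N) (res f X) (res f M) phi ->
        exists v, @Rad2 k (galg N) (res f X) (res f M) (phi - iota v)].

(* The map X (x) I -> M, x (x) v |-> (iota v)(x). *)
Definition is_evaluation (B : finCommHopfType k) (X M I : fdmodule (galg B))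
    (iota : {linear 'cV[k]_(mdim I) -> 'M[k]_(mdim M, mdim X)})
    (g : 'M[k]_(mdim M, mdim (tens X I))) : Prop :=
  forall (x : 'cV[k]_(mdim X)) (v : 'cV[k]_(mdim I)),
    g *m (x *t v) = iota v *m x.

End GroupModules.

(* Main.v *)
(* By Nagata's theorem the infinitesimal linearly reductive group G0/N is       *)
(* diagonalizable, so k[G0/N] is spanned by characters.  Let V be M or N.  The  *)
(* ring R = End_N(V) is local with residue field k, and G acts on it by         *)
(* conjugation through G/N.  If some phi in R of weight l under G0/N were       *)
(* invertible, it would be an isomorphism between V and a twist of V by l, so   *)
(* regularity makes the residue map R -> k invariant under G0/N; a nilpotency   *)
(* argument extends the invariance to G/N.                                      *)
(*                                                                              *)
(* Over N the module M (x) S is a direct sum of copies of M.  Let h : Z ->      *)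
(* M (x) S be G-linear.  If no component of h is an N-split epimorphism, then   *)
(* h factors N-linearly through X (x) Irr (x) S, and averaging over the         *)
(* linearly reductive group G/N makes the factorization G-linear.  Otherwise    *)
(* the residues of the components of h q, for q in Hom_N(M, Z), form a nonzero  *)
(* G-submodule of S, hence all of S since S is simple; Gaussian elimination     *)
(* over the local ring R turns such q into an N-linear section of h, which      *)
(* averages to a G-linear one.  The left almost split property is dual.         *)

Require Import Defs.
From mathcomp Require Import all_boot all_order all_algebra falgebra.
From HB Require Import structures.
From mathcomp Require Import mxtens perm.
From mathcomp Require Import zify ring.
From Stdlib Require Import Classical.

Set Implicit Arguments.
Unset Strict Implicit.
Unset Printing Implicit Defensive.

Import GRing.Theory.
Local Open Scope ring_scope.

(** * Tensor products of Hopf algebras and matrix coefficients *)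

(** Since N acts trivially on S, the restriction of M (x) S to N is a sum of copies of M. Consider a
    G-linear h : Z -> M (x) S. If all its components over N factor through X (x) Irr, the
    factorizations assemble into an N-linear one, and conjugation by a lifted integral of k(G/N)
    makes it G-linear ([average_hom]). Otherwise some component has an N-linear section q. Sending p
    in Hom_N(M, Z) to the residues of the components of h p is G-equivariant with values in S
    ([residue_conj_slice]), as soon as the residue map of the local ring End_N(M) is G-invariant. It
    is nonzero at q, hence onto the simple module S; [elimination_right] corrects preimages of a
    basis to an N-section of h, and averaging finishes. This is [right_almost_split_tens];
    [left_almost_split_tens] is dual, with the kernel in place of M.

    Invariance of residues ([regular_residue_conj]) is where regularity enters. The group G0/N is
    connected and inherits an integral from G/N ([component_integral]), so its coordinate ring is
    spanned by characters ([characters_span]). An endomorphism thus splits into weight vectors, and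
    an invertible one of weight l is an isomorphism V (x) k_l -> V, so l = 1
    ([residue_conj_weights]). To pass from G0 to G, the functions g |-> residue (g.phi) with phi of
    residue 0 are shown to generate a nilpotent ideal equal to its own square, hence zero
    ([residue_conj0]).

    Behind [characters_span]: an integral excludes nonzero nilpotent elements of the Lie algebra
    ([primitive_nil]); the Lie algebra is therefore commutative and central ([primitive_comm],
    [primitive_central]), and each of its nonzero elements is nonzero on some determinant character
    ([primitive_character]). So characters span modulo the square of the augmentation ideal, which
    is nilpotent. *)

Section Functionals.
Variables (k : fieldType) (B : finCommHopfType k).
Implicit Types (mu nu : galg B) (x y : B).

Lemma galg_sep x y : (forall mu, galg_app mu x = galg_app mu y) -> x = y.
Proof. by move=> E; rewrite (gdual_sum x) (gdual_sum y); apply: eq_bigr => i _; rewrite E. Qed.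

Lemma galg_app1 x : galg_app (1 : galg B) x = counit x.
Proof. exact: goneE. Qed.

Lemma galgM mu nu x :
  galg_app (mu * nu) x = \sum_(p <- comul x) galg_app mu p.1 * galg_app nu p.2.
Proof. exact: gmulE. Qed.

Lemma galg_appD mu x y : galg_app mu (x + y) = galg_app mu x + galg_app mu y.
Proof. exact: (raddfD (galg_app mu)). Qed.

Lemma galg_app_sum mu (I : Type) (r : seq I) (P : pred I) (F : I -> B) :
  galg_app mu (\sum_(i <- r | P i) F i) = \sum_(i <- r | P i) galg_app mu (F i).
Proof. exact: (raddf_sum (galg_app mu)). Qed.

Lemma galg_sumE (I : Type) (r : seq I) (P : pred I) (F : I -> galg B) x :
  galg_app (\sum_(i <- r | P i) F i) x = \sum_(i <- r | P i) galg_app (F i) x.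
Proof. by rewrite /galg_app sum_lfunE. Qed.

Lemma gdual_basis i j : galg_app (gdual i) (gbasis j : B) = (i == j)%:R.
Proof.
rewrite /galg_app lfunE /gbasis eq_sym; apply: coord_free.
exact: basis_free (vbasisP _).
Qed.

Lemma gbasis_sum mu : mu = \sum_l galg_app mu (gbasis l) *: gdual l.
Proof.
apply: galgP => x; rewrite {1}(gdual_sum x) galg_app_sum galg_sumE.
by apply: eq_bigr => l _; rewrite galg_appZ galgZE mulrC.
Qed.

(** Biduality in finite dimension: for linear [F] this is the function whose evaluation is [F]. *)
Definition galg_repr (F : galg B -> k) : B := \sum_l F (gdual l) *: gbasis l.

Lemma galg_reprE (F : galg B -> k) mu :
  linear (F : galg B -> k^o) -> galg_app mu (galg_repr F) = F mu.
Proof.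
move=> linF.
pose G : {linear galg B -> k^o} :=
  HB.pack (F : galg B -> k^o) (GRing.isLinear.Build k (galg B) k^o *:%R F linF).
rewrite /galg_repr galg_app_sum [in RHS](gbasis_sum mu) -[RHS]/(G _) linear_sum.
by apply: eq_bigr => l _; rewrite galg_appZ linearZ mulrC.
Qed.

End Functionals.

Section TensorAlgebra.
Variables (k : fieldType) (B C : finCommHopfType k).

(** A concrete model of k[B] (x) k[C] by coordinates in the two bases. It turns equality of formal
    sums into equality in a commutative ring, where idempotents and nilpotents can be discussed. *)
Definition tensor := 'M[k]_(\dim {:B}, \dim {:C}).
HB.instance Definition _ := GRing.Lmodule.on tensor.

Implicit Types (s t : tensor) (b : B) (c : C).

Definition pure b c : tensor :=
  \matrix_(i, j) (galg_app (gdual i) b * galg_app (gdual j) c).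

Lemma pure_bilinear : bilinear_map pure.
Proof.
split=> [c a x y|b a x y]; apply/matrixP => i j; rewrite !mxE galg_app_linear.
  by rewrite mulrDl -mulrA.
by rewrite mulrDr mulrCA.
Qed.

Lemma tensor_sum t : t = \sum_i \sum_j t i j *: pure (gbasis i) (gbasis j).
Proof.
apply/matrixP => i j; rewrite summxE.
under eq_bigr => i' _.
  rewrite summxE (bigD1 j) //= big1 ?addr0 => [|j' /negbTE nj].
    by rewrite !mxE !gdual_basis eqxx mulr1; over.
  by rewrite !mxE !gdual_basis [j == j']eq_sym nj !mulr0.
rewrite (bigD1 i) //= eqxx mulr1 big1 ?addr0 // => i' /negbTE ni.
by rewrite [i == i']eq_sym ni mulr0.
Qed.

Lemma tensor_ext (W : lmodType k) (f g : tensor -> W) :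
  linear f -> linear g -> (forall b c, f (pure b c) = g (pure b c)) -> f =1 g.
Proof.
move=> lf lg E t.
pose F : {linear tensor -> W} := HB.pack f (GRing.isLinear.Build k tensor W *:%R f lf).
pose G : {linear tensor -> W} := HB.pack g (GRing.isLinear.Build k tensor W *:%R g lg).
rewrite (tensor_sum t) -[LHS]/(F _) -[RHS]/(G _) !linear_sum.
apply: eq_bigr => i _; rewrite !linear_sum; apply: eq_bigr => j _.
by rewrite !linearZ /= E.
Qed.

Definition tlift (W : lmodType k) (beta : B -> C -> W) t : W :=
  \sum_i \sum_j t i j *: beta (gbasis i) (gbasis j).

Lemma tlift_linear (W : lmodType k) (beta : B -> C -> W) : linear (tlift beta).
Proof.
move=> a s t; rewrite /tlift scaler_sumr -big_split; apply: eq_bigr => i _ /=.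
rewrite scaler_sumr -big_split; apply: eq_bigr => j _ /=.
by rewrite !mxE scalerDl scalerA.
Qed.

Lemma tlift_pure (W : lmodType k) (beta : B -> C -> W) b c :
  bilinear_map beta -> tlift beta (pure b c) = beta b c.
Proof.
move=> [bl br].
pose L c : {linear B -> W} := HB.pack (beta^~ c) (GRing.isLinear.Build k B W *:%R _ (bl c)).
pose R b : {linear C -> W} := HB.pack (beta b) (GRing.isLinear.Build k C W *:%R _ (br b)).
rewrite [in RHS](gdual_sum b) -[RHS]/(L c _) linear_sum; apply: eq_bigr => i _.
rewrite linearZ /= [in RHS](gdual_sum c) -[beta _ _]/(R (gbasis i) _) linear_sum.
rewrite scaler_sumr; apply: eq_bigr => j _.
by rewrite linearZ /= scalerA mxE.
Qed.

Lemma eq_tlift (W : lmodType k) (beta beta' : B -> C -> W) t :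
  (forall b c, beta b c = beta' b c) -> tlift beta t = tlift beta' t.
Proof. by move=> E; apply: eq_bigr => i _; apply: eq_bigr => j _; rewrite E. Qed.

Definition tmul s t : tensor :=
  tlift (fun b c => tlift (fun b' c' => pure (b * b') (c * c')) t) s.

Lemma tmul_linearl t : linear (tmul^~ t).
Proof. exact: tlift_linear. Qed.

Lemma tmul_pure_bilinear b c :
  bilinear_map (fun b' c' => pure (b * b') (c * c')).
Proof.
have [bl br] := pure_bilinear.
by split=> [? a ? ?|? a ? ?]; rewrite mulrDr -scalerAr ?bl ?br.
Qed.

Lemma tmul_linearr s : linear (tmul s).
Proof.
move=> a t t'; rewrite /tmul.
under eq_tlift => b c do rewrite tlift_linear.
rewrite /tlift scaler_sumr -big_split; apply: eq_bigr => i _ /=.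
rewrite scaler_sumr -big_split; apply: eq_bigr => j _ /=.
by rewrite scalerDr !scalerA mulrC.
Qed.

Lemma tmul_pure b c b' c' : tmul (pure b c) (pure b' c') = pure (b * b') (c * c').
Proof.
have [bl br] := pure_bilinear.
rewrite /tmul tlift_pure; first by rewrite tlift_pure //; exact: tmul_pure_bilinear.
split=> [? a ? ?|? a ? ?]; rewrite !tlift_pure ?mulrDl -?scalerAl ?bl ?br //;
  exact: tmul_pure_bilinear.
Qed.

Lemma tmulC : commutative tmul.
Proof.
move=> s; apply: tensor_ext => [||b c]; [exact: tmul_linearr|exact: tmul_linearl|].
move: s; apply: tensor_ext => [||b' c']; [exact: tmul_linearl|exact: tmul_linearr|].
by rewrite !tmul_pure [b * _]mulrC [c * _]mulrC.
Qed.

Lemma tmulDl : left_distributive tmul +%R.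
Proof. by move=> r s t; have := tmul_linearl t 1 r s; rewrite !scale1r. Qed.

Lemma tmulA : associative tmul.
Proof.
move=> s t; apply: tensor_ext => [||b c]; [|exact: tmul_linearr|].
  by move=> a u v; rewrite !tmul_linearr.
move: s; apply: tensor_ext => [||b' c']; [exact: tmul_linearl| |].
  by move=> a u v; rewrite !tmul_linearl.
move: t; apply: tensor_ext => [||b'' c''].
- by move=> a u v; rewrite tmul_linearl tmul_linearr.
- by move=> a u v; rewrite tmul_linearr tmul_linearl.
by rewrite !tmul_pure !mulrA.
Qed.

Lemma tmul1 : left_id (pure 1 1) tmul.
Proof.
apply: tensor_ext => [||b c]; [exact: tmul_linearr| by []|].
by rewrite tmul_pure !mul1r.
Qed.

Lemma pure11_neq0 : pure 1 1 != 0.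
Proof.
have [bl br] := pure_bilinear.
apply/eqP => /(congr1 (tlift (fun b c => counit b * counit c : k^o))).
rewrite tlift_pure; last first.
  split=> [? a ? ?|? a ? ?]; rewrite linearP.
    by rewrite mulrDl -scalerAl.
  by rewrite mulrDr -scalerAr.
rewrite !rmorph1 mulr1 /tlift big1 => [/eqP|i _]; first by rewrite oner_eq0.
by rewrite big1 // => j _; rewrite mxE scale0r.
Qed.

HB.instance Definition _ := GRing.Zmodule_isComNzRing.Build tensor
  tmulA tmulC tmul1 tmulDl pure11_neq0.

Lemma tscalerAl (a : k) s t : a *: (s * t) = a *: s * t.
Proof.
have E : (a *: s + 0) * t = a *: (s * t) + 0 * t := tmul_linearl t a s 0.
by move: E; rewrite mul0r !addr0.
Qed.

HB.instance Definition _ := GRing.Lmodule_isLalgebra.Build k tensor tscalerAl.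
HB.instance Definition _ := GRing.Lalgebra_isComAlgebra.Build k tensor.

Lemma pureM b c b' c' : pure b c * pure b' c' = pure (b * b') (c * c').
Proof. exact: tmul_pure. Qed.

Definition inl_t b : tensor := pure b 1.
Definition inr_t c : tensor := pure 1 c.

Lemma inl_t_linear : linear inl_t.
Proof. by case: pure_bilinear => bl _; apply: bl. Qed.
Lemma inr_t_linear : linear inr_t.
Proof. by case: pure_bilinear => _ br; apply: br. Qed.
Lemma inl_t_monoid : monoid_morphism inl_t.
Proof. by split=> // b b'; rewrite /inl_t pureM mulr1. Qed.
Lemma inr_t_monoid : monoid_morphism inr_t.
Proof. by split=> // c c'; rewrite /inr_t pureM mulr1. Qed.

HB.instance Definition _ := GRing.isLinear.Build k B tensor *:%R inl_t inl_t_linear.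
HB.instance Definition _ := GRing.isMonoidMorphism.Build B tensor inl_t inl_t_monoid.
HB.instance Definition _ := GRing.isLinear.Build k C tensor *:%R inr_t inr_t_linear.
HB.instance Definition _ := GRing.isMonoidMorphism.Build C tensor inr_t inr_t_monoid.

Lemma pureE b c : pure b c = inl_t b * inr_t c.
Proof. by rewrite /inl_t /inr_t pureM mulr1 mul1r. Qed.

Definition tapp (mu : galg B) (nu : galg C) : tensor -> k^o :=
  tlift (fun b c => galg_app mu b * galg_app nu c : k^o).

Lemma tapp_bilinear (mu : galg B) (nu : galg C) :
  bilinear_map (fun b c => galg_app mu b * galg_app nu c : k^o).
Proof.
split=> [? a ? ?|? a ? ?]; rewrite galg_app_linear.
  by rewrite mulrDl scalerAl.
by rewrite mulrDr scalerAr.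
Qed.

HB.instance Definition _ mu nu := GRing.isLinear.Build k tensor k^o *:%R (tapp mu nu)
  (@tlift_linear _ _).

Lemma tapp_pure mu nu b c : tapp mu nu (pure b c) = galg_app mu b * galg_app nu c.
Proof. by rewrite /tapp tlift_pure //; exact: tapp_bilinear. Qed.

Lemma tapp_lr mu nu b c : tapp mu nu (inl_t b * inr_t c) = galg_app mu b * galg_app nu c.
Proof. by rewrite -pureE tapp_pure. Qed.

Lemma tapp_sep s t : (forall mu nu, tapp mu nu s = tapp mu nu t) -> s = t.
Proof.
move=> E; apply/matrixP => i j.
suff entry (u : tensor) : u i j = tapp (gdual i) (gdual j) u by rewrite !entry E.
apply: (tensor_ext (f := fun u => u i j : k^o)) u => [a u v|a u v|b c].
- by rewrite !mxE.
- exact: linearP.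
by rewrite tapp_pure mxE.
Qed.

Lemma tens2_pure (s t : seq (B * C)) :
  (s =t2 t) <-> \sum_(p <- s) pure p.1 p.2 = \sum_(p <- t) pure p.1 p.2.
Proof.
split=> [E|E W b bP]; first exact: (E _ _ pure_bilinear).
have lift u : \sum_(p <- u) b p.1 p.2 = tlift b (\sum_(p <- u) pure p.1 p.2).
  pose L : {linear tensor -> W} :=
    HB.pack (tlift b) (GRing.isLinear.Build k tensor W *:%R _ (@tlift_linear W b)).
  rewrite -[RHS]/(L _) linear_sum; apply: eq_bigr => p _ /=.
  by rewrite tlift_pure.
by rewrite !lift E.
Qed.

End TensorAlgebra.

Arguments inl_t {k B} C b.
Arguments inr_t {k} B {C} c.

Lemma tensmx11 (R : comPzRingType) m n :
  (1%:M : 'M[R]_m) *t (1%:M : 'M_n) = 1%:M.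
Proof.
apply/matrixP => i j; case: (mxtens_indexP i) => i1 i2; case: (mxtens_indexP j) => j1 j2.
by rewrite tensmxE !mxE -natrM mulnb -xpair_eqE (inj_eq (can_inj (@mxtens_indexK _ _))).
Qed.

Section Points.
Variables (k : fieldType) (R : comAlgType k).

Section Conv.
Variables (B : commHopfType k) (x y : {lrmorphism B -> R}).

(** The product of the R-points x and y of the group scheme. *)
Definition conv (b : B) : R := \sum_(p <- comul b) x p.1 * y p.2.

Lemma conv_bilinear : bilinear_map (fun b c => x b * y c).
Proof.
split=> [? a ? ?|? a ? ?]; rewrite linearP.
  by rewrite mulrDl -scalerAl.
by rewrite mulrDr -scalerAr.
Qed.

Lemma conv_linear : linear conv.
Proof.
move=> a b c; rewrite /conv (comul_linear a b c _ _ conv_bilinear).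
rewrite big_cat /= big_map scaler_sumr; congr (_ + _).
by apply: eq_bigr => p _ /=; rewrite linearZ -scalerAl.
Qed.

Lemma conv_monoid : monoid_morphism conv.
Proof.
split=> [|b c]; first by rewrite /conv (comul1 _ _ conv_bilinear) big_seq1 /= !rmorph1 mul1r.
rewrite /conv (comulM b c _ _ conv_bilinear) big_allpairs_dep /= mulr_suml.
apply: eq_bigr => p _; rewrite mulr_sumr; apply: eq_bigr => q _.
by rewrite !rmorphM mulrACA.
Qed.

HB.instance Definition _ := GRing.isLinear.Build k B R *:%R conv conv_linear.
HB.instance Definition _ := GRing.isMonoidMorphism.Build B R conv conv_monoid.
End Conv.

Section Pair.
Variables (B C : finCommHopfType k) (x : {lrmorphism B -> R}) (y : {lrmorphism C -> R}).

Definition tpair : tensor B C -> R := tlift (fun b c => x b * y c).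

Lemma tpair_bilinear : bilinear_map (fun b c => x b * y c).
Proof.
split=> [? a ? ?|? a ? ?]; rewrite linearP.
  by rewrite mulrDl -scalerAl.
by rewrite mulrDr -scalerAr.
Qed.

Lemma tpair_pure b c : tpair (pure b c) = x b * y c.
Proof. by rewrite /tpair tlift_pure //; exact: tpair_bilinear. Qed.

Lemma tpair_monoid : monoid_morphism tpair.
Proof.
have lin := @tlift_linear _ B C _ (fun b c => x b * y c).
split=> [|s]; first by rewrite tpair_pure !rmorph1 mulr1.
apply: tensor_ext => [a u v|a u v|b c].
- by rewrite mulrDr -scalerAr /tpair lin.
- by rewrite /tpair lin mulrDr -scalerAr.
move: s; apply: tensor_ext => [a u v|a u v|b' c'].
- by rewrite mulrDl -scalerAl /tpair lin.
- by rewrite /tpair lin mulrDl -scalerAl.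
by rewrite pureM !tpair_pure !rmorphM mulrACA.
Qed.

HB.instance Definition _ := GRing.isLinear.Build k (tensor B C) R *:%R tpair
  (@tlift_linear _ _ _ _ _).
HB.instance Definition _ := GRing.isMonoidMorphism.Build (tensor B C) R tpair tpair_monoid.

Lemma tpair_inl b : tpair (inl_t C b) = x b.
Proof. by rewrite tpair_pure rmorph1 mulr1. Qed.

Lemma tpair_inr c : tpair (inr_t B c) = y c.
Proof. by rewrite tpair_pure rmorph1 mul1r. Qed.

End Pair.
End Points.

Section Constants.
Variables (k : fieldType) (R : algType k).

Definition cst m n (phi : 'M[k]_(m, n)) : 'M[R]_(m, n) := map_mx (in_alg R) phi.

Lemma cstM m n p (phi : 'M[k]_(m, n)) (psi : 'M_(n, p)) :
  cst (phi *m psi) = cst phi *m cst psi.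
Proof. exact: map_mxM. Qed.

Lemma cst1 n : cst (1%:M : 'M_n) = 1%:M.
Proof. exact: map_mx1. Qed.

Lemma map_cst (R' : algType k) (x : {lrmorphism R -> R'}) m n (phi : 'M_(m, n)) :
  map_mx x (cst phi) = map_mx (in_alg R') phi.
Proof. by apply/matrixP => i j; rewrite !mxE rmorph_alg. Qed.

End Constants.
Arguments cst {k} R {m n} phi.

Section Evaluation.
Variables (k : fieldType) (B : finCommHopfType k) (mu : galg B).
Local Notation ev := (map_mx (galg_app mu)).

Lemma ev_cst_mull m n p (phi : 'M[k]_(m, n)) (X : 'M[B]_(n, p)) :
  ev (cst B phi *m X) = phi *m ev X.
Proof.
apply/matrixP => i j; rewrite !mxE galg_app_sum; apply: eq_bigr => l _.
by rewrite !mxE /= mulr_algl galg_appZ.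
Qed.

Lemma ev_cst_mulr m n p (X : 'M[B]_(m, n)) (phi : 'M[k]_(n, p)) :
  ev (X *m cst B phi) = ev X *m phi.
Proof.
apply/matrixP => i j; rewrite !mxE galg_app_sum; apply: eq_bigr => l _.
by rewrite !mxE /= mulr_algr galg_appZ mulrC.
Qed.

Lemma ev_cst m n (phi : 'M[k]_(m, n)) : ev (cst B phi) = galg_app mu 1 *: phi.
Proof. by apply/matrixP => i j; rewrite !mxE /= galg_appZ mulrC. Qed.

Lemma ev_mulmx m n p (X : 'M[B]_(m, n)) (Y : 'M[B]_(n, p)) :
  ev (X *m Y) = \sum_(q <- gcomul mu) map_mx (galg_app q.1) X *m map_mx (galg_app q.2) Y.
Proof.
apply/matrixP => i j; rewrite !mxE summxE galg_app_sum.
under eq_bigr => l _ do rewrite -gcomulE.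
rewrite exchange_big /=; apply: eq_bigr => q _; rewrite mxE.
by apply: eq_bigr => l _; rewrite !mxE.
Qed.

End Evaluation.

Lemma ev_sep (k : fieldType) (B : finCommHopfType k) m n (X Y : 'M[B]_(m, n)) :
  (forall mu, map_mx (galg_app mu) X = map_mx (galg_app mu) Y) -> X = Y.
Proof.
move=> E; apply/matrixP => i j; apply: galg_sep => mu.
by have /matrixP/(_ i j) := E mu; rewrite !mxE.
Qed.

Section Generic.
Variables (k : fieldType) (B : finCommHopfType k).
Implicit Types (V W : fdmodule (galg B)).

(** The matrix by which the universal point of the group acts on V. Applying mu entrywise gives
    [mact V mu], so statements about the action become matrix identities over k[G]. *)
Definition gen V : 'M[B]_(mdim V) := \matrix_(i, j) mcoef i j.
Definition igen V : 'M[B]_(mdim V) := map_mx antipode (gen V).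

Lemma ev_gen V mu : map_mx (galg_app mu) (gen V) = mact V mu.
Proof. by apply/matrixP => i j; rewrite !mxE mcoefE. Qed.

Lemma comul_mcoef V (i j : 'I_(mdim V)) :
  comul (mcoef i j) =t2 [seq (mcoef i l, mcoef l j) | l <- enum 'I_(mdim V)].
Proof.
apply/tens2_pure/tapp_sep => mu nu; rewrite !linear_sum big_map big_enum /=.
transitivity (\sum_(p <- comul (mcoef i j)) galg_app mu p.1 * galg_app nu p.2).
  by apply: eq_bigr => p _; rewrite tapp_pure.
by rewrite mcoef_comul; apply: eq_bigr => l _; rewrite tapp_pure.
Qed.

Lemma counit_mcoef V (i j : 'I_(mdim V)) : counit (mcoef i j) = (i == j)%:R :> k.
Proof. by rewrite -galg_app1 -mcoefE mact1 mxE. Qed.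

(** The coproduct of a matrix coefficient is given by matrix multiplication, so this is the antipode
    axiom read entrywise. *)
Lemma gen_igen V : gen V *m igen V = 1%:M.
Proof.
apply/matrixP => i j; rewrite mxE.
have bP : bilinear_map (fun b c : B => b * antipode c).
  split=> [? a ? ?|? a ? ?]; first by rewrite mulrDl -scalerAl.
  by rewrite linearP mulrDr -scalerAr.
have := comul_mcoef i j bP; rewrite antipoder big_map big_enum /=.
rewrite counit_mcoef mxE => E.
rewrite -[RHS](_ : (i == j)%:R *: 1 = _); last by case: (i == j); rewrite ?scale1r ?scale0r.
by rewrite E; apply: eq_bigr => l _; rewrite !mxE.
Qed.

Lemma igen_gen V : igen V *m gen V = 1%:M.
Proof. exact: mulmx1C (gen_igen V). Qed.

Lemma igen_unique V (X : 'M[B]_(mdim V)) : gen V *m X = 1%:M -> X = igen V.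
Proof. by move=> E; rewrite -[X]mul1mx -(igen_gen V) -mulmxA E mulmx1. Qed.

Section ConvGen.
Variables (R : comAlgType k) (x y : {lrmorphism B -> R}) (V : fdmodule (galg B)).

Lemma conv_gen : map_mx (conv x y) (gen V) = map_mx x (gen V) *m map_mx y (gen V).
Proof.
apply/matrixP => i j; rewrite !mxE /conv (comul_mcoef i j (conv_bilinear x y)).
by rewrite big_map big_enum; apply: eq_bigr => l _; rewrite !mxE.
Qed.

Lemma conv_igen : map_mx (conv x y) (igen V) = map_mx y (igen V) *m map_mx x (igen V).
Proof.
set Z := map_mx _ _; set X := map_mx x (igen V); set Y := map_mx y (igen V).
have E : map_mx x (gen V) *m map_mx y (gen V) *m Z = 1%:M.
  by rewrite -conv_gen -map_mxM gen_igen map_mx1.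
have Ex : X *m map_mx x (gen V) = 1%:M by rewrite -map_mxM igen_gen map_mx1.
have Ey : Y *m map_mx y (gen V) = 1%:M by rewrite -map_mxM igen_gen map_mx1.
by rewrite -[RHS]mulmx1 -E !mulmxA -[Y *m X *m _]mulmxA Ex mulmx1 Ey mul1mx.
Qed.

End ConvGen.

(** The conjugate of phi by the universal point. Applying mu gives [conj_act mu phi], and phi is
    linear over the group iff this matrix is constant. *)
Definition Gam V W (phi : 'M[k]_(mdim W, mdim V)) : 'M[B]_(mdim W, mdim V) :=
  gen W *m cst B phi *m igen V.
Arguments Gam : clear implicits.

Lemma conj_actE V W mu (phi : 'M_(mdim W, mdim V)) :
  conj_act mu phi = map_mx (galg_app mu) (Gam V W phi).
Proof.
rewrite /Gam ev_mulmx; apply: eq_bigr => p _.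
rewrite ev_cst_mulr ev_gen; congr (_ *m _).
apply/matrixP => i j; rewrite !mxE -ev_gen !mxE.
by rewrite /gantipode /galg_app comp_lfunE lfunE.
Qed.

Lemma GamM V W Z (phi : 'M_(mdim W, mdim V)) (psi : 'M_(mdim Z, mdim W)) :
  Gam V Z (psi *m phi) = Gam W Z psi *m Gam V W phi.
Proof.
by rewrite /Gam cstM !mulmxA -[_ *m _ *m igen W *m gen W]mulmxA igen_gen mulmx1.
Qed.

Lemma Gam1 V : Gam V V 1%:M = 1%:M.
Proof. by rewrite /Gam cst1 mulmx1 gen_igen. Qed.

Lemma GamP V W a (phi psi : 'M_(mdim W, mdim V)) :
  Gam V W (a *: phi + psi) = a%:A *: Gam V W phi + Gam V W psi.
Proof.
rewrite /Gam (_ : cst B _ = a%:A *: cst B phi + cst B psi).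
  by rewrite mulmxDr mulmxDl -scalemxAr -scalemxAl.
by apply/matrixP => i j; rewrite !mxE rmorphD rmorphM.
Qed.

Lemma mod_hom_gen V W (phi : 'M_(mdim W, mdim V)) :
  mod_hom phi <-> gen W *m cst B phi = cst B phi *m gen V.
Proof.
split=> [E|E a].
  by apply: ev_sep => mu; rewrite ev_cst_mull ev_cst_mulr !ev_gen.
by rewrite -!ev_gen -ev_cst_mull -ev_cst_mulr E.
Qed.

Lemma mod_homP V W (phi : 'M_(mdim W, mdim V)) :
  mod_hom phi <-> Gam V W phi = cst B phi.
Proof.
apply: (iff_trans (mod_hom_gen phi)); rewrite /Gam; split=> E.
  by rewrite E -mulmxA gen_igen mulmx1.
by rewrite -[LHS]mulmx1 -(igen_gen V) mulmxA E.
Qed.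

Lemma conv_Gam (R : comAlgType k) (x y : {lrmorphism B -> R}) V W phi :
  map_mx (conv x y) (Gam V W phi) =
  map_mx x (gen W) *m map_mx y (Gam V W phi) *m map_mx x (igen V).
Proof. by rewrite /Gam !map_mxM conv_gen conv_igen !map_cst !mulmxA. Qed.

End Generic.
Arguments Gam {k B} V W phi.

(** Used with [Y] a generic conjugate and [X], [Z] the outer generic matrices: conjugation by a
    product of two points is conjugation in two steps. *)
Lemma tapp_sandwich (k : fieldType) (B C : finCommHopfType k) mu nu m n p q
    (X : 'M[B]_(m, n)) (Y : 'M[C]_(n, p)) (Z : 'M[B]_(p, q)) :
  map_mx (tapp mu nu)
    (map_mx (inl_t C) X *m map_mx (inr_t B) Y *m map_mx (inl_t C) Z) =
  map_mx (galg_app mu) (X *m cst B (map_mx (galg_app nu) Y) *m Z).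
Proof.
apply/matrixP => i j; rewrite !mxE linear_sum galg_app_sum; apply: eq_bigr => b _.
rewrite !mxE !mulr_suml linear_sum galg_app_sum; apply: eq_bigr => a _.
rewrite !mxE /= mulrAC -rmorphM tapp_lr.
by rewrite mulr_algr -scalerAl galg_appZ mulrC.
Qed.

Section ConjAct.
Variables (k : fieldType) (B : finCommHopfType k).
Implicit Types (V W : fdmodule (galg B)).

Lemma tapp_comul (mu nu : galg B) b :
  tapp mu nu (conv (inl_t B) (inr_t B) b) = galg_app (mu * nu) b.
Proof. by rewrite linear_sum galgM; apply: eq_bigr => p _; exact: tapp_lr. Qed.

Lemma conj_actM V W mu nu (phi : 'M_(mdim W, mdim V)) :
  conj_act (mu * nu) phi = conj_act mu (conj_act nu phi : 'M_(mdim W, mdim V)).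
Proof.
rewrite !conj_actE /Gam -tapp_sandwich -conv_Gam.
by apply/matrixP => i j; rewrite !mxE tapp_comul.
Qed.

Lemma hom_conj_act V W (phi : 'M_(mdim W, mdim V)) :
  mod_hom phi <-> forall mu, conj_act mu phi = galg_app mu 1 *: phi.
Proof.
apply: (iff_trans (mod_homP phi)); split=> [E mu|E].
  by rewrite conj_actE E ev_cst.
by apply: ev_sep => mu; rewrite -conj_actE E ev_cst.
Qed.

End ConjAct.

Section ResTens.
Variables (k : fieldType) (B : finCommHopfType k).

Lemma gen_res (C : finCommHopfType k) (f : hopfMorphism B C) (V : fdmodule (galg B)) :
  gen (res f V) = map_mx f (gen V).
Proof.
apply: ev_sep => nu; rewrite ev_gen; apply/matrixP => i j.
by rewrite -[mact _ _ _ _]/(mact V (galg_map f nu) i j) mcoefE galg_mapE !mxE.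
Qed.

Lemma igen_res (C : finCommHopfType k) (f : hopfMorphism B C) (V : fdmodule (galg B)) :
  igen (res f V) = map_mx f (igen V).
Proof.
by apply/esym/igen_unique; rewrite gen_res -map_mxM gen_igen map_mx1.
Qed.

Lemma Gam_res (C : finCommHopfType k) (f : hopfMorphism B C) (V W : fdmodule (galg B))
    (phi : 'M_(mdim W, mdim V)) :
  Gam (res f V) (res f W) phi = map_mx f (Gam V W phi).
Proof. by rewrite /Gam gen_res igen_res !map_mxM map_cst. Qed.

Lemma gen_tens (V W : fdmodule (galg B)) : gen (tens V W) = gen V *t gen W.
Proof.
apply/matrixP => i j.
case: (mxtens_indexP i) => i1 i2; case: (mxtens_indexP j) => j1 j2.
rewrite tensmxE; apply: galg_sep => mu.
by rewrite !mxE -mcoefE -tens_actE.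
Qed.

Lemma igen_tens (V W : fdmodule (galg B)) : igen (tens V W) = igen V *t igen W.
Proof.
apply/esym/igen_unique; rewrite gen_tens tensmx_mul !gen_igen.
exact: tensmx11.
Qed.

End ResTens.

(** * Linear algebra: eigenvectors, submodules and simple modules *)

Lemma vspace_of_pred (k : fieldType) (U : vectType k) (P : U -> Prop) :
  P 0 -> (forall a u v, P u -> P v -> P (a *: u + v)) ->
  exists W : {vspace U}, forall u, u \in W <-> P u.
Proof.
move=> P0 PD.
suff ext n (W : {vspace U}) : (\dim {:U} - \dim W < n)%N -> (forall u, u \in W -> P u) ->
    exists W : {vspace U}, forall u, u \in W <-> P u.
  apply: (ext _ 0%VS (ltnSn _)) => u; rewrite memv0 => /eqP ->; exact: P0.
(* Enlarge [W] by a vector satisfying [P] outside it until there is none; [n] bounds the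
   codimension. *)
elim: n W => // n IHn W ltn WP.
have [allP|] := classic (forall u, P u -> u \in W).
  by exists W => u; split; [exact: WP|exact: allP].
move=> nall; have [u nu0] := not_all_ex_not _ _ nall.
have [Pu /negP nu] := imply_to_and _ _ nu0.
apply: (IHn (W + <[u]>)%VS).
  have ltd : (\dim W < \dim (W + <[u]>))%N.
    rewrite ltn_neqAle dimvS ?addvSl // andbT.
    apply: contra nu => /eqP E; suff -> : W = (W + <[u]>)%VS by rewrite memvE addvSr.
    by apply/eqP; rewrite eqEdim addvSl E /=.
  have := dimvS (subvf (W + <[u]>)%VS); lia.
move=> v /memv_addP[w wW [_ /vlineP[a ->] ->]].
by rewrite addrC; apply: PD => //; apply: WP.
Qed.


Section NilOrEigen.
Variables (k : closedFieldType) (U : vectType k) (T : {linear U -> U}).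

(** The vector p(T) z. *)
Definition eval_at (p : {poly k}) (z : U) := \sum_(i < size p) p`_i *: iter i T z.

Lemma eval_at_widen (p : {poly k}) z n : (size p <= n)%N -> eval_at p z = \sum_(i < n) p`_i *: iter i T z.
Proof.
move=> le_pn; rewrite /eval_at (big_ord_widen n (fun i => p`_i *: iter i T z)) //.
rewrite big_mkcond; apply: eq_bigr => i _; case: ltnP => // le_pi.
by rewrite nth_default // scale0r.
Qed.

Lemma eval_at_factor a (p : {poly k}) z :
  eval_at (('X - a%:P) * p) z = T (eval_at p z) - a *: eval_at p z.
Proof.
rewrite (@eval_at_widen _ _ (size p).+1); last first.
  by rewrite (leq_trans (size_polyMleq _ _)) // size_XsubC.
under eq_bigr => i _ do rewrite mulrBl coefB coefXM coefCM scalerBl -scalerA.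
rewrite sumrB -scaler_sumr -(eval_at_widen _ (leqnSn _)); congr (_ - _).
rewrite big_ord_recl /= scale0r add0r linear_sum; apply: eq_bigr => i _ /=.
by rewrite linearZ.
Qed.

Lemma eval_at_annihilator z : exists2 p : {poly k}, p != 0 & eval_at p z = 0.
Proof.
pose d := \dim {:U}; pose X := [tuple iter i T z | i < d.+1].
have nfree : ~ free X.
  move=> /eqP; rewrite size_tuple => E.
  by have := dimvS (subvf <<X>>%VS); rewrite E ltnn.
have [c nc] : exists c : 'I_d.+1 -> k,
    ~ (\sum_(i < d.+1) c i *: X`_i = 0 -> forall i, c i = 0).
  apply: not_all_ex_not => Hc; apply: nfree; exact/freeP.
have [E nc0] := imply_to_and _ _ nc; have [i ci0] := not_all_ex_not _ _ nc0.
pose c' i := c (inord i); exists (\poly_(i < d.+1) c' i).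
  apply/eqP => /polyP/(_ i); rewrite coef_poly ltn_ord coef0 /c' inord_val.
  exact: ci0.
rewrite (eval_at_widen _ (size_poly _ _)) -[RHS]E; apply: eq_bigr => j _.
by rewrite coef_poly ltn_ord /c' inord_val -tnth_nth tnth_mktuple.
Qed.

Lemma nil_or_eigen (P : U -> Prop) :
  (forall a u v, P u -> P v -> P (a *: u + v)) -> (forall u, P u -> P (T u)) ->
  forall z, P z -> (exists m, iter m T z = 0) \/
    exists a v, [/\ a != 0, v != 0, P v & T v = a *: v].
Proof.
move=> PD PT z Pz; have [p nz_p] := eval_at_annihilator z.
have [r ->] := closed_field_poly_normal p.
have evZ c q w : eval_at (c *: q) w = c *: eval_at q w.
  rewrite (eval_at_widen _ (size_scale_leq _ _)) scaler_sumr.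
  by apply: eq_bigr => i _; rewrite coefZ scalerA.
rewrite evZ => /eqP; rewrite scaler_eq0 lead_coef_eq0 (negbTE nz_p) /= => /eqP.
have PB a w : P w -> P (T w - a *: w).
  by move=> Pw; rewrite addrC -scaleNr; apply: PD => //; apply: PT.
have Pev s w : P w -> P (eval_at (\prod_(a <- s) ('X - a%:P)) w).
  move=> Pw; elim: s => [|a s IHs].
    rewrite big_nil /eval_at size_poly1 big_ord1 /=.
    by rewrite coef1 scale1r.
  by rewrite big_cons eval_at_factor; apply: PB.
have evT q w : eval_at q (T w) = T (eval_at q w).
  by rewrite /eval_at linear_sum; apply: eq_bigr => i _; rewrite linearZ -iterSr.
elim: r z Pz => [|a r IHr] z Pz.
  by rewrite big_nil /eval_at size_poly1 big_ord1 /= coef1 scale1r; left; exists 0%N.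
rewrite big_cons eval_at_factor.
have [->|nz_a] := eqVneq a 0.
  rewrite scale0r subr0 -evT => /IHr[]; first exact: PT.
    by case=> m Em; left; exists m.+1; rewrite iterSr.
  by right.
have [E0 _|nz_v] := eqVneq (eval_at (\prod_(a <- r) ('X - a%:P)) z) 0; first exact: IHr.
move=> /eqP; rewrite subr_eq0 => /eqP E; right.
by exists a, (eval_at (\prod_(a <- r) ('X - a%:P)) z); split=> //; apply: Pev.
Qed.

End NilOrEigen.

Section Submodules.
Variables (k : fieldType) (A : falgType k).
Implicit Types (V Y : fdmodule A).

Lemma mod_homM V W Z (f : 'M[k]_(mdim W, mdim V)) (g : 'M[k]_(mdim Z, mdim W)) :
  mod_hom f -> mod_hom g -> mod_hom (g *m f).
Proof. by move=> fP gP a; rewrite -mulmxA fP !mulmxA gP. Qed.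

Section Sub.
Variables (V : fdmodule A) (d : nat) (u : 'M[k]_(mdim V, d)) (v : 'M[k]_(d, mdim V)).
Hypotheses (vu : v *m u = 1%:M) (stab : forall a, mact V a *m u = u *m (v *m mact V a *m u)).

Definition sub_act a : 'M[k]_d := v *m mact V a *m u.

Lemma sub_linear : linear sub_act.
Proof.
by move=> c a b; rewrite /sub_act linearP mulmxDr mulmxDl -scalemxAr -scalemxAl.
Qed.

Lemma sub_act1 : sub_act 1 = 1%:M.
Proof. by rewrite /sub_act mact1 mulmx1. Qed.

Lemma sub_actM a b : sub_act (a * b) = sub_act a *m sub_act b.
Proof. by rewrite /sub_act mactM !mulmxA -!(mulmxA (v *m _)) (stab b) !mulmxA. Qed.

Definition sub_mod : fdmodule A := FdModule sub_linear sub_act1 sub_actM.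

End Sub.

Lemma submoduleP V (W : {vspace 'cV[k]_(mdim V)}) :
  (forall a w, w \in W -> mact V a *m w \in W) ->
  exists Y (f : 'M[k]_(mdim V, mdim Y)),
    [/\ mod_hom f, hom_inj f & forall w, w \in W <-> exists y, f *m y = w].
Proof.
move=> stab; pose u : 'M[k]_(mdim V, \dim W) := \matrix_(i, j) (vbasis W)`_j i 0.
pose v : 'M[k]_(\dim W, mdim V) := \matrix_(i, j) coord (vbasis W) i (delta_mx j 0).
have uE (y : 'cV_(\dim W)) : u *m y = \sum_j y j 0 *: (vbasis W)`_j.
  apply/matrixP => i j; rewrite !mxE summxE; apply: eq_bigr => l _.
  by rewrite !mxE (ord1 j) mulrC.
have vE (w : 'cV_(mdim V)) : v *m w = \col_i coord (vbasis W) i w.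
  apply/matrixP => i j; rewrite !mxE {2}[w]matrix_sum_delta linear_sum.
  apply: eq_bigr => l _; rewrite big_ord1 !mxE linearZ (ord1 j) mulrC.
  by [].
have uvW w : w \in W -> u *m (v *m w) = w.
  move=> wW; rewrite uE vE [RHS](coord_vbasis wW).
  by apply: eq_bigr => j _; rewrite mxE.
have uW y : u *m y \in W.
  rewrite uE memv_suml // => j _; apply: memvZ; apply: vbasis_mem.
  by apply: mem_nth; rewrite size_tuple.
have colE m n (M : 'M[k]_(m, n)) M' : (forall x : 'cV_n, M *m x = M' *m x) -> M = M'.
  move=> E; apply/matrixP => i j; have /matrixP/(_ i 0) := E (delta_mx j 0).
  by rewrite -!colE !mxE.
have vu : v *m u = 1%:M.
  apply: colE => y; rewrite mul1mx -mulmxA vE uE; apply/matrixP => i j.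
  rewrite mxE coord_sum_free ?(ord1 j) //; exact: basis_free (vbasisP _).
have stabu a : mact V a *m u = u *m (v *m mact V a *m u).
  by apply: colE => y; rewrite -!mulmxA uvW //; apply: stab.
exists (sub_mod vu stabu), u; split=> [a|y E|w].
- by rewrite [RHS]stabu.
- by rewrite -[y]mul1mx -vu -mulmxA E mulmx0.
split=> [wW|[y <-]]; last exact: uW.
by exists (v *m w); apply: uvW.
Qed.

Lemma hom_inj_free V Y (f : 'M[k]_(mdim V, mdim Y)) : hom_inj f -> row_free f^T.
Proof.
move=> inj_f; apply/inj_row_free => w E; apply: trmx_inj; rewrite trmx0; apply: inj_f.
by apply: trmx_inj; rewrite trmx_mul trmxK E trmx0.
Qed.

Lemma hom_inj_rank V Y (f : 'M[k]_(mdim V, mdim Y)) : hom_inj f -> (mdim Y <= mdim V)%N.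
Proof. by move=> /hom_inj_free; rewrite /row_free => /eqP <-; apply: rank_leq_col. Qed.

Lemma hom_inj_surj V Y (f : 'M[k]_(mdim V, mdim Y)) :
  hom_inj f -> mdim Y = mdim V -> hom_surj f.
Proof.
move=> /hom_inj_free inj_f E y.
have /row_fullP[g gf] : row_full f^T by apply/eqP; rewrite -[RHS]E; apply/eqP.
exists (g^T *m y); rewrite mulmxA -[f]trmxK -trmx_mul gf trmx1 mul1mx //.
Qed.

Lemma simple_submodule V : mdim V <> 0%N ->
  exists S (f : 'M[k]_(mdim V, mdim S)), [/\ simple_mod S, mod_hom f & hom_inj f].
Proof.
have [n] := ubnP (mdim V); elim: n V => // n IHn V ltVn nz_V.
have [simV|] := classic (simple_mod V).
  exists V, 1%:M; split=> // [a|x]; first by rewrite mul1mx mulmx1.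
  by rewrite mul1mx.
move=> /not_and_or[/NNPP/nz_V //|nsim].
have [Y nY] := not_all_ex_not _ _ nsim; have [f nf] := not_all_ex_not _ _ nY.
have [homf nf1] := imply_to_and _ _ nf; have [injf nf2] := imply_to_and _ _ nf1.
have [nz_Y nsurj] := not_or_and _ _ nf2.
have ltYV : (mdim Y < mdim V)%N.
  rewrite ltn_neqAle (hom_inj_rank injf) andbT; apply/eqP => E.
  by apply: nsurj; apply: hom_inj_surj E.
have [|S [g [simS homg injg]]] := IHn Y _ nz_Y; first exact: leq_trans ltYV _.
exists S, (f *m g); split=> //; first exact: mod_homM.
by move=> x; rewrite -mulmxA => /injf/injg.
Qed.

End Submodules.

Section Simple.
Variables (k : fieldType) (A : falgType k) (S : fdmodule A).
Hypothesis simS : simple_mod S.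

Lemma simple_subspace (P : 'cV[k]_(mdim S) -> Prop) :
  P 0 -> (forall a u v, P u -> P v -> P (a *: u + v)) ->
  (forall a u, P u -> P (mact S a *m u)) ->
  (forall u, P u -> u = 0) \/ (forall u, P u).
Proof.
move=> P0 PD Pact; have [W WP] := vspace_of_pred P0 PD.
have [|Y [f [homf injf imf]]] := @submoduleP _ _ S W.
  by move=> a w /WP Pw; apply/WP/Pact.
have [_ /(_ Y f homf injf)[Y0|surjf]] := simS; last first.
  by right=> u; apply/WP/imf; have [x <-] := surjf u; exists x.
left=> u /WP/imf[y <-]; rewrite (_ : y = 0) ?mulmx0 //.
by apply/matrixP => -[i lti] j; exfalso; move: lti; rewrite Y0.
Qed.

Lemma simple_col (v w : 'cV[k]_(mdim S)) : v <> 0 -> exists a, mact S a *m v = w.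
Proof.
move=> nz_v; have [|c u u' [a <-] [b <-]|b u [a <-]|P0|Pall] :=
  simple_subspace (P := fun u => exists a, mact S a *m v = u); last exact: Pall.
- by exists 0; rewrite linear0 mul0mx.
- by exists (c *: a + b); rewrite linearP mulmxDl scalemxAl.
- by exists (b * a); rewrite mactM mulmxA.
by case: nz_v; apply: P0; exists 1; rewrite mact1 mul1mx.
Qed.

(** The vectors killed by all rows xi a form a proper submodule of S, hence 0; so these rows span
    everything. *)
Lemma simple_row (xi eta : 'rV[k]_(mdim S)) : xi <> 0 -> exists a, xi *m mact S a = eta.
Proof.
move=> nz_xi.
have kill (w : 'cV_(mdim S)) : (forall a, xi *m mact S a *m w = 0) -> w = 0.
  have [|c u u' Hu Hu' a|b u Hu a|P0|Pall] :=
    simple_subspace (P := fun w => forall a, xi *m mact S a *m w = 0).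
  - by move=> a; rewrite mulmx0.
  - by rewrite mulmxDr -scalemxAr Hu Hu' scaler0 addr0.
  - by rewrite mulmxA -[xi *m _ *m _]mulmxA -mactM.
  - exact: P0.
  case: nz_xi; apply/matrixP => i j; have := Pall (delta_mx j 0) 1.
  by rewrite mact1 mulmx1 -colE => /matrixP/(_ i 0); rewrite !mxE.
have [W WP] : exists W : {vspace 'rV[k]_(mdim S)},
    forall u, u \in W <-> exists a, xi *m mact S a = u.
  apply: vspace_of_pred => [|c u u' [a <-] [b <-]]; first by exists 0; rewrite linear0 mulmx0.
  by exists (c *: a + b); rewrite linearP mulmxDr scalemxAr.
pose M : 'M[k]_(\dim W, mdim S) := \matrix_(i, j) (vbasis W)`_i 0 j.
have rowM i : row i M = (vbasis W)`_i by apply/rowP => j; rewrite !mxE.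
have: row_full M.
  suff: row_free M^T by rewrite /row_free /row_full mxrank_tr.
  apply/inj_row_free => w E; apply: trmx_inj; rewrite trmx0; apply: kill => a.
  have /(coord_vbasis) -> : xi *m mact S a \in W by apply/WP; exists a.
  rewrite mulmx_suml big1 // => i _; rewrite -rowM -scalemxAl -row_mul.
  by rewrite -[M]trmxK -trmx_mul E trmx0 row0 scaler0.
case/row_fullP => N NM; apply/WP.
rewrite -[eta]mulmx1 -NM mulmxA mulmx_sum_row memv_suml // => i _.
apply: memvZ; rewrite rowM; apply: vbasis_mem; apply: mem_nth; rewrite size_tuple.
exact: ltn_ord.
Qed.

End Simple.

(** Schur's lemma: the kernel of phi - c, for c an eigenvalue, is a nonzero submodule. *)
Lemma simple_schur (k : closedFieldType) (A : falgType k) (S : fdmodule A)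
    (phi : 'M[k]_(mdim S)) :
  simple_mod S -> @mod_hom k A S S phi -> exists c, phi = c%:M.
Proof.
move=> simS homphi; have nz_S : mdim S <> 0%N by case: simS.
have [c] : exists c, root (char_poly phi^T) c.
  by apply/closed_rootP; rewrite size_char_poly eqSS; exact/eqP.
rewrite -eigenvalue_root_char => /eigenvalueP[v Ev nz_v].
exists c; apply/eqP; rewrite -subr_eq0; apply/eqP.
have [|a u w Hu Hw|a u Hu|P0|Pall] :=
  simple_subspace simS (P := fun w => (phi - c%:M) *m w = 0).
- by rewrite mulmx0.
- by rewrite mulmxDr -scalemxAr Hu Hw scaler0 addr0.
- by rewrite mulmxA mulmxBl homphi -scalar_mxC -mulmxBr -mulmxA Hu mulmx0.
- case/eqP: nz_v; apply: trmx_inj; rewrite trmx0; apply: P0.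
  by rewrite mulmxBl mul_scalar_mx -[phi]trmxK -trmx_mul Ev linearZ subrr.
apply/matrixP => i j; have /matrixP/(_ i 0) := Pall (delta_mx j 0).
by rewrite -colE !mxE.
Qed.

(** * Infinitesimal linearly reductive groups are diagonalizable *)

(** The Leibniz rule in the abstract: [S] raises one of two indices. In characteristic p it serves
    three times, for the Frobenius map, for p-th powers of derivations, and for ad(y^p) =
    ad(y)^p. *)
Lemma binomial_iter (U : zmodType) (S : {additive U -> U}) (h : nat -> nat -> U) :
  (forall i j, S (h i j) = h i.+1 j + h i j.+1) ->
  forall n, iter n S (h 0 0) = \sum_(i < n.+1) h i (n - i)%N *+ 'C(n, i).
Proof.
move=> Sh; elim=> [|n IHn]; first by rewrite big_ord1 mulr1n.
rewrite iterS IHn raddf_sum.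
under eq_bigr => i _ do rewrite raddfMn /= Sh mulrnDl.
rewrite big_split /= [RHS]big_ord_recl bin0 /=.
under [in RHS]eq_bigr => i _ do rewrite /bump /= binS mulrnDr subSS.
rewrite [in RHS]big_split /= addrA [RHS]addrC; congr (_ + _).
rewrite [LHS]big_ord_recl [in RHS]big_ord_recr /= (bin_small (ltnSn n)) mulr0n addr0.
rewrite bin0 subn0; congr (_ + _); apply: eq_bigr => i _.
by rewrite /bump /= subnSK.
Qed.

Lemma binomial_iter_char (U : zmodType) (S : {additive U -> U}) (h : nat -> nat -> U) p :
  prime p -> (forall u : U, u *+ p = 0) -> (forall i j, S (h i j) = h i.+1 j + h i j.+1) ->
  iter p S (h 0 0) = h 0 p + h p 0.
Proof.
move=> pr_p Up Sh; rewrite (binomial_iter Sh); have := prime_gt0 pr_p.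
case: p pr_p Up => // p pr_p Up _.
rewrite big_ord_recl big_ord_recr /= bin0 binn subn0 subnn !mulr1n big1 ?add0r // => i _.
have /dvdnP[m ->] : (p.+1 %| 'C(p.+1, bump 0 i))%N; last by rewrite mulrnA Up.
by apply: prime_dvd_bin => //=; have := ltn_ord i; rewrite /bump /=; lia.
Qed.

Lemma lmod_pchar (k : fieldType) (U : lmodType k) p (u : U) : p \in [pchar k] -> u *+ p = 0.
Proof. by move=> charp; rewrite -scaler_nat (pcharf0 charp) scale0r. Qed.

(** Additivity of Frobenius, stated for pairwise commuting elements because it is applied to
    matrices as well as to polynomials. *)
Lemma expp_sum (R : pzRingType) p (I : Type) (s : seq I) (F : I -> R) :
  prime p -> (forall u : R, u *+ p = 0) -> (forall i j, F i * F j = F j * F i) ->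
  forall r, (\sum_(i <- s) F i) ^+ (p ^ r) = \sum_(i <- s) F i ^+ (p ^ r).
Proof.
move=> pr_p Rp; have addp u v : u * v = v * u -> (u + v) ^+ p = u ^+ p + v ^+ p :> R.
  move=> cuv; pose h i j := u ^+ i * v ^+ j.
  have Sh i j : (u + v) * h i j = h i.+1 j + h i j.+1.
    rewrite /h mulrDl mulrA -exprS; congr (_ + _).
    by rewrite mulrA (commrX i (esym cuv : GRing.comm v u)) -mulrA -exprS.
  have := binomial_iter_char (S := (u + v) \*o idfun) pr_p Rp Sh.
  rewrite [h 0%N p]mul1r [h p 0%N]mulr1 [RHS]addrC => <-.
  rewrite -[LHS]mulr1 [h _ _]mulr1 expr0.
  by elim: (p) => [|n IHn] /=; rewrite ?mul1r // exprS -IHn mulrA.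
have addps (G : I -> R) : (forall i j, G i * G j = G j * G i) ->
    (\sum_(i <- s) G i) ^+ p = \sum_(i <- s) G i ^+ p.
  move=> cG; elim: s => [|i s' IHs]; first by rewrite !big_nil expr0n gtn_eqF ?prime_gt0.
  rewrite !big_cons addp ?IHs // mulr_suml mulr_sumr.
  by apply: eq_bigr => j _; apply: cG.
move=> cF r; elim: r F cF => [|r IHr] F cF.
  by rewrite expr1; apply: eq_bigr => i _; rewrite expr1.
rewrite expnS exprM addps // IHr => [|i j]; first by apply: eq_bigr => i _; rewrite exprM.
by apply: commrX; apply/esym/commrX/esym/cF.
Qed.

(** Pigeonhole: in a long product over [s] either b occurs often enough to vanish, or many factors
    come from the rest. *)
Lemma prod_nilpotent (R : comNzRingType) (s : seq R) :
  (forall x, x \in s -> exists n, x ^+ n = 0) ->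
  exists N, forall t, {subset t <= s} -> (N <= size t)%N -> \prod_(x <- t) x = 0.
Proof.
elim: s => [|b s IHs] nil_s.
  by exists 1%N => -[|x t] // sub_t _; have := sub_t x (mem_head _ _).
have [|N HN] := IHs; first by move=> x sx; apply: nil_s; rewrite inE sx orbT.
have [n bn] := nil_s b (mem_head _ _).
exists (n + N)%N => t sub_t le_t.
rewrite (bigID (pred1 b)) /= (eq_bigr (fun=> b)) => [|x /eqP //].
rewrite big_const_seq iter_mulr_1.
have [le_n|lt_n] := leqP n (count (pred1 b) t).
  by rewrite -(subnK le_n) exprD bn mulr0 mul0r.
rewrite -big_filter HN ?mulr0 // => [x|].
  by rewrite mem_filter => /andP[/negbTE nb /sub_t]; rewrite inE nb.
rewrite size_filter -(leq_add2l (count (pred1 b) t)) count_predC.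
by apply: leq_trans le_t; rewrite leq_add2r ltnW.
Qed.

Section SpanNilpotent.
Variables (k : fieldType) (A : falgType k) (s : seq A).

Lemma span_expv_mul n N (t : seq A) x :
  (forall t, {subset t <= s} -> (N <= size t)%N -> \prod_(x <- t) x = 0) ->
  {subset t <= s} -> (N <= n + size t)%N -> x \in (<<s>> ^+ n)%VS ->
  x * \prod_(y <- t) y = 0.
Proof.
move=> HN; elim: n t x => [|n IHn] t x sub_t le_N.
  by rewrite expv0 => /vlineP[a ->]; rewrite -scalerAl mul1r HN // scaler0.
rewrite expvSr; set z := \prod_(y <- t) y => xU.
suff /subvP/(_ x xU) : (<<s>> ^+ n * <<s>> <= lker (amulr z))%VS.
  by rewrite memv_ker lfunE => /eqP.
apply/prodvP => u v uU /(@coord_span _ _ _ (in_tuple s)) ->; rewrite memv_ker lfunE /= mulr_sumr mulr_suml.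
apply/eqP; rewrite big1 // => i _; rewrite -scalerAr -scalerAl -mulrA.
have si : s`_i \in s by apply: mem_nth.
have := IHn (s`_i :: t) u; rewrite big_cons => -> //; first by rewrite scaler0.
  by move=> y; rewrite inE => /predU1P[->|/sub_t].
by rewrite /= addnS.
Qed.

End SpanNilpotent.

Lemma counitZ (k : fieldType) (B : finCommHopfType k) c (x : B) :
  counit (c *: x) = c * counit x :> k.
Proof. by rewrite -!galg_app1 galg_appZ. Qed.

Lemma nil_expv0 (k : fieldType) (A : finCommHopfType k) (U : {vspace A}) :
  (forall x, x \in U -> exists n, x ^+ n = 0) -> exists N, (U ^+ N)%VS = 0%VS.
Proof.
move=> nilU; have [|N HN] := @prod_nilpotent A (vbasis U); first by move=> x /vbasis_mem/nilU.
exists N; apply/eqP; rewrite -subv0; apply/subvP => x; rewrite -{1}(span_basis (vbasisP U)).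
move=> xN; have := span_expv_mul (t := [::]) HN _ _ xN.
by rewrite addn0 big_nil mulr1 memv0 => ->.
Qed.

Section AugmentationIdeal.
Variables (k : closedFieldType) (A : finCommHopfType k).
Hypothesis connA : forall c : A, c * c = c -> c = 0 \/ c = 1.

Lemma counit_horner (a : A) p : counit (horner_alg a p) = p.[counit a] :> k.
Proof.
elim/poly_ind: p => [|p c IHp]; first by rewrite !raddf0 horner0.
rewrite !rmorphD !rmorphM /= horner_algX horner_algC IHp hornerMXaddC rmorph_alg.
by congr (_ + _); rewrite -[RHS]mulr1.
Qed.

(** A Fitting decomposition: write an annihilating polynomial of a as X^m q with q(0) != 0; a Bezout
    relation yields an idempotent, which connectedness makes trivial. *)
Lemma aug_nilpotent (a : A) : counit a = 0 :> k -> exists n, a ^+ n = 0.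
Proof.
move=> a0; pose T : {linear A -> A} := amull a.
have evT p : eval_at T p 1 = horner_alg a p.
  rewrite -[in RHS](coefK p) poly_def linear_sum; apply: eq_bigr => i _.
  rewrite linearZ /= rmorphXn /= horner_algX.
  suff -> : iter i T 1 = a ^+ i by rewrite mulr_algl.
  by elim: (i : nat) => [|j IHj] /=; rewrite ?expr0 // IHj lfunE exprS.
have [p nz_p] := eval_at_annihilator T 1; rewrite evT => pa.
have [m [q nroot_q def_p]] := multiplicity_XsubC p 0.
move: nroot_q; rewrite nz_p /= => nroot_q.
have cop : coprimep (('X - 0%:P) ^+ m) q by rewrite coprimep_expl // coprimep_sym coprimep_XsubC.
have [[u w] /= Euw] := Bezout_eq1_coprimepP _ _ cop.
have [h hE] : exists h : {rmorphism {poly k} -> A}, h =1 horner_alg a by exists (horner_alg a).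
exists m; rewrite -hE in pa.
have hX : h (('X - 0%:P) ^+ m) = a ^+ m by rewrite polyC0 subr0 rmorphXn hE horner_algX.
have pa' : h q * a ^+ m = 0 by rewrite -pa def_p rmorphM hX.
have Ea : h u * a ^+ m + h w * h q = 1 by rewrite -hX -!rmorphM -rmorphD Euw rmorph1.
(* The element w(a) q(a) is idempotent since q(a) a^m = 0. Its counit is w(0) q(0) = 1 if m > 0,
   while for m = 0 the equation q(a) = 0 contradicts q(0) != 0. So it is 1, whence a^m = 0. *)
have [c0|c1] : h w * h q = 0 \/ h w * h q = 1.
- apply: connA; rewrite -[RHS]mulr1 -Ea mulrDr [X in _ = X + _](_ : _ = 0) ?add0r //.
  by rewrite mulrCA -mulrA pa' !mulr0.
- have /(congr1 (fun x => counit x : k)) := c0; rewrite rmorphM /= !hE !counit_horner a0.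
  have := congr1 (horner^~ 0) Euw; rewrite hornerD !hornerM.
  rewrite hornerC; case: m {def_p cop Euw hX Ea} pa' => [|m] pa' /=.
    have : counit (h q) = 0 :> k by rewrite -[h q]mulr1 -[1](expr0 a) pa' raddf0.
    by rewrite hE counit_horner a0 => /eqP; rewrite -[_ == 0]/(root q 0) (negbTE nroot_q).
  have -> : (('X - 0%:P : {poly k}) ^+ m.+1).[0] = 0.
    by rewrite horner_exp hornerXsubC subr0 expr0n.
  rewrite mulr0 add0r => ->.
  by rewrite raddf0 => /eqP; rewrite oner_eq0.
by rewrite -[LHS]mul1r -c1 -mulrA pa' mulr0.
Qed.

Definition aug : {vspace A} := lker (linfun (counit : A -> k^o)).

Lemma mem_aug (a : A) : (a \in aug) = (counit a == 0 :> k).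
Proof. by rewrite memv_ker lfunE. Qed.

Lemma aug_expv0 : exists N, (aug ^+ N)%VS = 0%VS.
Proof. by apply: nil_expv0 => x; rewrite mem_aug => /eqP/aug_nilpotent. Qed.

Lemma aug_exprn0 : exists N, forall a : A, counit a = 0 :> k -> a ^+ N = 0.
Proof.
have [N EN] := aug_expv0; exists N => a a0; apply/eqP; rewrite -memv0 -EN.
by elim: N {EN} => [|N IHN]; rewrite ?memv_line // expvSl exprS memv_mul // mem_aug a0.
Qed.

(** Geometric series: a divided by its counit is 1 minus a nilpotent. *)
Lemma counit_unit (a : A) : counit a <> 0 :> k -> exists b, b * a = 1.
Proof.
move=> /eqP nz_a; have [N EN] := aug_exprn0.
pose c := 1 - (counit a : k)^-1 *: a.
have /EN cN : counit c = 0 :> k.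
  by rewrite raddfB /= counitZ rmorph1 mulVf // subrr.
exists ((\sum_(i < N) c ^+ i) * (counit a : k)^-1%:A).
rewrite -mulrA mulr_algl.
have -> : (counit a : k)^-1 *: a = 1 - c by rewrite opprB addrC subrK.
have := subrXX 1 c N; rewrite expr1n cN subr0 => E.
rewrite mulrC [RHS]E; congr (_ * _); apply: eq_bigr => i _.
by rewrite expr1n mul1r.
Qed.

End AugmentationIdeal.

Section Derivations.
Variables (k : fieldType) (A : finCommHopfType k).
Implicit Types (y z mu nu : galg A) (a b : A).

(* The derivative along mu of left translations. *)
Definition lder mu a : A := \sum_(p <- comul a) galg_app mu p.1 *: p.2.

Lemma lder_bilinear mu : bilinear_map (fun b c : A => galg_app mu b *: c).
Proof.
split=> [? a ? ?|? a ? ?]; first by rewrite galg_app_linear scalerDl scalerA.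
by rewrite scalerDr !scalerA mulrC.
Qed.

Lemma lder_linear mu : linear (lder mu).
Proof.
move=> c a b; rewrite /lder (comul_linear c a b _ _ (lder_bilinear mu)).
rewrite big_cat /= big_map scaler_sumr; congr (_ + _).
by apply: eq_bigr => p _ /=; rewrite galg_appZ scalerA.
Qed.

HB.instance Definition _ mu := GRing.isLinear.Build k A A *:%R (lder mu) (@lder_linear mu).

Lemma galg_lder mu nu a : galg_app nu (lder mu a) = galg_app (mu * nu) a.
Proof.
by rewrite galg_app_sum galgM; apply: eq_bigr => p _; rewrite galg_appZ.
Qed.

Lemma counit_lder mu a : counit (lder mu a) = galg_app mu a :> k.
Proof. by rewrite -galg_app1 galg_lder mulr1. Qed.

Lemma galg_iter_lder mu nu n a :
  galg_app nu (iter n (lder mu) a) = galg_app (mu ^+ n * nu) a.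
Proof.
elim: n nu => [|n IHn] nu; first by rewrite mul1r.
by rewrite galg_lder IHn exprSr mulrA.
Qed.

(** The elements of the Lie algebra, as point derivations at the identity; for such y the operator
    [lder y] is a derivation of k[G]. *)
Definition primitive y := forall a b,
  galg_app y (a * b) = galg_app y a * counit b + counit a * galg_app y b.

Lemma primitive1 y : primitive y -> galg_app y 1 = 0.
Proof.
move=> /(_ 1 1); rewrite mulr1 rmorph1 mulr1 mul1r => /eqP.
by rewrite -subr_eq subrr eq_sym => /eqP.
Qed.

Lemma lderM y a b : primitive y -> lder y (a * b) = lder y a * b + a * lder y b.
Proof.
move=> py; rewrite -[X in _ = _ * X + _]counitl -[X in _ = _ + X * _]counitl.
rewrite /lder (comulM a b _ _ (lder_bilinear y)) big_allpairs_dep /= !mulr_suml -big_split; apply: eq_bigr => p _ /=.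
rewrite !mulr_sumr -big_split; apply: eq_bigr => q _ /=.
by rewrite py scalerDl -!scalerAl -!scalerAr !scalerA.
Qed.

Lemma lder1 y : primitive y -> lder y 1 = 0.
Proof.
move=> py; apply: galg_sep => nu; rewrite galg_lder galgM.
rewrite (comul1 _ _ (mul_bilinear y nu)) big_seq1 /= primitive1 // mul0r.
by rewrite raddf0.
Qed.

Lemma primitiveP c y z : primitive y -> primitive z -> primitive (c *: y + z).
Proof.
move=> py pz a b; rewrite !galgDE !galgZE py pz !mulrDr !mulrDl !mulrA.
by rewrite [c * counit a]mulrC addrACA.
Qed.

Lemma primitive0 : primitive 0.
Proof. by move=> a b; rewrite !galg0E mul0r mulr0 addr0. Qed.

Lemma galgM_prim y z a b : primitive y -> primitive z ->
  galg_app (y * z) (a * b) = galg_app (y * z) a * counit b + counit a * galg_app (y * z) b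
    + (galg_app y a * galg_app z b + galg_app z a * galg_app y b).
Proof.
move=> py pz; rewrite -!galg_lder lderM // galg_appD !pz !counit_lder.
by rewrite [X in _ + X = _]addrC addrACA.
Qed.

Definition brac y z : galg A := y * z - z * y.

Lemma primitive_brac y z : primitive y -> primitive z -> primitive (brac y z).
Proof.
move=> py pz a b; rewrite /brac -scaleN1r !galgDE !galgZE !galgM_prim //.
rewrite !mulN1r opprD addrACA [X in _ + X](_ : _ = 0) ?addr0.
  by rewrite opprD addrACA mulrBl mulrBr.
by rewrite [X in _ - X]addrC subrr.
Qed.

(** The p-th power of a derivation is a derivation: the inner binomial terms vanish. *)
Lemma primitive_expp y p : p \in [pchar k] -> primitive y -> primitive (y ^+ p).
Proof.
move=> charp py a b; rewrite -[y ^+ p]mulr1 -!galg_iter_lder !galg_app1.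
pose h i j := iter i (lder y) a * iter j (lder y) b.
rewrite (binomial_iter_char (S := lder y) (h := h) (pcharf_prime charp)) => [|u|i j]; last 1 first.
- by rewrite /h /= lderM.
- by rewrite /h /= rmorphD !rmorphM addrC.
exact: lmod_pchar.
Qed.

Lemma brac_linear y : linear (brac y).
Proof.
move=> a u v; rewrite /brac mulrDr mulrDl -scalerAl -scalerAr opprD addrACA.
by rewrite scalerBr.
Qed.

HB.instance Definition _ y := GRing.isLinear.Build k (galg A) (galg A) *:%R (brac y)
  (@brac_linear y).

Lemma brac_expp y z p : p \in [pchar k] -> brac (y ^+ p) z = iter p (brac y) z.
Proof.
move=> charp; pose h i j := (-1) ^+ j *: (y ^+ i * z * y ^+ j).
have -> : z = h 0 0 by rewrite /h scale1r mulr1 mul1r.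
rewrite (binomial_iter_char (S := brac y) (h := h) (pcharf_prime charp)) => [|u|i j]; last 1 first.
- by rewrite /h /= /brac -scalerAr -scalerAl !mulrA -exprS -[_ * y ^+ j * y]mulrA -exprSr [(-1) ^+ j.+1]exprS mulN1r scaleNr.
- rewrite /h /brac !mulr1 !scale1r !mul1r addrC.
  suff -> : (-1) ^+ p = -1 :> k by rewrite scaleN1r.
  by have := pFrobenius_autN charp 1; rewrite !pFrobenius_autE expr1n.
exact: lmod_pchar.
Qed.

Lemma brac_expp_iter y z p r : p \in [pchar k] ->
  brac (y ^+ (p ^ r)) z = iter (p ^ r) (brac y) z.
Proof.
move=> charp; elim: r y z => [|r IHr] y z; first by rewrite expr1.
rewrite expnS exprM IHr; have E u : brac (y ^+ p) u = iter p (brac y) u by apply: brac_expp.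
by rewrite mulnC; elim: (p ^ r)%N => //= n ->; rewrite E -iterD.
Qed.

Lemma primitive_expp_iter y p r :
  p \in [pchar k] -> primitive y -> primitive (y ^+ (p ^ r)).
Proof.
move=> charp; elim: r y => [|r IHr] y py; first by rewrite expr1.
by rewrite expnS exprM; apply/IHr/primitive_expp.
Qed.

End Derivations.

(** * The Lie algebra of a connected group with a normalized integral *)

Section Toral.
Variables (k : closedFieldType) (A : finCommHopfType k).
Hypothesis connA : forall c : A, c * c = c -> c = 0 \/ c = 1.
Variable e : galg A.
Hypotheses (eint : forall nu, nu * e = galg_app nu 1 *: e) (e1 : galg_app e 1 = 1).
Implicit Types (y z : galg A) (a b x : A).

Lemma lderX y x n : primitive y -> lder y (x ^+ n.+1) = (x ^+ n * lder y x) *+ n.+1.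
Proof.
move=> py; elim: n => [|n IHn]; first by rewrite expr1 mul1r.
rewrite exprS lderM // IHn [RHS]mulrS mulrnAr mulrA -exprS; congr (_ + _).
by rewrite mulrC.
Qed.

Lemma primitive_dual y : primitive y -> y != 0 ->
  exists x, galg_app y x = 1 /\ counit x = 0 :> k.
Proof.
move=> py nz_y; have [x /eqP nz_yx] : exists x, galg_app y x <> 0.
  apply: not_all_not_ex => y0; case/eqP: nz_y; apply: galgP => x.
  by rewrite galg0E; apply: NNPP; apply: y0.
have yc c : galg_app y (c%:A) = 0 by rewrite galg_appZ primitive1 // mulr0.
exists ((galg_app y x)^-1 *: (x - (counit x : k)%:A)); split.
  by rewrite galg_appZ galg_appD -scaleNr yc addr0 mulVf.
by rewrite counitZ raddfB /= counitZ rmorph1 mulr1 subrr mulr0.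
Qed.

(** Choose x in the augmentation ideal with y(x) = 1. It is nilpotent, and its derivative is a unit;
    differentiating the first vanishing power x^(m+1) gives m+1 = 0 in k. *)
Lemma primitive_pchar y : primitive y -> y != 0 -> exists p, p \in [pchar k].
Proof.
move=> py nz_y; have [x [yx1 x0]] := primitive_dual py nz_y.
have [b bDx] : exists b, b * lder y x = 1.
  by apply: counit_unit => //; rewrite counit_lder yx1; apply/eqP/oner_neq0.
have [N xN] := aug_nilpotent connA x0.
have [n /eqP xn minn] := ex_minnP (ex_intro (fun n => x ^+ n == 0) N (introT eqP xN)).
case: n xn minn => [/eqP|m xm minn]; first by rewrite oner_eq0.
have := lderX x m py; rewrite xm raddf0 -scaler_nat => /esym/(congr1 ( *%R b)).
rewrite mulr0 -scalerAr mulrCA bDx mulr1 => /eqP; rewrite scaler_eq0.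
by case/orP => [m0|/minn]; [apply: natf0_pchar m0|rewrite ltnn].
Qed.

Lemma prime_fact p n : prime p -> (n < p)%N -> ~~ (p %| n`!)%N.
Proof.
move=> pr_p; elim: n => [|n IHn] lt_np; first by rewrite dvdn1 neq_ltn prime_gt1 ?orbT.
by rewrite factS Euclid_dvdM // gtnNdvd //= IHn // ltnW.
Qed.

(** At i = n the counit of the right side is n! y(x)^n when x has counit 0, since the remainder
    keeps a factor x. *)
Lemma iter_lderX y x n i : primitive y -> (i <= n)%N ->
  exists w, iter i (lder y) (x ^+ n) =
    (x ^+ (n - i) * lder y x ^+ i) *+ n ^_ i + x ^+ (n - i).+1 * w.
Proof.
move=> py; elim: i => [|i IHi] lt_in; first by exists 0; rewrite subn0 mulr1 mulr0 addr0.
have [w Ew] := IHi (ltnW lt_in).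
have [m def_m] : exists m, (n - i = m.+1)%N by exists (n - i.+1)%N; rewrite subnSK.
have -> : (n - i.+1 = m)%N by rewrite subnS def_m.
have lderD a b : lder y (a + b) = lder y a + lder y b by exact: raddfD.
have lderMn a j : lder y (a *+ j) = lder y a *+ j by exact: raddfMn.
rewrite iterS Ew ffactnSr def_m lderD lderMn (lderM _ (_ ^+ i) py) (lderM _ w py) !lderX //; set u := lder y x.
exists (lder y (u ^+ i) *+ n ^_ i + u * w *+ m.+2 + x * lder y w).
rewrite 2!mulrDr mulrnDl !addrA; congr (_ + _ + _ + _).
- by rewrite mulrnAl -mulrA -exprS -mulrnA mulnC.
- by rewrite mulrnAr.
- by rewrite mulrnAl mulrnAr mulrA.
by rewrite mulrA -exprSr.
Qed.

(* The derivation D = lder y has D^p = 0, and v = D^(p-1) (x^(p-1)) is a unit   *)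
(* killed by D.  Hence 1 = D^(p-1) (v^-1 x^(p-1)), and the integral e, which    *)
(* vanishes on the image of D, would be 0 at 1.                                 *)
Lemma primitive_p_nil y p : p \in [pchar k] -> primitive y -> y ^+ p = 0 -> y = 0.
Proof.
move=> charp py yp; apply/eqP; apply: contraT => nz_y.
have pr_p := pcharf_prime charp.
have [x [yx1 x0]] := primitive_dual py nz_y.
have [[|q] def_p] : exists q, p = q.+1 by exists p.-1; rewrite prednK // prime_gt0.
  by move: pr_p; rewrite def_p.
pose D := lder y; pose v := iter q.+1 D (x ^+ q.+1).
have Dp a : iter p D a = 0.
  by apply: galg_sep => nu; rewrite galg_iter_lder yp mul0r galg0E raddf0.
have Dv : D v = 0 by rewrite -[D v]/(iter q.+2 D _) -def_p Dp.
have [b bv] : exists b, b * v = 1.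
  apply: counit_unit => //; rewrite /v; have [w ->] := iter_lderX x py (leqnn q.+1).
  rewrite subnn mul1r expr1 ffactnn rmorphD rmorphMn rmorphM rmorphXn /= counit_lder yx1 x0.
  rewrite mul0r addr0 expr1n => /eqP; rewrite -(dvdn_pcharf charp).
  by apply/negP/prime_fact; rewrite // def_p.
have Db : D b = 0.
  rewrite -[LHS]mulr1 -bv mulrCA; suff -> : D b * v = 0 by rewrite mulr0.
  have : lder y (b * v) = lder y 1 by rewrite bv.
  rewrite lderM // -!/(D _) Dv mulr0 addr0 => ->.
  exact: lder1.
have Dba i a : iter i D (b * a) = b * iter i D a.
  by elim: i => //= i ->; rewrite /D lderM // -!/(D _) Db mul0r add0r.
suff: galg_app e 1 = 0 by rewrite e1 => /eqP; rewrite oner_eq0.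
rewrite -bv /v -Dba /= galg_lder eint galgZE primitive1 //.
by rewrite mul0r.
Qed.

(** If y is nonzero and nilpotent, some y^(p^r) is a nonzero primitive element with zero p-th power,
    which [primitive_p_nil] excludes. *)
Lemma primitive_nil y n : primitive y -> y ^+ n = 0 -> y = 0.
Proof.
move=> py yn; apply/eqP; apply: contraT => nz_y.
have [p charp] := primitive_pchar py nz_y; have p_gt1 := prime_gt1 (pcharf_prime charp).
suff /(_ n) : forall r, y ^+ (p ^ r) != 0.
  by rewrite -(subnK (ltnW (ltn_expl n p_gt1))) exprD yn mulr0 eqxx.
elim=> [|r IHr]; first by rewrite expr1.
apply: contra IHr => /eqP E; apply/eqP; apply: (primitive_p_nil charp).
  exact: primitive_expp_iter.
by rewrite -exprM -expnSr.
Qed.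

Lemma closed_root (c : k) q : (0 < q)%N -> exists d : k, d ^+ q = c.
Proof.
move=> q_gt0; have [d Ed] := solve_monicpoly (fun i => if i == 0%N then c else 0) q_gt0.
exists d; rewrite Ed; case: q q_gt0 {Ed} => // q _.
by rewrite big_ord_recl mulr1 big1 ?addr0 // => i _; rewrite mul0r.
Qed.

(* In a linear relation between the y^(p^i), extract p-power roots of the       *)
(* coefficients so that the lowest term becomes y: the resulting primitive      *)
(* element is nilpotent, hence 0.                                               *)
Lemma primitive_expp_mem_pos y p (W : {vspace galg A}) :
  p \in [pchar k] -> primitive y ->
  (forall i, (0 < i)%N -> y ^+ (p ^ i) \in W) -> y \in W.
Proof.
move=> charp py HW; pose d := \dim {:galg A}.
pose X := [tuple y ^+ (p ^ i) | i < d.+1].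
have nfree : ~ free X.
  move=> /eqP; rewrite size_tuple => E.
  by have := dimvS (subvf <<X>>%VS); rewrite E ltnn.
have [c nc] : exists c : 'I_d.+1 -> k,
    ~ (\sum_(i < d.+1) c i *: X`_i = 0 -> forall i, c i = 0).
  by apply: not_all_ex_not => Hc; apply: nfree; exact/freeP.
have [Ec nc0] := imply_to_and _ _ nc; have [i0 /eqP ci0] := not_all_ex_not _ _ nc0.
pose c' i := if (i < d.+1)%N then c (inord i) else 0.
have Ec' : \sum_(i < d.+1) c' i *: y ^+ (p ^ i) = 0.
  rewrite -[RHS]Ec; apply: eq_bigr => i _; rewrite /c' ltn_ord inord_val.
  by rewrite -tnth_nth tnth_mktuple.
have exc : exists i, c' i != 0 by exists i0; rewrite /c' ltn_ord inord_val.
have [s nz_cs min_s] := ex_minnP exc.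
have q_gt0 : (0 < p ^ s)%N by rewrite expn_gt0 prime_gt0 // (pcharf_prime charp).
have /fin_all_exists[b Eb] : forall i : 'I_d.+1, exists b : k, b ^+ (p ^ s) = c' (i + s)%N.
  by move=> i; apply: closed_root.
pose P : {poly k} := \sum_i b i *: 'X^(p ^ i).
have hP : horner_alg y P = \sum_i b i *: y ^+ (p ^ i).
  rewrite linear_sum; apply: eq_bigr => i _.
  by rewrite linearZ /= rmorphXn /= horner_algX mulr_algl.
have Ps : horner_alg y P ^+ (p ^ s) = 0.
  rewrite -rmorphXn /P expp_sum ?(pcharf_prime charp) // => [|u|i j]; last 2 first.
  - exact: lmod_pchar.
  - exact: mulrC.
  rewrite rmorph_sum /= -[RHS]Ec'.
  have vanish i : (d.+1 <= i)%N -> c' i = 0 by move=> le_d; rewrite /c' ltnNge le_d.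
  transitivity (\sum_(i < d.+1) c' (i + s)%N *: y ^+ (p ^ (i + s))).
    apply: eq_bigr => i _; rewrite exprZn Eb linearZ /= -exprM -expnD rmorphXn /=.
    by rewrite horner_algX mulr_algl.
  rewrite -(big_mkord xpredT (fun i => c' (i + s)%N *: y ^+ (p ^ (i + s)))).
  rewrite -(big_mkord xpredT (fun i => c' i *: y ^+ (p ^ i))).
  have ext m : (d.+1 <= m)%N -> \sum_(0 <= i < d.+1) c' i *: y ^+ (p ^ i) =
      \sum_(0 <= i < m) c' i *: y ^+ (p ^ i).
    move=> le_m; rewrite [RHS](big_cat_nat (n := d.+1)) //= [X in _ = _ + X]big1_seq ?addr0 //.
    by move=> i /=; rewrite mem_index_iota => /andP[le_i _]; rewrite vanish // scale0r.
  rewrite (ext (d.+1 + s)%N) ?leq_addr // [RHS](big_cat_nat (n := s)) ?leq_addl //=.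
  rewrite [X in _ = X + _]big1_seq ?add0r => [|i].
    have := @big_addn _ _ +%R 0 (d.+1 + s) s xpredT (fun i => c' i *: y ^+ (p ^ i)).
    by rewrite add0n addnK => ->.
  rewrite mem_index_iota => /= lt_is; apply/eqP; rewrite scaler_eq0; apply/orP; left.
  by apply: contraTT lt_is => /min_s; rewrite -leqNgt.
have prP : primitive (horner_alg y P).
  rewrite hP; elim/big_rec: _ => [|i z _ pz]; first exact: primitive0.
  by apply: primitiveP => //; apply: primitive_expp_iter.
have := primitive_nil prP Ps; rewrite hP big_ord_recl expr1 => /eqP.
have nz_b0 : b ord0 != 0.
  by apply: contra nz_cs => /eqP b0; rewrite -[s]add0n -(Eb ord0) b0 expr0n (gtn_eqF q_gt0).
rewrite addr_eq0 => /eqP/(congr1 (fun u => (b ord0)^-1 *: u)).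
rewrite scalerA mulVf // scale1r => ->; rewrite memvZ // memvN memv_suml // => i _.
by rewrite memvZ // HW.
Qed.

(** Descend one step at a time, applying the previous lemma to the primitive element y^(p^r). *)
Lemma primitive_expp_mem y p r (W : {vspace galg A}) :
  p \in [pchar k] -> primitive y ->
  (forall i, (r <= i)%N -> y ^+ (p ^ i) \in W) -> y \in W.
Proof.
move=> charp py; elim: r => [|r IHr] HW; first by have := HW 0%N (leq0n _); rewrite expr1.
apply: IHr => i; rewrite leq_eqVlt => /predU1P[<-|/HW //].
apply: (primitive_expp_mem_pos charp) => [|j j_gt0]; first exact: primitive_expp_iter.
by rewrite -exprM -expnD HW // -addn1 leq_add2l.
Qed.

(** Consider ad(y) on the Lie algebra. If it is nilpotent at z, then y^(p^i) commutes with z for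
    large i, hence so does y. Otherwise there is an eigenvector v with nonzero eigenvalue a. *)
Lemma primitive_comm y z : primitive y -> primitive z -> y * z = z * y.
Proof.
move=> py pz; apply/eqP; rewrite -subr_eq0 -/(brac y z).
have [->|nz_y] := eqVneq y 0; first by rewrite /brac mulr0 mul0r subrr.
have [p charp] := primitive_pchar py nz_y; have p_gt1 := prime_gt1 (pcharf_prime charp).
have bracN (u v : galg A) : brac u v = - brac v u by rewrite /brac opprB.
have memK (u v : galg A) : (u \in lker (linfun (brac v))) = (brac v u == 0).
  by rewrite memv_ker lfunE.
have killed (u v : galg A) m : primitive u -> iter m (brac u) v = 0 -> brac u v = 0.
  move=> pu um; apply/eqP; rewrite bracN oppr_eq0 -memK.
  apply: (primitive_expp_mem (r := m) charp) => // i le_mi.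
  rewrite memK bracN oppr_eq0 brac_expp_iter //; apply/eqP.
  have /subnK <- : (m <= p ^ i)%N by apply: leq_trans le_mi (ltnW (ltn_expl i p_gt1)).
  by rewrite iterD um; elim: (_ - _)%N => //= n ->; rewrite raddf0.
have [||[m Em]|[a [v [nz_a nz_v pv Ev]]]] :=
  @nil_or_eigen _ _ (brac y) (@primitive _ A) _ _ _ pz.
- by move=> a u v; apply: primitiveP.
- by move=> u; apply: primitive_brac.
- by apply/eqP; apply: killed Em.
(* From [y, v] = a v it follows that ad(v)^2 y = 0, so the nilpotent case with v in place of y gives
   [v, y] = 0, a contradiction. *)
have /eqP : brac v y = 0.
  apply: (@killed _ _ 2) => //=; rewrite [brac v y]bracN Ev -scaleNr linearZ /=.
  by rewrite /brac subrr scaler0.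
rewrite bracN Ev oppr_eq0 scaler_eq0 (negbTE nz_a) (negbTE nz_v).
by [].
Qed.

End Toral.

(** * The regular representation, the antipode and the adjoint action *)

Section Regular.
Variables (k : fieldType) (A : falgType k).

Definition reg_coord (x : A) : 'cV[k]_(\dim {:A}) := \col_i coord (vbasis {:A}) i x.

Lemma reg_coord_linear : linear reg_coord.
Proof. by move=> a x y; apply/colP => i; rewrite !mxE linearP. Qed.

HB.instance Definition _ := GRing.isLinear.Build k A 'cV[k]_(\dim {:A}) *:%R reg_coord
  reg_coord_linear.

Lemma reg_coordK x : x = \sum_i reg_coord x i 0 *: (vbasis {:A})`_i.
Proof.
by rewrite [LHS](coord_vbasis (memvf x)); apply: eq_bigr => i _; rewrite mxE.
Qed.

Lemma reg_coord_inj : injective reg_coord.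
Proof. by move=> x y E; rewrite (reg_coordK x) (reg_coordK y) E. Qed.

Definition reg_act (a : A) : 'M[k]_(\dim {:A}) :=
  \matrix_(i, j) coord (vbasis {:A}) i (a * (vbasis {:A})`_j).

Lemma reg_actE a x : reg_act a *m reg_coord x = reg_coord (a * x).
Proof.
apply/colP => i; rewrite !mxE {2}(reg_coordK x) mulr_sumr linear_sum.
by apply: eq_bigr => j _; rewrite !mxE -scalerAr linearZ mulrC.
Qed.

Lemma reg_coord_sep m (M N : 'M[k]_(m, \dim {:A})) :
  (forall x, M *m reg_coord x = N *m reg_coord x) -> M = N.
Proof.
move=> E; have basis (j : 'I_(\dim {:A})) : reg_coord (vbasis {:A})`_j = delta_mx j 0.
  apply/colP => i; rewrite !mxE eqxx andbT coord_free 1?eq_sym //.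
  exact: basis_free (vbasisP _).
apply/matrixP => i j; have /matrixP/(_ i 0) := E (vbasis {:A})`_j.
by rewrite basis -!colE !mxE.
Qed.

Lemma reg_linear : linear reg_act.
Proof.
move=> c a b; apply: reg_coord_sep => x.
by rewrite mulmxDl -scalemxAl !reg_actE mulrDl -scalerAl linearP.
Qed.

Lemma reg_act1 : reg_act 1 = 1%:M.
Proof. by apply: reg_coord_sep => x; rewrite reg_actE !mul1r mul1mx. Qed.

Lemma reg_actM a b : reg_act (a * b) = reg_act a *m reg_act b.
Proof. by apply: reg_coord_sep => x; rewrite -mulmxA !reg_actE mulrA. Qed.

Definition reg_mod : fdmodule A := FdModule reg_linear reg_act1 reg_actM.

Lemma reg_act_inj : injective reg_act.
Proof.
move=> a b /(congr1 (mulmx^~ (reg_coord 1))); rewrite !reg_actE !mulr1.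
exact: reg_coord_inj.
Qed.

End Regular.

Section Antipode.
Variables (k : fieldType) (B : finCommHopfType k).
Local Notation reg := (reg_mod (galg B)).

Lemma antipode1 : antipode (1 : B) = 1.
Proof.
have bP : bilinear_map (fun b c : B => antipode b * c).
  split=> [? a ? ?|? a ? ?]; last by rewrite mulrDr -scalerAr.
  by rewrite linearP mulrDl -scalerAl.
have := comul1 _ _ bP; rewrite antipodel big_seq1 /= mulr1 => <-.
by rewrite rmorph1 scale1r.
Qed.

(** A functional mu is recovered from its action on 1 in the regular module, so the matrix
    coefficients of that module span k[G]. *)
Lemma mcoef_span (x : B) : exists c : 'I_(mdim reg) -> 'I_(mdim reg) -> k,
  x = \sum_i \sum_j c i j *: mcoef i j.
Proof.
exists (fun i j => galg_app (vbasis {:galg B})`_i x * reg_coord (1 : galg B) j 0).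
apply: galg_sep => mu; rewrite [in LHS](reg_coordK mu) galg_sumE galg_app_sum.
apply: eq_bigr => i _; rewrite galgZE -[mu in reg_coord mu]mulr1 -reg_actE mxE mulr_suml.
rewrite galg_app_sum; apply: eq_bigr => j _; rewrite galg_appZ -mcoefE.
by rewrite mulrC [reg_act _ _ _ * _]mulrC mulrA.
Qed.

(** The inverse generic matrix of a tensor product is the tensor product of the inverses; this is
    multiplicativity on matrix coefficients. *)
Lemma antipodeM (x y : B) : antipode (x * y) = antipode x * antipode y.
Proof.
have [c def_x] := mcoef_span x; have [d def_y] := mcoef_span y.
have E (i j i' j' : 'I_(mdim reg)) :
    antipode (mcoef i j * mcoef i' j') = antipode (mcoef i j) * antipode (mcoef i' j').
  have /matrixP/(_ (mxtens_index (i, i')) (mxtens_index (j, j'))) := igen_tens reg reg.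
  by rewrite tensmxE /igen mxE gen_tens tensmxE !mxE.
have Er (i j : 'I_(mdim reg)) : antipode (mcoef i j * y) = antipode (mcoef i j) * antipode y.
  move: (mcoef i j) (E i j) => u Eu.
  rewrite def_y mulr_sumr !linear_sum mulr_sumr; apply: eq_bigr => i' _.
  rewrite mulr_sumr !linear_sum mulr_sumr; apply: eq_bigr => j' _.
  by rewrite -scalerAr !linearZ /= -scalerAr Eu.
rewrite def_x mulr_suml !linear_sum mulr_suml; apply: eq_bigr => i _.
rewrite mulr_suml !linear_sum mulr_suml; apply: eq_bigr => j _.
by rewrite -scalerAl !linearZ /= -scalerAl Er.
Qed.

Lemma antipode_igen (V : fdmodule (galg B)) : map_mx antipode (igen V) = gen V.
Proof.
have antiM (X Y : 'M[B]_(mdim V)) :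
    map_mx antipode (X *m Y) = map_mx antipode X *m map_mx antipode Y.
  apply/matrixP => i j; rewrite !mxE linear_sum; apply: eq_bigr => l _.
  by rewrite antipodeM !mxE.
have anti1 : map_mx antipode (1%:M : 'M[B]_(mdim V)) = 1%:M.
  by apply/matrixP => i j; rewrite !mxE; case: (i == j); rewrite ?antipode1 ?linear0.
have := antiM (gen V) (igen V); rewrite gen_igen anti1 => E.
by rewrite -[LHS]mul1mx -(gen_igen V) -mulmxA -E mulmx1.
Qed.

Lemma conj_act1 (V W : fdmodule (galg B)) (phi : 'M_(mdim W, mdim V)) :
  conj_act 1 phi = phi.
Proof.
pose ev m n := @map_mx _ _ (galg_app (1 : galg B)) m n.
have ev1M m n p (X : 'M[B]_(m, n)) (Y : 'M_(n, p)) : ev _ _ (X *m Y) = ev _ _ X *m ev _ _ Y.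
  apply/matrixP => i j; rewrite !mxE galg_app_sum; apply: eq_bigr => l _.
  by rewrite !mxE !galg_app1 rmorphM.
have ev_igen : ev _ _ (igen V) = 1%:M.
  have := ev1M _ _ _ (gen V) (igen V); rewrite gen_igen {2}/ev ev_gen mact1 mul1mx => <-.
  by apply/matrixP => i j; rewrite !mxE galg_app1 rmorph_nat.
by rewrite conj_actE -/(ev _ _ _) ev1M ev_igen mulmx1 /ev ev_cst_mulr ev_gen mact1 mul1mx.
Qed.

End Antipode.

Section Central.
Variables (k : fieldType) (A : finCommHopfType k).
Implicit Types (y mu : galg A) (a b : A).

Definition adjact mu y : galg A := \sum_(p <- gcomul mu) p.1 * y * gantipode p.2.

Lemma mact_adj (V : fdmodule (galg A)) mu y :
  mact V (adjact mu y) = conj_act mu (mact V y : 'M_(mdim V, mdim V)).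
Proof. by rewrite /adjact linear_sum; apply: eq_bigr => p _; rewrite -!mactM. Qed.

(** The function g |-> (Ad(g) y)(a) on the group. *)
Definition coadj y a : A := \sum_(p <- comul a) p.1 * antipode (lder y p.2).

Lemma adjE mu y a : galg_app (adjact mu y) a = galg_app mu (coadj y a).
Proof.
rewrite galg_sumE /coadj galg_app_sum.
under eq_bigr => q _ do rewrite -mulrA galgM.
rewrite exchange_big; apply: eq_bigr => p _ /=; rewrite -gcomulE.
apply: eq_bigr => q _; rewrite -galg_lder; congr (_ * _).
by rewrite /gantipode {1}/galg_app comp_lfunE lfunE.
Qed.

Lemma primitive_adj mu y : primitive y -> primitive (adjact mu y).
Proof.
move=> py a b; rewrite !adjE.
have bP : bilinear_map (fun b c : A => b * antipode (lder y c)).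
  split=> [? c ? ?|? c ? ?]; first by rewrite mulrDl -scalerAl.
  by rewrite !linearP mulrDr -scalerAr.
suff -> : coadj y (a * b) = (counit b : k) *: coadj y a + (counit a : k) *: coadj y b.
  by rewrite galg_appD !galg_appZ [counit b * _]mulrC.
rewrite /coadj (comulM a b _ _ bP) big_allpairs_dep /=.
have -> : (counit b : k) *: coadj y a = coadj y a * (counit b : k)%:A by rewrite mulr_algr.
have -> : (counit a : k) *: coadj y b = (counit a : k)%:A * coadj y b by rewrite mulr_algl.
rewrite -(antipoder a) -(antipoder b) /coadj !mulr_suml -big_split; apply: eq_bigr => p _ /=.
rewrite !mulr_sumr -big_split; apply: eq_bigr => q _ /=.
by rewrite lderM // linearD !antipodeM mulrDr; congr (_ + _); rewrite mulrACA.
Qed.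

End Central.

(** * Nagata's theorem *)

Section Nagata.
Variables (k : closedFieldType) (A : finCommHopfType k).
Hypothesis connA : forall c : A, c * c = c -> c = 0 \/ c = 1.
Variable e : galg A.
Hypotheses (eint : forall nu, nu * e = galg_app nu 1 *: e) (e1 : galg_app e 1 = 1).
Implicit Types (y z mu : galg A) (a b x : A).
Local Notation reg := (reg_mod (galg A)).

Lemma exprn_char_counit p N r a : p \in [pchar k] ->
  (forall b, counit b = 0 :> k -> b ^+ N = 0) -> (N <= p ^ r)%N ->
  a ^+ (p ^ r) = ((counit a : k) ^+ (p ^ r))%:A.
Proof.
move=> charp HN le_N; pose F (i : bool) := if i then (counit a : k)%:A else a - (counit a : k)%:A.
have Ea : a = \sum_(i <- [:: true; false]) F i.
  by rewrite !big_cons big_nil addr0 /F addrC subrK.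
rewrite {1}Ea (expp_sum _ (pcharf_prime charp)) => [|u|i j]; last 2 first.
- exact: lmod_pchar.
- exact: mulrC.
rewrite !big_cons big_nil addr0 /F -(subnK le_N) !exprD [X in _ + _ * X]HN ?mulr0 ?addr0.
  by rewrite -!exprD subnK // -in_algE -rmorphXn.
by rewrite raddfB /= counitZ rmorph1 mulr1 subrr.
Qed.

(* The generic conjugate of y is sum_j a_j b_j with commuting primitive b_j,    *)
(* and for a large power q of p its q-th power is sum_j (counit a_j)^q b_j^q.   *)
(* This is constant, so y^q is central.                                         *)
Lemma primitive_central y mu : primitive y -> mu * y = y * mu.
Proof.
move=> py; have [->|nz_y] := eqVneq y 0; first by rewrite mul0r mulr0.
have [p charp] := primitive_pchar connA py nz_y; have p_gt1 := prime_gt1 (pcharf_prime charp).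
have [N HN] := aug_exprn0 connA.
have [L LP] := vspace_of_pred (@primitive0 _ A) (@primitiveP _ A).
pose b j := (vbasis L)`_j; pose cf j nu := coord (vbasis L) j (adjact nu y).
have adj_linear : linear (fun nu => adjact nu y).
  move=> c u v; apply: galgP => a.
  by rewrite galgDE galgZE !adjE galgDE galgZE.
pose a j : A := galg_repr (cf j).
have aE j nu : galg_app nu (a j) = cf j nu.
  by apply: galg_reprE => c u v; rewrite /cf adj_linear linearP.
have Gy : Gam reg reg (reg_act y) = \sum_j a j *: cst A (reg_act (b j)).
  apply: ev_sep => nu; rewrite -conj_actE -(mact_adj reg).
  have /coord_vbasis -> : adjact nu y \in L by apply/LP/primitive_adj.
  rewrite linear_sum; apply/matrixP => i j; rewrite summxE !mxE summxE galg_app_sum.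
  apply: eq_bigr => l _; rewrite linearZ !mxE /=.
  by rewrite mulr_algr galg_appZ aE mulrC.
suff cent r : (N <= r)%N -> brac mu (y ^+ (p ^ r)) = 0.
  suff : y \in lker (linfun (brac mu)).
    by rewrite memv_ker lfunE /= /brac subr_eq0 => /eqP.
  apply: (primitive_expp_mem connA eint e1 charp py (r := N)) => i /cent.
  by rewrite memv_ker lfunE => /eqP.
move=> le_N; set q := (p ^ r)%N.
have le_q : (N <= q)%N by apply: leq_trans le_N (ltnW (ltn_expl r p_gt1)).
have GX (phi : 'M[k]_(mdim reg)) i : Gam reg reg (phi ^+ i) = Gam reg reg phi ^+ i.
  elim: i => [|i IHi]; first exact: Gam1.
  by rewrite !exprS -IHi -[phi * _]/(phi *m _) GamM.
have cstX (phi : 'M[k]_(mdim reg)) i : cst A (phi ^+ i) = cst A phi ^+ i.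
  elim: i => [|i IHi]; first exact: cst1.
  by rewrite !exprS -IHi -[phi * _]/(phi *m _) cstM.
have regX z i : reg_act (z ^+ i) = reg_act z ^+ i.
  elim: i => [|i IHi]; first exact: reg_act1.
  by rewrite !exprS -IHi reg_actM.
pose W : 'M[k]_(mdim reg) := \sum_j (counit (a j) : k) ^+ q *: (reg_act (b j)) ^+ q.
have GW : Gam reg reg (reg_act (y ^+ q)) = cst A W.
  rewrite regX GX Gy /q.
  rewrite (@expp_sum 'M[A]_(mdim reg) p _ _ (fun j => a j *: cst A (reg_act (b j)))
             (pcharf_prime charp)) => [|u|i j]; last 2 first.
  - apply/matrixP => i j; rewrite mulmxnE mxE; exact: lmod_pchar.
  - have scM (c d : A) (P Q : 'M[k]_(mdim reg)) :
        (c *: cst A P) * (d *: cst A Q) = (c * d) *: cst A (P *m Q).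
      by rewrite cstM -[LHS]/(_ *m _) -scalemxAl -scalemxAr scalerA.
    have bb : b i * b j = b j * b i.
      by apply: (primitive_comm connA eint e1); apply/LP/vbasis_mem/mem_nth; rewrite size_tuple.
    transitivity ((a i * a j) *: cst A (reg_act (b i) *m reg_act (b j))); first exact: scM.
    rewrite mulrC -reg_actM bb reg_actM; apply/esym; exact: scM.
  rewrite /W /cst raddf_sum /=; apply: eq_bigr => j _.
  have scX (c : A) (M : 'M[A]_(mdim reg)) i : (c *: M) ^+ i = c ^+ i *: M ^+ i.
    elim: i => [|i IHi]; first by rewrite scale1r.
    by rewrite !exprS IHi -[LHS]/(_ *m _) -scalemxAl -scalemxAr scalerA.
  rewrite scX -cstX (exprn_char_counit (a j) charp HN le_q).
  by apply/matrixP => i l; rewrite !mxE /= mulr_algl scalerA.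
have WE : W = reg_act (y ^+ q).
  by rewrite -[RHS](conj_act1 (V := reg) (W := reg)) conj_actE GW ev_cst galg_app1 rmorph1 scale1r.
have /mod_homP/(_ mu) : Gam reg reg (reg_act (y ^+ q)) = cst A (reg_act (y ^+ q)) by rewrite GW WE.
by rewrite -!reg_actM => /reg_act_inj E; rewrite /brac E subrr.
Qed.

(* Averaging a rank one idempotent over the group gives a scalar of trace 1. *)
Lemma dim_simple_neq0 (S : fdmodule (galg A)) : simple_mod S -> (mdim S)%:R != 0 :> k.
Proof.
move=> simS; have S_gt0 : (0 < mdim S)%N by rewrite lt0n; apply/eqP; case: simS.
pose i0 := Ordinal S_gt0; pose phi : 'M[k]_(mdim S) := delta_mx i0 i0.
have hom_av : @mod_hom _ _ S S (conj_act e phi).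
  apply/hom_conj_act => mu; rewrite -conj_actM eint !conj_actE.
  by apply/matrixP => i j; rewrite !mxE galgZE.
have [c Ec] := simple_schur simS hom_av.
have : \tr (conj_act (X := S) (Y := S) e phi) = 1.
  rewrite conj_actE.
  have -> : \tr (map_mx (galg_app e) (Gam S S phi)) = galg_app e (\tr (Gam S S phi)).
    by rewrite /mxtrace galg_app_sum; apply: eq_bigr => i _; rewrite mxE.
  rewrite /Gam mxtrace_mulC mulmxA igen_gen mul1mx.
  have -> : \tr (cst A phi) = (\tr phi)%:A by rewrite /cst trace_map_mx.
  rewrite galg_appZ e1 mulr1 /mxtrace (bigD1 i0) //= big1 ?addr0 => [|i /negbTE ni].
    by rewrite !mxE !eqxx.
  by rewrite !mxE ni.
rewrite Ec mxtrace_scalar => E; apply/eqP => E0.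
by move: E => /eqP; rewrite -mulr_natr E0 mulr0 eq_sym oner_eq0.
Qed.

Lemma det_character (S : fdmodule (galg A)) : is_character (\det (gen S)).
Proof.
split.
  apply/tens2_pure; rewrite big_seq1 /=.
  transitivity (conv (inl_t A) (inr_t A) (\det (gen S))).
    by apply: eq_bigr => p _; exact: pureE.
  by rewrite -det_map_mx conv_gen det_mulmx !det_map_mx pureE.
have -> : counit (\det (gen S)) = \det (map_mx counit (gen S)) :> k^o by rewrite det_map_mx.
rewrite (_ : map_mx _ _ = 1%:M) ?det1 //.
by apply/matrixP => i j; rewrite !mxE counit_mcoef.
Qed.

(** The derivation multiplies each matrix coefficient of S by c, hence each product of dim S of them
    by c dim S. *)
Lemma lder_det (S : fdmodule (galg A)) y c : primitive y -> mact S y = c%:M ->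
  lder y (\det (gen S)) = (c *+ mdim S) *: \det (gen S).
Proof.
move=> py Ey; have coefE (i j : 'I_(mdim S)) : lder y (mcoef i j) = c *: mcoef i j.
  rewrite /lder (comul_mcoef i j (lder_bilinear y)) big_map big_enum /= (bigD1 i) //=.
  rewrite -mcoefE Ey mxE eqxx big1 ?addr0 // => l /negbTE nl.
  by rewrite -mcoefE Ey mxE eq_sym nl scale0r.
have prodE (I : Type) (r : seq I) (F : I -> A) : (forall i, lder y (F i) = c *: F i) ->
    lder y (\prod_(i <- r) F i) = (c *+ size r) *: \prod_(i <- r) F i.
  move=> HF; elim: r => [|i r IHr]; first by rewrite big_nil lder1 // mulr0n scale0r.
  by rewrite big_cons lderM // HF IHr /= mulrS scalerDl -scalerAl -scalerAr.
rewrite /determinant linear_sum scaler_sumr; apply: eq_bigr => s _.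
have detE : lder y (\prod_i gen S i (s i)) = (c *+ mdim S) *: \prod_i gen S i (s i).
  have := prodE _ (index_enum 'I_(mdim S)) (fun i => gen S i (s i)).
  rewrite -[size _]/(size (index_enum _)) (_ : size _ = mdim S); last first.
    by rewrite -[index_enum _]enumT size_enum_ord.
  by apply=> i; rewrite mxE coefE.
case: (odd_perm s); rewrite ?expr1 ?expr0 ?mulN1r ?mul1r //.
by rewrite linearN /= detE scalerN.
Qed.

(* If S is a simple submodule of an eigenspace of y on the group algebra, with  *)
(* eigenvalue c <> 0, then l = det S has value c * dim S under y.               *)
Lemma primitive_character y : primitive y -> y != 0 ->
  exists l : A, is_character l /\ galg_app y l <> 0.
Proof.
move=> py nz_y; pose T : {linear galg A -> galg A} := amull y.
have TE u : T u = y * u by rewrite /T /= lfunE.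
have [//|//|[m]|[c [v [nz_c nz_v _ Ev]]]] :=
  @nil_or_eigen _ _ T (fun _ => True) _ _ 1 I.
  have -> : iter m T 1 = y ^+ m.
    by elim: m => //= m ->; rewrite TE exprS.
  by move=> /(primitive_nil connA eint e1 py) E; rewrite E eqxx in nz_y.
rewrite TE in Ev.
pose W : {vspace 'cV[k]_(mdim reg)} := lker (linfun (mulmx (reg_act y - c%:M))).
have memW (w : 'cV_(mdim reg)) : (w \in W) = (reg_act y *m w == c *: w).
  by rewrite memv_ker lfunE /= mulmxBl mul_scalar_mx subr_eq0.
have [|Y [f [homf injf imf]]] := @submoduleP _ _ reg W.
  move=> a w; rewrite !memW => /eqP Ew; apply/eqP.
  by rewrite mulmxA -reg_actM -(primitive_central a py) reg_actM -mulmxA Ew linearZ.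
have nz_Y : mdim Y <> 0%N.
  move=> Y0; have /imf[u Eu] : reg_coord v \in W.
    by rewrite memW reg_actE Ev linearZ.
  case/eqP: nz_v; apply: reg_coord_inj; rewrite raddf0 -Eu.
  suff -> : u = 0 by rewrite mulmx0.
  by apply/matrixP => -[i lti] j; exfalso; move: lti; rewrite Y0.
have [S [g [simS homg injg]]] := simple_submodule nz_Y.
have Sy : mact S y = c%:M.
  have H (x : 'cV_(mdim S)) : mact S y *m x = c *: x.
    apply/eqP; rewrite -subr_eq0; apply/eqP/injg/injf.
    rewrite !mulmxBr -!scalemxAr; apply/eqP; rewrite subr_eq0.
    rewrite [g *m (mact _ _ *m _)]mulmxA homg -[mact Y y *m g *m x]mulmxA [f *m (_ *m _)]mulmxA homf -mulmxA -memW.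
    by apply/imf; exists (g *m x).
  apply/matrixP => i j; have /matrixP/(_ i 0) := H (delta_mx j 0).
  by rewrite -colE !mxE eqxx andbT mulr_natr.
exists (\det (gen S)); split; first exact: det_character.
rewrite -counit_lder (lder_det py Sy) counitZ; have [_ ->] := det_character S.
by rewrite mulr1 -mulr_natr; apply/eqP; rewrite mulf_neq0 // dim_simple_neq0.
Qed.

End Nagata.

Lemma separating_functional (k : fieldType) (A : finCommHopfType k) (W : {vspace A}) x :
  x \notin W -> exists y : galg A,
    galg_app y x != 0 /\ forall w, w \in W -> galg_app y w = 0.
Proof.
move=> nWx; pose p w : A := w - projv W w.
have nz_px : p x != 0.
  by apply: contra nWx; rewrite subr_eq0 => /eqP ->; apply: memv_proj.
have plin : linear p by move=> c u v; rewrite /p linearP scalerBr opprD addrACA.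
pose P : {linear A -> A} := HB.pack p (GRing.isLinear.Build k A A *:%R p plin).
have [y nz_y] : exists y : galg A, galg_app y (p x) <> 0.
  apply: not_all_not_ex => all0; case/eqP: nz_px; apply: galg_sep => y.
  by rewrite raddf0; apply: NNPP; apply: all0.
have yP : galg_app (y \o linfun P)%VF =1 galg_app y \o p.
  by move=> w; rewrite /galg_app comp_lfunE lfunE.
exists (y \o linfun P)%VF; split=> [|w Ww]; rewrite yP /=; first exact/eqP.
by rewrite /p projv_id // subrr raddf0.
Qed.

Section Diagonalizable.
Variables (k : closedFieldType) (A : finCommHopfType k).
Hypothesis connA : forall c : A, c * c = c -> c = 0 \/ c = 1.
Variable e : galg A.
Hypotheses (eint : forall nu, nu * e = galg_app nu 1 *: e) (e1 : galg_app e 1 = 1).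

Lemma is_character1 : is_character (1 : A).
Proof. by split; [exact: comul1|rewrite rmorph1]. Qed.

Lemma is_characterM (l m : A) : is_character l -> is_character m -> is_character (l * m).
Proof.
move=> [lP l1] [mP m1]; split; last by rewrite rmorphM /= l1 m1 mulr1.
apply/tens2_pure; rewrite big_seq1 /=.
move/tens2_pure: lP; move/tens2_pure: mP; rewrite !big_seq1 /= => Em El.
have comulE b : \sum_(p <- comul b) pure p.1 p.2 = conv (inl_t A) (inr_t A) b.
  by apply: eq_bigr => p _; exact: pureE.
by rewrite comulE rmorphM /= -!comulE El Em pureM.
Qed.

(* Nagata's theorem: an infinitesimal linearly reductive group is diagonalizable. *)
Theorem characters_span (U : {vspace A}) :
  (forall l, is_character l -> l \in U) -> U = fullv.
Proof.
move=> HU.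
(* [K] is the span of the characters, as the intersection of all subspaces containing them. *)
have [K KP] : exists K : {vspace A}, forall u, u \in K <->
    forall U : {vspace A}, (forall l, is_character l -> l \in U) -> u \in U.
  apply: vspace_of_pred => [V _|c u v Hu Hv V HV]; first exact: mem0v.
  by rewrite memvD ?memvZ ?Hu ?Hv.
suff fullK : (fullv <= K)%VS.
  apply/eqP; rewrite eqEsubv subvf /=; apply/subvP => u _.
  by have /KP := subvP fullK u (memvf u); apply.
have charK l : is_character l -> l \in K by move=> lP; apply/KP => V; apply.
have subK (V : {vspace A}) : (forall l, is_character l -> l \in V) -> (K <= V)%VS.
  by move=> HV; apply/subvP => u /KP; apply.
have charM l u : is_character l -> u \in K -> l * u \in K.
  move=> lP /KP/(_ (amull l @^-1: K)%VS) H.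
  have -> : l * u = amull l u by rewrite lfunE.
  rewrite memv_preim; apply: H => m mP; rewrite -memv_preim lfunE.
  exact/charK/is_characterM.
have mulK u v : u \in K -> v \in K -> u * v \in K.
  move=> /KP/(_ (amulr v @^-1: K)%VS) H Kv.
  have -> : u * v = amulr v u by rewrite lfunE.
  rewrite memv_preim; apply: H => m mP; rewrite -memv_preim lfunE.
  exact: charM.
have K1 : 1 \in K by apply/charK/is_character1.
pose m := aug A.
have m_augE a : a - (counit a : k)%:A \in m.
  by rewrite mem_aug raddfB /= counitZ rmorph1 mulr1 subrr.
(* A nonzero functional y killing [K] and [m * m] would be primitive, and [primitive_character]
   would give a character l in [K] with y(l) != 0. *)
have full2 : (fullv <= K + m * m)%VS.
  apply/subvP => x _; apply: contraT => /separating_functional[y [nz_yx y0]].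
  have yK u : u \in K -> galg_app y u = 0.
    by move=> Ku; apply: y0; apply: subvP Ku; apply: addvSl.
  have ymm a b : a \in m -> b \in m -> galg_app y (a * b) = 0.
    move=> ma mb; apply: y0; move: (memv_mul ma mb); apply: subvP; apply: addvSr.
  have py : primitive y.
    move=> a b; pose al : A := (counit a : k)%:A; pose be : A := (counit b : k)%:A.
    have -> : a * b = (a - al) * (b - be) + (a * be + (b * al + - al * be)) by ring.
    have yc (u : A) c : galg_app y (u * c%:A) = c * galg_app y u by rewrite mulr_algr galg_appZ.
    rewrite !galg_appD ymm ?m_augE // add0r !yc (yK (- al)) ?memvN ?memvZ //.
    by rewrite mulr0 addr0 mulrC.
  have nz_y : y != 0 by apply: contraNneq nz_yx => ->; rewrite galg0E.
  have [l [lP nz_yl]] := primitive_character connA eint e1 py nz_y.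
  by case: nz_yl; apply/yK/charK.
pose J := (K :&: m)%VS.
have memJ u : u \in J = (u \in K) && (u \in m) by rewrite memv_cap.
have mm : (m * m <= m)%VS.
  apply/prodvP => a b; rewrite !mem_aug => /eqP a0 _.
  by rewrite rmorphM /= a0 mul0r.
have m2 : (m <= J + m * m)%VS.
  apply/subvP => x mx; have /memv_addP[u Ku [w mw Ex]] := subvP full2 x (memvf x).
  rewrite Ex memv_add // memJ Ku /=.
  have -> : u = x - w by rewrite Ex addrK.
  by rewrite memvB // (subvP mm).
have JJ : (J * J <= J)%VS.
  apply/prodvP => a b; rewrite !memJ => /andP[Ka ma] /andP[Kb mb].
  by rewrite mulK // (subvP mm) // memv_mul.
have Jm : (J <= m)%VS by apply: capvSr.
(* [J] is closed under products, so inserting the inclusion for i into [m * m] raises the exponent;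
   nilpotence of [m] then gives m = J. *)
have mi i : (m <= J + m ^+ i.+1)%VS.
  elim: i => [|i IHi]; first by rewrite expv1 addvSr.
  apply: (subv_trans m2); rewrite subv_add addvSl /=.
  apply: (subv_trans (prodvS IHi IHi)).
  rewrite prodvDl !prodvDr !subv_add (subv_trans JJ) ?addvSl //=.
  have mimi n : (m ^+ n.+1 <= m)%VS.
    elim: n => [|n IHn]; first by rewrite expv1.
    by rewrite expvSl; apply: subv_trans mm; rewrite prodvS.
  have up (P Q : {vspace A}) : (P <= m)%VS -> (Q <= m ^+ i.+1)%VS -> (P * Q <= J + m ^+ i.+2)%VS.
    by move=> HP HQ; apply: subv_trans (addvSr _ _); rewrite expvSl prodvS.
  have up' (P Q : {vspace A}) : (P <= m ^+ i.+1)%VS -> (Q <= m)%VS -> (P * Q <= J + m ^+ i.+2)%VS.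
    by move=> HP HQ; apply: subv_trans (addvSr _ _); rewrite expvSr prodvS.
  by rewrite up // up' // up.
have [N mN] := aug_expv0 connA.
have mJ : (m <= J)%VS.
  apply: (subv_trans (mi N)); rewrite expvSl -/m.
  by rewrite [(m ^+ N)%VS]mN prodv0 addv0.
apply: (subv_trans full2); rewrite subv_add subvv /=.
by apply: (subv_trans mm); apply: (subv_trans mJ); apply: capvSl.
Qed.

End Diagonalizable.

(** * Quotients, integrals and averaging *)

Lemma conj_act_coef (k : fieldType) (G : finCommHopfType k) (V W : fdmodule (galg G)) mu
    (phi : 'M[k]_(mdim W, mdim V)) a b :
  conj_act mu phi a b = galg_app mu (Gam V W phi a b).
Proof. by rewrite conj_actE mxE. Qed.

Section GalgMap.
Variables (k : fieldType) (B C : finCommHopfType k) (f : hopfMorphism B C).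

Lemma galg_mapM mu nu : galg_map f (mu * nu) = galg_map f mu * galg_map f nu.
Proof.
apply: galgP => x; rewrite galg_mapE !galgM (hopf_comul f x (mul_bilinear mu nu)) big_map.
by apply: eq_bigr => p _; rewrite !galg_mapE.
Qed.

Lemma galg_map1 : galg_map f 1 = 1.
Proof. by apply: galgP => x; rewrite galg_mapE !galg_app1 hopf_counit. Qed.

Lemma galg_map_linear : linear (galg_map f).
Proof.
by move=> a mu nu; apply: galgP => x; rewrite galgDE galgZE !galg_mapE galgDE galgZE.
Qed.

Lemma galg_map_surj w : injective f -> exists mu, galg_map f mu = w.
Proof.
move=> inj_f; exists (w \o (linfun f)^-1)%VF; apply: galgP => x.
rewrite galg_mapE /galg_app comp_lfunE -[f x]lfunE lker0_lfunK //.
by apply/lker0P => u v; rewrite !lfunE; apply: inj_f.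
Qed.

Lemma conj_act_res (V W : fdmodule (galg B)) nu (phi : 'M_(mdim W, mdim V)) :
  conj_act (X := res f V) (Y := res f W) nu phi = conj_act (galg_map f nu) phi.
Proof.
rewrite !conj_actE Gam_res; apply/matrixP => i j.
by rewrite !mxE galg_mapE.
Qed.

End GalgMap.

Lemma galgM1 (k : fieldType) (B : finCommHopfType k) (mu nu : galg B) :
  galg_app (mu * nu) 1 = galg_app mu 1 * galg_app nu 1.
Proof. by rewrite galgM (comul1 _ _ (mul_bilinear mu nu)) big_seq1. Qed.

Lemma galg_app_linearl (k : fieldType) (B : finCommHopfType k) (x : B) :
  linear (fun mu : galg B => galg_app mu x : k^o).
Proof. by move=> a mu nu; rewrite galgDE galgZE. Qed.

Definition galg_ev (k : fieldType) (B : finCommHopfType k) (x : B) : 'Hom(galg B, k^o) :=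
  linfun (HB.pack (fun mu : galg B => galg_app mu x : k^o)
    (GRing.isLinear.Build k (galg B) k^o *:%R _ (@galg_app_linearl k B x))
    : {linear galg B -> k^o}).

Lemma memv_ker_ev (k : fieldType) (B : finCommHopfType k) (x : B) mu :
  (mu \in lker (galg_ev x)) = (galg_app mu x == 0).
Proof. by rewrite memv_ker lfunE. Qed.

(** [w] is the component of 1 in a complementary left ideal W; for x in U the product x w lies in
    both U and W. *)
Lemma semisimple_split (k : fieldType) (A : falgType k) (U : {vspace A}) :
  semisimple_algebra A -> left_ideal U ->
  exists w, (forall x, x \in U -> x * w = 0) /\ 1 - w \in U.
Proof.
move=> ssA idU; have [W [idW UW UIW]] := ssA U idU.
have /memv_addP[u Uu [w Ww E1]] : 1 \in (U + W)%VS by rewrite UW memvf.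
exists w; split=> [x Ux|]; last by rewrite E1 addrK.
apply/eqP; rewrite -memv0 -UIW memv_cap idW // andbT.
have -> : x * w = x - x * u by rewrite -[X in X - _]mulr1 E1 mulrDr addrC addKr.
by rewrite memvB // idU.
Qed.

(** Split off the augmentation ideal of the group algebra: the complementary component of 1 is
    killed by every nu - nu(1). *)
Lemma galg_integral (k : fieldType) (B : finCommHopfType k) : linearly_reductive B ->
  exists e : galg B, (forall nu, nu * e = galg_app nu 1 *: e) /\ galg_app e 1 = 1.
Proof.
move=> lrB; have [|w [w0 w1]] := @semisimple_split _ _ (lker (galg_ev (1 : B))) lrB.
  by move=> a u; rewrite !memv_ker_ev galgM1 => /eqP ->; rewrite mulr0.
have app11 : galg_app (1 : galg B) 1 = 1 by rewrite galg_app1 rmorph1.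
exists w; split=> [nu|]; last first.
  move: w1; rewrite memv_ker_ev -scaleN1r galgDE galgZE mulN1r subr_eq0 app11.
  by move/eqP.
apply/eqP; rewrite -subr_eq0 -[in X in _ - X](mul1r w) scalerAl -mulrBl w0 //.
by rewrite memv_ker_ev -scaleN1r galgDE !galgZE app11 mulr1 mulN1r subrr.
Qed.

Section Quotient.
Variables (k : fieldType) (Q G N : finCommHopfType k).
Variables (j : hopfMorphism Q G) (f : hopfMorphism G N).
Hypothesis quoP : quotient_by j f.

Lemma quotient_fixedP x :
  (exists y, x = j y) <-> conv (inl_t N) (inr_t G \o f) x = inl_t N x.
Proof.
have [_ fixP] := quoP; apply: (iff_trans (fixP x)).
apply: (iff_trans (tens2_pure _ _)); rewrite big_map big_seq1 /=.
suff -> : \sum_(p <- comul x) pure p.1 (f p.2) = conv (inl_t N) (inr_t G \o f) x by [].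
by apply: eq_bigr => p _; rewrite pureE.
Qed.

Lemma quotient_triv y : f (j y) = (counit y : k)%:A.
Proof.
have [_ fixP] := quoP; have /fixP E : exists y', j y = j y' by exists y.
have bP : bilinear_map (fun (u : G) (v : N) => (counit u : k) *: v).
  split=> [? a ? ?|? a ? ?]; last by rewrite scalerDr !scalerA mulrC.
  by rewrite linearP scalerDl -scalerA.
have := E _ _ bP; rewrite big_map big_seq1 /= hopf_counit => <-.
rewrite -[in LHS](counitl (j y)) linear_sum; apply: eq_bigr => p _.
by rewrite linearZ.
Qed.

Section Hom.
Variables (V W : fdmodule (galg G)) (phi : 'M[k]_(mdim W, mdim V)).
Hypothesis homphi : @mod_hom k (galg N) (res f V) (res f W) phi.

(** For N-linear phi the conjugate by g depends only on the coset gN, so its entries are functions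
    on G/N. *)
Lemma hom_Gam_fixed a b : exists y, Gam V W phi a b = j y.
Proof.
apply/quotient_fixedP.
have /mod_homP := homphi; rewrite Gam_res => Ef.
have : map_mx (conv (inl_t N) (inr_t G \o f)) (Gam V W phi) = map_mx (inl_t N) (Gam V W phi).
  rewrite conv_Gam (map_mx_comp f (inr_t G)) Ef (map_cst (inr_t G) phi) [in RHS]/Gam !map_mxM (map_cst (inl_t N) phi).
  by congr (_ *m _ *m _).
by move=> /matrixP/(_ a b); rewrite !mxE.
Qed.

(** The coproduct of a function on G/N involves only functions on G/N, and these are constant on N;
    so N fixes the conjugates of phi. *)
Lemma conj_act_hom mu : @mod_hom k (galg N) (res f V) (res f W) (conj_act mu phi).
Proof.
apply/hom_conj_act => nu; rewrite conj_act_res -conj_actM.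
suff E a b : galg_app (galg_map f nu * mu) (Gam V W phi a b) =
    galg_app nu 1 * galg_app mu (Gam V W phi a b).
  apply/matrixP => a b; rewrite [RHS]mxE; have := E a b.
  by rewrite -!conj_act_coef.
have [y ->] := hom_Gam_fixed a b.
rewrite galgM (hopf_comul j y (mul_bilinear (galg_map f nu) mu)) big_map /=.
rewrite -[in RHS](counitl y) linear_sum !galg_app_sum mulr_sumr; apply: eq_bigr => p _.
rewrite linearZ /=.
by rewrite galg_mapE quotient_triv !galg_appZ mulrCA mulrA.
Qed.

End Hom.

Section Average.
Variables (eQ : galg Q) (eG : galg G).
Hypotheses (eQint : forall nu, nu * eQ = galg_app nu 1 *: eQ) (eGP : galg_map j eG = eQ).

(** The conjugates of phi have entries in k[G/N], where [eG] acts as the integral [eQ]; the average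
    is therefore G-invariant. *)
Lemma average_hom (V W : fdmodule (galg G)) (phi : 'M[k]_(mdim W, mdim V)) :
  @mod_hom k (galg N) (res f V) (res f W) phi -> @mod_hom k (galg G) V W (conj_act eG phi).
Proof.
move=> homphi; apply/hom_conj_act => mu; rewrite -conj_actM.
apply/matrixP => a b; rewrite [RHS]mxE !conj_act_coef; have [y ->] := hom_Gam_fixed homphi a b.
rewrite -!(galg_mapE j) galg_mapM eGP eQint galgZE galg_mapE.
by rewrite rmorph1.
Qed.

End Average.
End Quotient.

Section ConjComp.
Variables (k : fieldType) (G : finCommHopfType k).

Lemma conj_act_homl (V W Z : fdmodule (galg G)) mu (psi : 'M[k]_(mdim Z, mdim W))
    (phi : 'M[k]_(mdim W, mdim V)) : mod_hom psi ->
  conj_act mu (psi *m phi : 'M_(mdim Z, mdim V)) = psi *m conj_act mu phi.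
Proof.
by move=> /mod_homP hompsi; rewrite !conj_actE (GamM phi psi) hompsi ev_cst_mull.
Qed.

Lemma conj_act_homr (V W Z : fdmodule (galg G)) mu (psi : 'M[k]_(mdim Z, mdim W))
    (phi : 'M[k]_(mdim W, mdim V)) : mod_hom phi ->
  conj_act mu (psi *m phi : 'M_(mdim Z, mdim V)) = conj_act mu psi *m phi.
Proof.
by move=> /mod_homP homphi; rewrite !conj_actE (GamM phi psi) homphi ev_cst_mulr.
Qed.

End ConjComp.

Section Idempotents.
Variable R : comNzRingType.
Implicit Types x y : R.

Lemma nilpotentD x y : (exists n, x ^+ n = 0) -> (exists n, y ^+ n = 0) ->
  exists n, (x + y) ^+ n = 0.
Proof.
move=> [n xn] [m ym]; exists (n + m)%N; rewrite exprDn big1 // => i _.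
have [le_mi|lt_im] := leqP m i.
  by rewrite -(subnK le_mi) [y ^+ _]exprD ym mulr0 mulr0 mul0rn.
have le_n : (n <= n + m - i)%N by lia.
by rewrite -(subnK le_n) [x ^+ _]exprD xn mulr0 mul0r mul0rn.
Qed.

Lemma nilpotent_sum (I : Type) (s : seq I) (F : I -> R) :
  (forall i, exists n, F i ^+ n = 0) -> exists n, (\sum_(i <- s) F i) ^+ n = 0.
Proof.
move=> HF; elim/big_rec: _ => [|i x _ Hx]; first by exists 1%N.
exact: nilpotentD.
Qed.

(** The difference t satisfies t^3 = t, so it is a multiple of every power of t^2. *)
Lemma idempotent_nilpotent x y : x * x = x -> y * y = y ->
  (exists n, (x - y) ^+ n = 0) -> x = y.
Proof.
move=> xx yy [n Hn]; set t := x - y in Hn.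
have t3 : t ^+ 3 = t.
  have -> : t ^+ 3 = x * x * x - 3%:R * (x * x) * y + 3%:R * x * (y * y) - y * y * y.
    by rewrite /t; ring.
  by rewrite xx yy xx yy /t; ring.
have tn m : t = t * (t ^+ 2) ^+ m.
  by elim: m => [|m IHm]; rewrite ?mulr1 // exprS mulrA -exprS t3 -IHm.
apply/eqP; rewrite -subr_eq0 -/t (tn n) -exprM mulnC exprM Hn expr2 !mulr0.
exact: eqxx.
Qed.

End Idempotents.

Section TensorNilpotent.
Variables (k : fieldType) (B C : finCommHopfType k).

(** Such t lies in the ideal generated by the augmentation ideal of C. *)
Lemma tensor_nilpotent_r (t : tensor B C) :
  (forall c : C, counit c = 0 :> k -> exists n, c ^+ n = 0) ->
  tlift (fun b c => (counit c : k) *: b) t = 0 -> exists n, t ^+ n = 0.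
Proof.
move=> nilC t0; pose c' l : C := gbasis l - (counit (gbasis l : C) : k)%:A.
have pureB (b : B) u c : pure b (u - c%:A) = pure b u - inl_t C (c *: b).
  by rewrite !pureE linearB /= rmorph_alg mulrBr mulr_algr [inl_t C (c *: b)]linearZ.
have -> : t = \sum_i \sum_l t i l *: pure (gbasis i) (c' l).
  have E0 : \sum_i \sum_l t i l *: inl_t C ((counit (gbasis l : C) : k) *: gbasis i) = 0.
    transitivity (inl_t C (tlift (fun b c => (counit c : k) *: b) t)); last by rewrite t0 raddf0.
    rewrite /tlift linear_sum; apply: eq_bigr => i _; rewrite linear_sum.
    by apply: eq_bigr => l _; rewrite [RHS]linearZ.
  transitivity (t - 0); first by rewrite subr0.
  rewrite -[X in _ - X]E0 {1}[t]tensor_sum -sumrB; apply: eq_bigr => i _.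
  by rewrite -sumrB; apply: eq_bigr => l _; rewrite -scalerBr pureB.
apply: nilpotent_sum => i; apply: nilpotent_sum => l.
have [|n Hn] := nilC (c' l); first by rewrite raddfB /= counitZ rmorph1 mulr1 subrr.
by exists n; rewrite exprZn pureE exprMn -[inr_t _ _ ^+ n]rmorphXn Hn raddf0 mulr0 scaler0.
Qed.

Lemma tensor_nilpotent_l (t : tensor B C) :
  (forall b : B, counit b = 0 :> k -> exists n, b ^+ n = 0) ->
  tlift (fun b c => (counit b : k) *: c) t = 0 -> exists n, t ^+ n = 0.
Proof.
move=> nilB t0; pose b' l : B := gbasis l - (counit (gbasis l : B) : k)%:A.
have pureB u (c : C) a : pure (u - a%:A) c = pure u c - inr_t B (a *: c).
  by rewrite !pureE linearB /= rmorph_alg mulrBl mulr_algl [inr_t B (a *: c)]linearZ.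
have -> : t = \sum_i \sum_l t i l *: pure (b' i) (gbasis l).
  have E0 : \sum_i \sum_l t i l *: inr_t B ((counit (gbasis i : B) : k) *: gbasis l) = 0.
    transitivity (inr_t B (tlift (fun b c => (counit b : k) *: c) t)); last by rewrite t0 raddf0.
    rewrite /tlift linear_sum; apply: eq_bigr => i _; rewrite linear_sum.
    by apply: eq_bigr => l _; rewrite [RHS]linearZ.
  transitivity (t - 0); first by rewrite subr0.
  rewrite -[X in _ - X]E0 {1}[t]tensor_sum -sumrB; apply: eq_bigr => i _.
  by rewrite -sumrB; apply: eq_bigr => l _; rewrite -scalerBr pureB.
apply: nilpotent_sum => i; apply: nilpotent_sum => l.
have [|n Hn] := nilB (b' i); first by rewrite raddfB /= counitZ rmorph1 mulr1 subrr.
by exists n; rewrite exprZn pureE exprMn -[inl_t _ _ ^+ n]rmorphXn Hn raddf0 mul0r scaler0.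
Qed.

End TensorNilpotent.

(** * The idempotent of the identity component and the integral of G0/N *)

Section IdentityComponent.
Variables (k : closedFieldType) (kG kG0 : finCommHopfType k) (r : hopfMorphism kG kG0).
Hypothesis connG0 : forall c : kG0, c * c = c -> c = 0 \/ c = 1.
Variable e : kG.
Hypotheses (ee : e * e = e) (eP : forall x, r x = 0 <-> exists y, x = (1 - e) * y).

Lemma component_res : r e = 1.
Proof.
apply/eqP; rewrite -subr_eq0 -(rmorph1 r) -rmorphB -oppr_eq0 -rmorphN opprB.
by apply/eqP/eP; exists 1; rewrite mulr1.
Qed.

Lemma component_counit : counit e = 1 :> k.
Proof. by rewrite -(hopf_counit r) component_res rmorph1. Qed.

Lemma component_mul x y : r x = r y -> e * x = e * y.
Proof.
move=> E; apply/eqP; rewrite -subr_eq0 -mulrBr.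
have /eP[z ->] : r (x - y) = 0 by rewrite linearB /= E subrr.
by rewrite mulrA mulrBr mulr1 ee subrr mul0r.
Qed.

(** As functions of (g, g0) the idempotents e(g g0) and e(g) agree at g0 = 1; since G0 is
    infinitesimal, their difference is nilpotent. *)
Lemma component_invr : conv (inl_t kG0) (inr_t kG \o r) e = inl_t kG0 e.
Proof.
apply: idempotent_nilpotent; rewrite -?rmorphM ?ee //.
apply: tensor_nilpotent_r; first exact: aug_nilpotent.
pose F := @tlift k kG kG0 kG (fun b c => (counit c : k) *: b).
have FP : bilinear_map (fun (b : kG) (c : kG0) => (counit c : k) *: b).
  split=> [? a ? ?|? a ? ?]; first by rewrite scalerDr !scalerA mulrC.
  by rewrite linearP scalerDl -scalerA.
have FB u v : F (u - v) = F u - F v.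
  by rewrite [u - v]addrC -[- v]scaleN1r /F tlift_linear scaleN1r addrC.
rewrite -/(F _) FB [F (inl_t _ e)]tlift_pure // rmorph1 scale1r.
have -> : F (conv (inl_t kG0) (inr_t kG \o r) e) = e; last by rewrite subrr.
have F0 : F 0 = 0 by rewrite -(subrr 0) FB subrr.
rewrite -[RHS]counitr /conv; elim: (comul e) => [|p s IHs]; first by rewrite !big_nil.
rewrite !big_cons -IHs -[X in F (X + _)]scale1r {1}/F tlift_linear scale1r; congr (_ + _).
by rewrite -pureE tlift_pure // hopf_counit.
Qed.

Lemma component_invl : conv (inl_t kG \o r) (inr_t kG0) e = inr_t kG0 e.
Proof.
apply: idempotent_nilpotent; rewrite -?rmorphM ?ee //.
apply: tensor_nilpotent_l; first exact: aug_nilpotent.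
pose F := @tlift k kG0 kG kG (fun b c => (counit b : k) *: c).
have FP : bilinear_map (fun (b : kG0) (c : kG) => (counit b : k) *: c).
  split=> [? a ? ?|? a ? ?]; last by rewrite scalerDr !scalerA mulrC.
  by rewrite linearP scalerDl -scalerA.
have FB u v : F (u - v) = F u - F v.
  by rewrite [u - v]addrC -[- v]scaleN1r /F tlift_linear scaleN1r addrC.
rewrite -/(F _) FB [F (inr_t _ e)]tlift_pure // rmorph1 scale1r.
have -> : F (conv (inl_t kG \o r) (inr_t kG0) e) = e; last by rewrite subrr.
have F0 : F 0 = 0 by rewrite -(subrr 0) FB subrr.
rewrite -[RHS]counitl /conv; elim: (comul e) => [|p s IHs]; first by rewrite !big_nil.
rewrite !big_cons -IHs -[X in F (X + _)]scale1r {1}/F tlift_linear scale1r; congr (_ + _).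
by rewrite -pureE tlift_pure // hopf_counit.
Qed.

Lemma tapp_convr mu nu x :
  tapp mu nu (conv (inl_t kG0) (inr_t kG \o r) x) = galg_app (mu * galg_map r nu) x.
Proof.
rewrite galgM linear_sum; apply: eq_bigr => p _.
by rewrite galg_mapE; apply: tapp_lr.
Qed.

Lemma tapp_convl mu nu x :
  tapp mu nu (conv (inl_t kG \o r) (inr_t kG0) x) = galg_app (galg_map r mu * nu) x.
Proof.
rewrite galgM linear_sum; apply: eq_bigr => p _.
by rewrite galg_mapE; apply: tapp_lr.
Qed.

Section Quotients.
Variables (kN kQ kQ0 : finCommHopfType k) (f0 : hopfMorphism kG0 kN).
Variables (j : hopfMorphism kQ kG) (q : hopfMorphism kQ0 kG0).
Hypotheses (surj_r : closed_subgroup r).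
Hypotheses (jP : quotient_by j (hopf_comp f0 r)) (qP : quotient_by q f0).

(** The extension by zero of an N-invariant function on G0 is N-invariant on G, because e is
    invariant under translation by N. *)
Lemma component_cut x : (exists a, r x = q a) -> exists b, e * x = j b.
Proof.
move=> rx; apply/(quotient_fixedP jP).
have /(quotient_fixedP qP) fix_rx : exists a, r x = q a by [].
pose lift : kG0 -> kG := (linfun r)^-1%VF.
have liftK z : r (lift z) = z.
  have [y <-] := surj_r z; rewrite -[r y]lfunE /lift -[r _]lfunE.
  by rewrite limg_lfunVK // memv_img ?memvf.
have e_inv : conv (inl_t kN) (inr_t kG \o hopf_comp f0 r) e = inl_t kN e.
  have := congr1 (tpair (inl_t kN) (inr_t kG \o f0)) component_invr.
  rewrite tpair_inl => <-; rewrite {2}/conv linear_sum; apply: eq_bigr => p _.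
  by rewrite rmorphM /= tpair_inl tpair_inr.
rewrite !rmorphM /= e_inv; set t := conv _ _ x.
(* [H] restricts the first factor to G0 and [K] extends it by zero, so K H is multiplication by e
   (x) 1. *)
pose H : tensor kG kN -> tensor kG0 kN := tpair (inl_t kN \o r) (inr_t kG0).
pose K : tensor kG0 kN -> tensor kG kN := tlift (fun z c => inl_t kN (e * lift z) * inr_t kG c).
have KP : bilinear_map (fun z (c : kN) => inl_t kN (e * lift z) * inr_t kG c).
  split=> [c a u v|z a u v]; last by rewrite linearP mulrDr -scalerAr.
  by rewrite /lift linearP mulrDr -scalerAr linearP mulrDl -scalerAl.
have KH s : K (H s) = inl_t kN e * s.
  move: s; apply: tensor_ext => [a u v|a u v|b c].
  - by rewrite /H linearP /K tlift_linear.
  - by rewrite mulrDr -scalerAr.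
  rewrite /H tpair_pure /= -pureE /K tlift_pure // (component_mul (liftK (r b))).
  by rewrite pureE rmorphM mulrA.
rewrite -!KH; congr (K _); rewrite /H tpair_inl /= -fix_rx /t.
rewrite {1}/conv linear_sum /conv.
rewrite (hopf_comul r x (conv_bilinear (inl_t kN) (inr_t kG0 \o f0))) big_map.
by apply: eq_bigr => p _; rewrite rmorphM /= tpair_inl tpair_inr.
Qed.

Lemma connected_quotient (c : kQ0) : c * c = c -> c = 0 \/ c = 1.
Proof.
move=> cc; have [inj_q _] := qP; have : q c * q c = q c by rewrite -rmorphM cc.
by case/connG0 => E; [left|right]; apply: inj_q; rewrite E ?rmorph0 ?rmorph1.
Qed.

(* kQ = U + W as left ideals, where U is generated by the augmentation ideal  *)
(* of the subgroup G0/N; the W-component w of 1 restricts to a normalized     *)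
(* integral on the identity component.                                        *)
Lemma component_integral : linearly_reductive kQ ->
  exists e0 : galg kQ0, (forall nu, nu * e0 = galg_app nu 1 *: e0) /\ galg_app e0 1 = 1.
Proof.
move=> lrQ; have [inj_j _] := jP; have [inj_q _] := qP.
pose restr nu := galg_map j (galg_map r nu).
have restr1 nu : galg_app (restr nu) 1 = galg_app nu 1.
  by rewrite !galg_mapE !rmorph1.
have [b0 eb0] : exists b, e = j b.
  have [|b Eb] := @component_cut 1; first by exists 1; rewrite !rmorph1.
  by exists b; rewrite -Eb mulr1.
have [D DP] : exists D : {vspace galg kQ}, forall u, u \in D <->
    exists nu, galg_app nu 1 = 0 /\ u = restr nu.
  apply: vspace_of_pred => [|a u v [nu [nu1 ->]] [nu' [nu1' ->]]].
    by exists 0; rewrite galg0E /restr; split=> //; apply: galgP => x; rewrite !galg_mapE !galg0E.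
  exists (a *: nu + nu'); rewrite galgDE galgZE nu1 nu1' mulr0 addr0; split=> //.
  by rewrite /restr !galg_map_linear.
have [|w [w0 w1]] := @semisimple_split _ _ (fullv * D)%VS lrQ.
  move=> a u Uu; suff /subvP : ((fullv * D)%VS <= (amull a @^-1: (fullv * D)))%VS.
    by move/(_ u Uu); rewrite -memv_preim lfunE.
  by apply/prodvP => x y _ Dy; rewrite -memv_preim lfunE /= mulrA memv_mul ?memvf.
have app11 : galg_app (1 : galg kQ) 1 = 1 by rewrite galg_app1 rmorph1.
have restr_w nu : restr nu * w = galg_app nu 1 *: w.
  apply/eqP; rewrite -subr_eq0 -[in X in _ - X](mul1r w) scalerAl -mulrBl; apply/eqP/w0.
  rewrite -[X in X \in _]mul1r memv_mul ?memvf //; apply/DP.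
  exists (- galg_app nu 1 *: 1 + nu).
  rewrite galgDE !galgZE galg_app1 rmorph1 mulr1 addNr; split=> //.
  by rewrite /restr !galg_map_linear !galg_map1 scaleNr addrC.
have w_b0 : galg_app w b0 = 1.
  have : 1 - w \in lker (galg_ev b0).
    apply: subvP w1; apply/prodvP => mu u _ /DP[nu [nu1 ->]]; rewrite memv_ker_ev.
    have [mu' <-] := galg_map_surj mu inj_j.
    rewrite -galg_mapM galg_mapE -eb0 -tapp_convr component_invr -[inl_t _ _]mulr1.
    by rewrite -(rmorph1 (inr_t kG)) tapp_lr nu1 mulr0.
  rewrite memv_ker_ev -scaleN1r galgDE galgZE mulN1r subr_eq0 galg_app1.
  by rewrite -(hopf_counit j) -eb0 component_counit => /eqP.
have [w' w'P] := galg_map_surj w inj_j.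
pose lift : kG0 -> kG := (linfun r)^-1%VF.
have liftK z : r (lift z) = z.
  have [y <-] := surj_r z; rewrite -[r y]lfunE /lift -[r _]lfunE.
  by rewrite limg_lfunVK // memv_img ?memvf.
(* Extension by zero from G0 to G followed by [w']; the factor e makes it independent of the
   lift. *)
pose F (z : kG0) : k^o := galg_app w' (e * lift z).
have F_linear : linear F.
  by move=> a u v; rewrite /F /lift linearP mulrDr -scalerAr galg_app_linear.
pose F' : {linear kG0 -> k^o} := HB.pack F (GRing.isLinear.Build k kG0 k^o *:%R F F_linear).
pose e0 : galg kQ0 := linfun (F' \o q).
have e0E a : galg_app e0 a = F (q a) by rewrite /galg_app lfunE.
have Fr x : F (r x) = galg_app w' (e * x) by rewrite /F (component_mul (liftK _)).
exists e0; split=> [nu|]; last first.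
  by rewrite e0E rmorph1 -(rmorph1 r) Fr mulr1 eb0 -galg_mapE w'P.
apply: galgP => a; have [nu' nuP] := galg_map_surj nu inj_q.
rewrite galgZE e0E; pose x := lift (q a); have rx : r x = q a by apply: liftK.
have [|b Eb] := @component_cut x; first by exists a.
rewrite -rx Fr Eb -galg_mapE w'P.
have -> : galg_app nu 1 = galg_app nu' 1 by rewrite -nuP galg_mapE rmorph1.
rewrite -galgZE -restr_w -w'P -galg_mapM galg_mapE -Eb -tapp_convl rmorphM /= component_invl.
have FP : bilinear_map (fun u v : kG0 => galg_app nu' u * F v : k^o).
  split=> [? c ? ?|? c ? ?]; first by rewrite galg_app_linear mulrDl scalerAl.
  by rewrite F_linear mulrDr scalerAr.
rewrite galgM -nuP.
have -> : \sum_(p <- comul a) galg_app (galg_map q nu') p.1 * galg_app e0 p.2 =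
    \sum_(p <- comul (q a)) galg_app nu' p.1 * F p.2.
  rewrite (hopf_comul q a FP) big_map; apply: eq_bigr => p _.
  by rewrite galg_mapE e0E.
rewrite -rx (hopf_comul r x FP) big_map /conv mulr_sumr linear_sum.
apply: eq_bigr => p _; rewrite Fr.
by rewrite mulrCA -rmorphM; apply/esym/tapp_lr.
Qed.

End Quotients.
End IdentityComponent.

(** * Residues of endomorphisms *)

Lemma scalar_mx0 (R : nmodType) n : (0%:M : 'M[R]_n) = 0.
Proof. by apply/matrixP => i j; rewrite !mxE mul0rn. Qed.

Lemma nunitmx0 (F : fieldType) n : (0 < n)%N -> (0 : 'M[F]_n) \notin unitmx.
Proof. by case: n => // n _; rewrite unitmxE det0 unitr0. Qed.

Section Slices.
Variable R : comPzRingType.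

(* The coordinate map U (x) S -> U along the j-th basis vector of S. *)
Definition slice m s (j : 'I_s) : 'M[R]_(m, m * s) :=
  \matrix_(i, l) (l == mxtens_index (i, j))%:R.

Lemma slice_mulE m s n (j : 'I_s) (X : 'M[R]_(m * s, n)) i c :
  (slice m j *m X) i c = X (mxtens_index (i, j)) c.
Proof.
rewrite mxE (bigD1 (mxtens_index (i, j))) //= mxE eqxx mul1r big1 ?addr0 // => l /negbTE nl.
by rewrite mxE nl mul0r.
Qed.

Lemma slice_sep m s n (X Y : 'M[R]_(m * s, n)) :
  (forall j, slice m j *m X = slice m j *m Y) -> X = Y.
Proof.
move=> E; apply/matrixP => l c; case: (mxtens_indexP l) => i j.
by rewrite -!slice_mulE E.
Qed.

Lemma slice_tens m n s t (A : 'M[R]_(m, n)) (B : 'M[R]_(s, t)) j :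
  slice m j *m (A *t B) = \sum_l B j l *: (A *m slice n l).
Proof.
apply/matrixP => i c; rewrite slice_mulE summxE; case: (mxtens_indexP c) => i' j'.
rewrite tensmxE (bigD1 j') //= big1 ?addr0 => [|l nl].
  rewrite !mxE (bigD1 i') //= !mxE eqxx mulr1 big1 ?addr0 1?mulrC // => l nl.
  rewrite !mxE (inj_eq (can_inj (@mxtens_indexK _ _))) xpair_eqE eq_sym (negbTE nl).
  by rewrite mulr0.
rewrite !mxE big1 ?mulr0 // => l' _.
rewrite !mxE (inj_eq (can_inj (@mxtens_indexK _ _))) xpair_eqE [j' == l]eq_sym (negbTE nl).
by rewrite andbF mulr0.
Qed.

Lemma slice_trT m s (j l : 'I_s) : slice m j *m (slice m l)^T = (j == l)%:R%:M.
Proof.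
apply/matrixP => i i'; rewrite slice_mulE !mxE (inj_eq (can_inj (@mxtens_indexK _ _))).
by rewrite xpair_eqE; case: (i == i'); case: (j == l); rewrite ?mulr1n ?mulr0n ?mul0rn.
Qed.

Lemma slice_sum m s : \sum_(j < s) (slice m j)^T *m slice m j = 1%:M.
Proof.
apply: slice_sep => l; rewrite mulmx_sumr mulmx1 (bigD1 l) //= mulmxA slice_trT eqxx.
rewrite mul1mx big1 ?addr0 // => j nj.
by rewrite mulmxA slice_trT eq_sym (negbTE nj) scalar_mx0 mul0mx.
Qed.

Lemma tens_slice m n s t (A : 'M[R]_(m, n)) (B : 'M[R]_(s, t)) l :
  (A *t B) *m (slice n l)^T = \sum_j B j l *: ((slice m j)^T *m A).
Proof.
apply: slice_sep => i; rewrite mulmxA slice_tens mulmx_suml mulmx_sumr.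
rewrite (bigD1 l) //= -scalemxAl -mulmxA slice_trT eqxx mulmx1 big1 ?addr0 => [|j nj].
  rewrite (bigD1 i) //= -scalemxAr mulmxA slice_trT eqxx mul1mx big1 ?addr0 // => j nj.
  by rewrite -scalemxAr mulmxA slice_trT eq_sym (negbTE nj) scalar_mx0 mul0mx scaler0.
by rewrite -scalemxAl -mulmxA slice_trT (negbTE nj) scalar_mx0 mulmx0 scaler0.
Qed.

End Slices.
Arguments slice {R} m {s} j.

Lemma map_slice (R R' : comPzRingType) (h : {rmorphism R -> R'}) m s (j : 'I_s) :
  map_mx h (slice m j) = slice m j.
Proof. by apply/matrixP => i l; rewrite !mxE rmorph_nat. Qed.

Section LocalEnd.
Variables (k : closedFieldType) (A : falgType k).

Lemma mod_hom_inv (X Y : fdmodule A) (f : 'M[k]_(mdim Y, mdim X)) g :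
  mod_hom f -> g *m f = 1%:M -> f *m g = 1%:M -> @mod_hom k A Y X g.
Proof.
move=> homf gf fg a; rewrite -[g *m _]mulmx1 -fg !mulmxA.
by rewrite -[_ *m _ *m f]mulmxA -homf mulmxA gf mul1mx.
Qed.

Definition local_end (U : fdmodule A) : Prop :=
  mdim U <> 0%N /\ forall phi psi : 'M[k]_(mdim U),
    @mod_hom k A U U phi -> @mod_hom k A U U psi ->
    phi \notin unitmx -> psi \notin unitmx -> phi + psi \notin unitmx.

(** Non-invertible endomorphisms of U factor through g, and so do their sums; an invertible sum
    would split g. *)
Lemma right_almost_split_local (X U : fdmodule A) (g : 'M[k]_(mdim U, mdim X)) :
  right_almost_split g -> local_end U.
Proof.
move=> [homg nsplit fact]; split=> [U0|phi psi homphi hompsi nphi npsi].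
  apply: nsplit; exists 0; split=> [a|]; first by rewrite mul0mx mulmx0.
  by apply/matrixP => -[i lti] j; exfalso; move: lti; rewrite U0.
have factor (chi : 'M[k]_(mdim U)) : @mod_hom k A U U chi -> chi \notin unitmx ->
    exists u : 'M[k]_(mdim X, mdim U), @mod_hom k A U X u /\ chi = g *m u.
  move=> homchi nchi; apply: fact => // -[s [_ E]].
  by case/negP: nchi; case: (mulmx1_unit E).
have [u [homu ->]] := factor _ homphi nphi; have [v [homv ->]] := factor _ hompsi npsi.
rewrite -mulmxDr; apply/negP => Uw; apply: nsplit.
have homw : @mod_hom k A U U (g *m (u + v)).
  by apply: (@mod_homM _ _ U X U) => // a; rewrite mulmxDl mulmxDr homu homv.
exists ((u + v) *m invmx (g *m (u + v))); split; last by rewrite mulmxA mulmxV.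
apply: (@mod_homM _ _ U U X); last by move=> a; rewrite mulmxDl mulmxDr homu homv.
by apply: (mod_hom_inv homw); rewrite ?mulVmx ?mulmxV.
Qed.

Lemma left_almost_split_local (X U : fdmodule A) (g : 'M[k]_(mdim X, mdim U)) :
  left_almost_split g -> local_end U.
Proof.
move=> [homg nsplit fact]; split=> [U0|phi psi homphi hompsi nphi npsi].
  apply: nsplit; exists 0; split=> [a|]; first by rewrite mul0mx mulmx0.
  by apply/matrixP => -[i lti] j; exfalso; move: lti; rewrite U0.
have factor (chi : 'M[k]_(mdim U)) : @mod_hom k A U U chi -> chi \notin unitmx ->
    exists u : 'M[k]_(mdim U, mdim X), @mod_hom k A X U u /\ chi = u *m g.
  move=> homchi nchi; apply: fact => // -[s [_ E]].
  by case/negP: nchi; case: (mulmx1_unit E).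
have [u [homu ->]] := factor _ homphi nphi; have [v [homv ->]] := factor _ hompsi npsi.
rewrite -mulmxDl; apply/negP => Uw; apply: nsplit.
have homw : @mod_hom k A U U ((u + v) *m g).
  by apply: (@mod_homM _ _ U X U) => // a; rewrite mulmxDl mulmxDr homu homv.
exists (invmx ((u + v) *m g) *m (u + v)); split; last by rewrite -mulmxA mulVmx.
apply: (@mod_homM _ _ X U U); first by move=> a; rewrite mulmxDl mulmxDr homu homv.
by apply: (mod_hom_inv homw); rewrite ?mulVmx ?mulmxV.
Qed.

(** Some eigenvalue of phi, with 0 as default for the empty matrix. If the endomorphism ring is
    local, it is the only one ([residue_uniq]), and this is the residue map to k. *)
Definition residue n (phi : 'M[k]_n) : k :=
  head 0 (sval (closed_field_poly_normal (char_poly phi))).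

Lemma residue_nunit n (phi : 'M[k]_n) : (0 < n)%N -> phi - (residue phi)%:M \notin unitmx.
Proof.
move=> n_gt0; rewrite /residue; case: closed_field_poly_normal => r /= Er.
have : root (char_poly phi) (head 0 r).
  case: r Er => [|c r] Er; last first.
    by rewrite Er rootZ ?big_cons ?rootM ?root_XsubC ?eqxx // lead_coef_eq0 monic_neq0 ?char_poly_monic.
  have := size_char_poly phi; rewrite Er big_nil alg_polyC size_polyC.
  by case: (_ != 0) => //= -[E]; rewrite -E in n_gt0.
rewrite -eigenvalue_root_char => /eigenvalueP[v Ev nz_v]; apply/negP => U.
case/eqP: nz_v; rewrite -[v](mulmxK U) mulmxBr Ev -mul_mx_scalar subrr mul0mx.
by [].
Qed.

Section Residue.
Variable U : fdmodule A.
Hypothesis locU : local_end U.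
Local Notation hom phi := (@mod_hom k A U U phi).
Implicit Types phi psi : 'M[k]_(mdim U).

Lemma local_gt0 : (0 < mdim U)%N.
Proof. by rewrite lt0n; apply/eqP; case: locU. Qed.

Lemma mod_homP_scalar phi psi c : hom phi -> hom psi -> hom (c *: phi + psi).
Proof.
by move=> hp hs a; rewrite mulmxDl mulmxDr -scalemxAl -scalemxAr hp hs.
Qed.

Lemma mod_hom_scalar c : hom c%:M.
Proof. by move=> a; rewrite scalar_mxC. Qed.

Lemma nunitZ phi c : phi \notin unitmx -> c *: phi \notin unitmx.
Proof.
have [->|nz_c] := eqVneq c 0; last by rewrite unitmxZ // unitfE.
by rewrite scale0r nunitmx0 ?local_gt0.
Qed.

Lemma residue_uniq phi c : hom phi -> phi - c%:M \notin unitmx -> residue phi = c.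
Proof.
move=> hp nc; have [_ loc] := locU; apply/eqP; apply: contraT => nz.
have homB d : hom (phi - d%:M).
  by move=> a; rewrite mulmxBl mulmxBr hp scalar_mxC.
have homN : hom (-1 *: (phi - (residue phi)%:M)).
  by move=> a; rewrite -scalemxAl -scalemxAr homB.
have := loc _ _ (homB c) homN nc (nunitZ (-1) (residue_nunit phi local_gt0)).
rewrite scaleN1r opprB addrC addrA subrK -raddfB /= -scalemx1 unitmxZ ?unitmx1 //.
by rewrite unitfE subr_eq0.
Qed.

Lemma residueP c phi psi : hom phi -> hom psi ->
  residue (c *: phi + psi) = c * residue phi + residue psi.
Proof.
move=> hp hs; have [_ loc] := locU; apply: residue_uniq; first exact: mod_homP_scalar.
have -> : c *: phi + psi - (c * residue phi + residue psi)%:M =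
    c *: (phi - (residue phi)%:M) + (psi - (residue psi)%:M).
  by rewrite scalerBr scale_scalar_mx raddfD /= opprD addrACA.
have homB (chi : 'M[k]_(mdim U)) d : hom chi -> hom (chi - d%:M).
  by move=> hc a; rewrite mulmxBl mulmxBr hc scalar_mxC.
apply: loc; [|exact: homB|exact: nunitZ (residue_nunit _ local_gt0)|exact: residue_nunit local_gt0].
by move=> a; rewrite -scalemxAl -scalemxAr homB.
Qed.

Lemma residue_scalar c : residue (c%:M : 'M[k]_(mdim U)) = c.
Proof.
apply: residue_uniq; first exact: mod_hom_scalar.
by rewrite subrr nunitmx0 ?local_gt0.
Qed.

Lemma residue0 : residue (0 : 'M[k]_(mdim U)) = 0.
Proof. by rewrite -(scalar_mx0 _ (mdim U)) residue_scalar. Qed.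

Lemma residue_sum (I : Type) (s : seq I) (F : I -> 'M[k]_(mdim U)) : (forall i, hom (F i)) ->
  hom (\sum_(i <- s) F i) /\ residue (\sum_(i <- s) F i) = \sum_(i <- s) residue (F i).
Proof.
move=> hF; elim: s => [|i s [IHh IHr]].
  by rewrite !big_nil residue0; split=> // a; rewrite mul0mx mulmx0.
rewrite !big_cons -[F i]scale1r (residueP _ (hF i) IHh) IHr mul1r.
split; first exact: mod_homP_scalar (hF i) IHh.
by rewrite scale1r.
Qed.

Lemma residueZ c phi : hom phi -> residue (c *: phi) = c * residue phi.
Proof.
move=> hp; rewrite -[c *: phi]addr0 residueP ?residue0 ?addr0 // => a.
by rewrite mul0mx mulmx0.
Qed.

Lemma residue_unit phi : hom phi -> (phi \in unitmx) = (residue phi != 0).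
Proof.
move=> hp; apply/idP/idP => [U0|nz].
  apply/eqP => E; have := residue_nunit phi local_gt0.
  by rewrite E scalar_mx0 subr0 U0.
apply: contraLR nz => np; rewrite negbK; apply/eqP; apply: residue_uniq => //.
by rewrite scalar_mx0 subr0.
Qed.

Lemma residueM phi psi : hom phi -> hom psi ->
  residue (phi *m psi) = residue phi * residue psi.
Proof.
move=> hp hs; set r := residue phi; set t := residue psi.
have hM (f g : 'M[k]_(mdim U)) : hom f -> hom g -> hom (f *m g).
  by move=> hf hg; apply: (@mod_homM _ _ U U U).
have homB (chi : 'M[k]_(mdim U)) d : hom chi -> hom (chi - d%:M).
  by move=> hc a; rewrite mulmxBl mulmxBr hc scalar_mxC.
have -> : phi *m psi = 1 *: ((phi - r%:M) *m psi) + r *: psi.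
  by rewrite scale1r mulmxBl mul_scalar_mx subrK.
rewrite residueP ?residueZ // ?mul1r; first last.
- by move=> a; rewrite -scalemxAl -scalemxAr hs.
- exact/hM/hs/homB.
suff -> : residue ((phi - r%:M) *m psi) = 0 by rewrite add0r.
apply/eqP; rewrite -[_ == 0]negbK -residue_unit ?unitmx_mul ?negb_and; last exact/hM/hs/homB.
by rewrite residue_nunit ?local_gt0.
Qed.

(** If left multiplication by phi is not nilpotent at 1, it has an eigenvalue a != 0; then phi - a
    is singular and the residue is a. *)
Lemma residue0_nilpotent phi : hom phi -> residue phi = 0 -> exists m, phi ^+ m = 0.
Proof.
move=> hp r0; pose T : {linear 'M[k]_(mdim U) -> 'M[k]_(mdim U)} := mulmx phi.
have [//|//|[m Em]|[a [v [nz_a nz_v _ Ev]]]] :=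
    @nil_or_eigen _ _ T (fun _ => True) _ _ 1%:M I.
  exists m; rewrite -[RHS]Em; elim: m {Em} => //= m <-.
  by rewrite exprS.
case/eqP: nz_a; rewrite -r0; apply/esym/residue_uniq => //; apply/negP => Ua.
case/eqP: nz_v; rewrite -[v](mulKmx Ua) mulmxBl mul_scalar_mx.
by rewrite -[phi *m v]/(T v) Ev subrr mulmx0.
Qed.

End Residue.
End LocalEnd.

Lemma character_app (k : fieldType) (B : finCommHopfType k) (l : B) mu nu :
  is_character l -> galg_app (mu * nu) l = galg_app mu l * galg_app nu l.
Proof. by move=> [lP _]; rewrite galgM (lP _ _ (mul_bilinear mu nu)) big_seq1. Qed.

Lemma character_basis (k : fieldType) (B : finCommHopfType k) :
  (forall U : {vspace B}, (forall l, is_character l -> l \in U) -> U = fullv) ->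
  exists s : seq B, [/\ free s, <<s>>%VS = fullv & forall l, l \in s -> is_character l].
Proof.
move=> span; pose d := \dim {:B}.
suff ext n : exists s : seq B, [/\ free s, forall l, l \in s -> is_character l
    & <<s>>%VS = fullv \/ size s = n].
  have [s [fs cs [fullS|sz]]] := ext d.+1; first by exists s.
  by have := dimvS (subvf <<s>>%VS); rewrite (eqP fs) sz ltnn.
elim: n => [|n [s [fs cs [fullS|sz]]]]; last 2 first.
- by exists s; split=> //; left.
- have [fullS|nfull] := eqVneq <<s>>%VS fullv; first by exists s; split=> //; left.
  have /not_all_ex_not[l nl] : ~ forall l, is_character l -> l \in <<s>>%VS.
    by move=> H; case/eqP: nfull; apply: span.
  have [lP /negP nls] := imply_to_and _ _ nl.
  exists (l :: s); split; [by rewrite free_cons nls| |by right; rewrite /= sz].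
  by move=> m; rewrite inE => /predU1P[->|/cs].
by exists [::]; split=> //; [exact: nil_free|right].
Qed.

Section Weights.
Variables (k : closedFieldType) (kG kN kQ : finCommHopfType k).
Variables (f : hopfMorphism kG kN) (q : hopfMorphism kQ kG).
Hypothesis qP : quotient_by q f.
Variable V : fdmodule (galg kG).
Hypotheses (locV : local_end (res f V)) (regV : regular q V).
Implicit Types (phi : 'M[k]_(mdim V)).
Local Notation homN phi := (@mod_hom k (galg kN) (res f V) (res f V) phi).

(** An invertible phi of weight l is an isomorphism V (x) k_l -> V. In this section [kG] and [kQ]
    stand for G0 and G0/N. *)
Lemma weight_iso phi (l : kQ) (char_l : is_character l) :
  (forall nu, conj_act (X := V) (Y := V) nu phi = galg_app nu (q l) *: phi) ->
  phi \in unitmx -> l = 1.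
Proof.
move=> wphi Uphi; apply: (regV (char_l := char_l)).
set L := res q (char_mod char_l).
have genL : gen L 0 0 = q l.
  rewrite gen_res !mxE; congr (q _); apply: galg_sep => mu.
  by rewrite -mcoefE [mact _ _ _ _]mxE eqxx mulr1n.
have gen_phi : gen V *m cst kG phi = q l *: (cst kG phi *m gen V).
  have EG : Gam V V phi = q l *: cst kG phi.
    apply: ev_sep => nu; rewrite -conj_actE wphi; apply/matrixP => i j.
    by rewrite !mxE /= mulr_algr galg_appZ mulrC.
  by rewrite -[LHS]mulmx1 -(igen_gen V) mulmxA -[gen V *m _ *m _]/(Gam V V phi) EG -scalemxAl.
pose P : 'M[k]_(mdim V, mdim V * 1) := phi *m slice (mdim V) 0.
pose P' : 'M[k]_(mdim V * 1, mdim V) := (slice (mdim V) 0)^T *m invmx phi.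
have homP : @mod_hom k (galg kG) (tens V L) V P.
  apply/mod_hom_gen; rewrite gen_tens /P cstM /cst map_slice -/(cst kG phi).
  rewrite -[RHS]mulmxA slice_tens big_ord1 genL mulmxA gen_phi.
  by rewrite -scalemxAr -scalemxAl mulmxA.
have P'P : P' *m P = 1%:M.
  rewrite /P' /P mulmxA mulmxKV //; have := slice_sum k (mdim V) 1.
  by rewrite big_ord1.
have PP' : P *m P' = 1%:M.
  by rewrite /P' /P -mulmxA (mulmxA (slice _ _)) slice_trT eqxx mul1mx mulmxV.
exists P; split=> //; exists P'; split=> //.
exact: mod_hom_inv homP P'P PP'.
Qed.

Hypothesis spanQ : forall U : {vspace kQ}, (forall l, is_character l -> l \in U) -> U = fullv.

Lemma residue_conj_weights phi nu : homN phi ->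
  residue (conj_act (X := V) (Y := V) nu phi) = galg_app nu 1 * residue phi.
Proof.
move=> homphi; have [inj_q _] := qP.
have [s [fs fullS cs]] := character_basis spanQ; pose t := in_tuple s.
have charS (i : 'I_(size s)) : is_character (t`_i : kQ) by apply/cs/mem_nth.
have coordS y : y = \sum_(i < size s) coord t i y *: t`_i.
  by apply: (coord_span (X := t)); rewrite fullS memvf.
(* Conjugation by a lift of the i-th coordinate functional extracts the component whose weight is
   the i-th basis character. *)
have /fin_all_exists[e eP] : forall i : 'I_(size s), exists e : galg kG,
    forall y, galg_app e (q y) = coord t i y.
  move=> i; pose w : galg kQ := linfun (coord t i : kQ -> k^o).
  have [mu muP] := galg_map_surj w inj_q; exists mu => y.
  by rewrite -galg_mapE muP /galg_app lfunE.
pose ph (i : 'I_(size s)) := conj_act (X := V) (Y := V) (e i) phi.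
have homph (i : 'I_(size s)) : homN (ph i) by apply: (conj_act_hom qP homphi).
have decomp mu : conj_act (X := V) (Y := V) mu phi = \sum_(i < size s) galg_app mu (q t`_i) *: ph i.
  apply/matrixP => a b; rewrite conj_act_coef summxE.
  have [y Ey] := hom_Gam_fixed qP homphi a b.
  rewrite Ey [in LHS](coordS y) linear_sum galg_app_sum; apply: eq_bigr => i _.
  by rewrite linearZ /= galg_appZ mxE conj_act_coef Ey eP mulrC.
have weight (i : 'I_(size s)) mu : conj_act (X := V) (Y := V) mu (ph i) = galg_app mu (q t`_i) *: ph i.
  rewrite /ph -conj_actM decomp (bigD1 i) //= big1 ?addr0 => [|l nl].
    by rewrite -galg_mapE galg_mapM character_app // !galg_mapE eP coord_free // eqxx mulr1.
  rewrite -galg_mapE galg_mapM character_app // !galg_mapE eP coord_free //.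
  by rewrite (negbTE nl) mulr0 scale0r.
(* An invertible component has trivial weight; any other has residue 0. *)
have resph (i : 'I_(size s)) : galg_app nu (q t`_i) * residue (ph i) = galg_app nu 1 * residue (ph i).
  have [U|nU] := boolP (ph i \in unitmx).
    by rewrite (weight_iso (charS i) (weight i) U) rmorph1.
  have -> : residue (ph i) = 0 by apply/eqP; rewrite -[_ == 0]negbK -(residue_unit locV (homph i)).
  by rewrite !mulr0.
have hZ c i : homN (c *: ph i).
  by move=> a; rewrite -scalemxAl -scalemxAr; congr (_ *: _); apply: homph.
have resdecomp mu : residue (\sum_(i < size s) galg_app mu (q t`_i) *: ph i) =
    \sum_(i < size s) galg_app mu (q t`_i) * residue (ph i).
  have [_ ->] := residue_sum locV (index_enum _) (fun i : 'I_(size s) => hZ (galg_app mu (q t`_i)) i).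
  by apply: eq_bigr => i _; exact: (residueZ locV _ (homph i)).
rewrite decomp resdecomp -[in RHS](conj_act1 (V := V) (W := V) phi) decomp resdecomp mulr_sumr.
apply: eq_bigr => i _; rewrite resph; congr (_ * _).
by rewrite galg_app1 hopf_counit; have [_ ->] := charS i; rewrite mul1r.
Qed.

End Weights.

(** * From invariance of residues under G0 to invariance under G *)

Section Descent.
Variables (k : closedFieldType) (kG kG0 kN kQ : finCommHopfType k).
Variables (r : hopfMorphism kG kG0) (e : kG).
Hypotheses (surj_r : closed_subgroup r) (ee : e * e = e).
Hypothesis eP : forall x, r x = 0 <-> exists y, x = (1 - e) * y.
Variables (f : hopfMorphism kG kN) (j : hopfMorphism kQ kG).
Hypothesis jP : quotient_by j f.
Variable V : fdmodule (galg kG).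
Hypothesis locV : local_end (res f V).
Implicit Types (phi psi : 'M[k]_(mdim V)).
Local Notation homN phi := (@mod_hom k (galg kN) (res f V) (res f V) phi).
Local Notation conj mu phi := (conj_act (X := V) (Y := V) mu phi).
Hypothesis stab0 : forall phi nu, homN phi ->
  residue (conj (galg_map r nu) phi) = galg_app nu 1 * residue phi.

(** The function g |-> residue (g.phi) on G. It is linear and multiplicative in phi. *)
Let c phi : kG := galg_repr (fun mu => residue (conj mu phi)).

Lemma conj_linear phi : linear (fun mu => conj mu phi).
Proof.
move=> a mu nu; apply/matrixP => i l; rewrite !mxE !conj_act_coef.
by rewrite galgDE galgZE.
Qed.

Lemma conj_linearr mu : linear (fun phi => conj mu phi).
Proof.
move=> a phi psi; apply/matrixP => i l.
have E : (a%:A *: Gam V V phi + Gam V V psi) i l = a *: Gam V V phi i l + Gam V V psi i l.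
  by rewrite mxE; congr (_ + _); rewrite mxE mulr_algl.
rewrite conj_act_coef GamP E galg_appD galg_appZ -!conj_act_coef.
by rewrite [RHS]mxE; congr (_ + _); rewrite mxE.
Qed.

Lemma conj_homN mu phi : homN phi -> homN (conj mu phi).
Proof. by move=> hp; apply: (conj_act_hom jP hp). Qed.

Lemma residue_coefE phi mu : homN phi -> galg_app mu (c phi) = residue (conj mu phi).
Proof.
move=> hp; apply: (galg_reprE (F := fun mu => residue (conj mu phi))) => a nu xi.
rewrite (conj_linear phi a nu xi) (residueP locV _ (conj_homN nu hp) (conj_homN xi hp)).
by [].
Qed.

Lemma residue_coefP a phi psi : homN phi -> homN psi -> c (a *: phi + psi) = a *: c phi + c psi.
Proof.
move=> hp hs; have hps : homN (a *: phi + psi) by apply: mod_homP_scalar hp hs.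
apply: galg_sep => mu; rewrite galg_appD galg_appZ; apply: (etrans (residue_coefE mu hps)).
rewrite (conj_linearr mu a phi psi) (residueP locV _ (conj_homN mu hp) (conj_homN mu hs)).
by congr (_ * _ + _); apply/esym; [exact: (residue_coefE mu hp)|exact: (residue_coefE mu hs)].
Qed.

Lemma residue_coefM phi psi : homN phi -> homN psi -> c (phi *m psi) = c phi * c psi.
Proof.
move=> hp hs; have hps : homN (phi *m psi) by apply: (@mod_homM _ _ (res f V) (res f V) (res f V)).
apply: galg_sep => mu; rewrite residue_coefE // -gcomulE.
have -> : conj mu (phi *m psi) = \sum_(p <- gcomul mu) (conj p.1 phi *m conj p.2 psi).
  by rewrite conj_actE (GamM psi phi) ev_mulmx; apply: eq_bigr => p _; rewrite !conj_actE.
have hM (p : galg kG * galg kG) : homN (conj p.1 phi *m conj p.2 psi).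
  by apply: (@mod_homM _ _ (res f V) (res f V) (res f V)); apply: conj_homN.
have [_ ->] := residue_sum locV (gcomul mu) hM.
apply: eq_bigr => p _; rewrite !residue_coefE //.
exact: (residueM locV (conj_homN _ hp) (conj_homN _ hs)).
Qed.

Lemma residue_coef_nilpotent phi : homN phi -> residue phi = 0 -> exists n, c phi ^+ n = 0.
Proof.
move=> hp r0; have [n Hn] := residue0_nilpotent locV hp r0; exists n.+1.
have cX m : homN (phi ^+ m.+1) /\ c (phi ^+ m.+1) = c phi ^+ m.+1.
  elim: m => [|m [IHh IHc]]; first by rewrite !expr1.
  rewrite exprS [in RHS]exprS -IHc -[phi * _]/(phi *m _) residue_coefM //; split=> //.
  exact: (@mod_homM _ _ (res f V) (res f V) (res f V)).
have [_ <-] := cX n; rewrite exprS Hn mulr0.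
apply: galg_sep => mu; rewrite raddf0 residue_coefE; last by move=> a; rewrite mul0mx mulmx0.
have := conj_linearr mu (-1) 0 0; rewrite scaler0 addr0 scaleN1r addNr => ->.
exact: (residue0 locV).
Qed.

(* The functions c phi with residue phi = 0 generate a nilpotent ideal z.  By   *)
(* invariance under the identity component, cut out by e, the product of        *)
(* Delta (c phi) and 1 (x) e is a sum of terms c phi_i (x) b_i with             *)
(* residue phi_i = 0.  Applying u (x) v |-> u * theta v, where theta has values *)
(* in z, to both sides yields c phi \in z * z; so z = z * z and z = 0.          *)
Lemma residue_conj0 mu phi : homN phi -> residue phi = 0 -> residue (conj mu phi) = 0.
Proof.
have [I IP] : exists I : {vspace 'M[k]_(mdim V)}, forall u, u \in I <-> homN u /\ residue u = 0.
  apply: vspace_of_pred => [|a u v [hu ru] [hv rv]].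
    by split; [move=> a; rewrite mul0mx mulmx0|exact: (residue0 locV)].
  split; first exact: mod_homP_scalar hu hv.
  by rewrite (residueP locV _ hu hv) ru rv mulr0 addr0.
pose x (i : 'I_(\dim I)) := c (vbasis I)`_i.
have memI (i : 'I_(\dim I)) : (vbasis I)`_i \in I.
  by apply/vbasis_mem/mem_nth; rewrite size_tuple.
pose X := [seq x i | i <- enum 'I_(\dim I)].
pose z : {vspace kG} := (<<X>> * fullv)%VS.
have memX i : x i \in <<X>>%VS by apply/memv_span/map_f; rewrite mem_enum.
have memz i a : x i * a \in z by rewrite memv_mul ?memvf.
have idz a b : a \in z -> b * a \in z.
  move=> za; have /subvP/(_ a za) : (z <= amulr b @^-1: z)%VS.
    apply/prodvP => u v Xu _; rewrite -memv_preim lfunE /= -mulrA.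
    by rewrite memv_mul ?memvf.
  by rewrite -memv_preim lfunE /= mulrC.
have c_comb psi : psi \in I -> c psi = \sum_(i < \dim I) coord (vbasis I) i psi *: x i.
  move=> /coord_vbasis {1}->; rewrite /x.
  suff /(_ (index_enum _))[] : forall s : seq 'I_(\dim I),
      homN (\sum_(i <- s) coord (vbasis I) i psi *: (vbasis I)`_i) /\
      c (\sum_(i <- s) coord (vbasis I) i psi *: (vbasis I)`_i) =
      \sum_(i <- s) coord (vbasis I) i psi *: c (vbasis I)`_i by [].
  elim=> [|i s [IHh IHc]].
    rewrite !big_nil; split; first by move=> a; rewrite mul0mx mulmx0.
    have h0 : homN 0 by move=> a; rewrite mul0mx mulmx0.
    by have := residue_coefP (-1) h0 h0; rewrite scaler0 addr0 scaleN1r addNr.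
  have [hi _] := (IP _).1 (memI i).
  rewrite !big_cons -IHc; split; first exact: mod_homP_scalar hi IHh.
  exact: residue_coefP hi IHh.
have cz psi : psi \in I -> c psi \in z.
  move=> Ipsi; rewrite c_comb // memv_suml // => i _; apply: memvZ.
  by rewrite -[x i]mulr1.
(* [T] projects onto the ideal z. Convolving it with the antipode gives theta, with values in z and
   with sum a_1 theta(a_2) = T a. *)
pose T : 'End(kG) := projv z.
pose theta b := \sum_(p <- comul b) antipode p.1 * T p.2.
have theta_z b : theta b \in z.
  by rewrite memv_suml // => p _; apply: idz; apply: memv_proj.
have theta_bil : bilinear_map (fun u v : kG => antipode u * T v).
  split=> [? a ? ?|? a ? ?]; first by rewrite linearP mulrDl -scalerAl.
  by rewrite linearP mulrDr -scalerAr.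
have theta_linear : linear theta.
  move=> a u v; rewrite /theta (comul_linear a u v _ _ theta_bil) big_cat big_map scaler_sumr.
  by congr (_ + _); apply: eq_bigr => p _; rewrite /= linearZ -scalerAl.
pose lift : kG0 -> kG := (linfun r)^-1%VF.
have liftK w : r (lift w) = w.
  have [y <-] := surj_r w; rewrite -[r y]lfunE /lift -[r _]lfunE.
  by rewrite limg_lfunVK // memv_img ?memvf.
(* The part of nu supported on the identity component; it comes from k G0, so [stab0] applies to
   it. *)
pose cut nu : galg kG := (nu \o amull e)%VF.
have cutE nu y : galg_app (cut nu) y = galg_app nu (e * y).
  by rewrite /cut /galg_app comp_lfunE lfunE.
have cut_res nu : exists nu0, cut nu = galg_map r nu0.
  exists (cut nu \o (linfun r)^-1)%VF; apply: galgP => y.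
  rewrite galg_mapE [RHS]/galg_app comp_lfunE -/(galg_app (cut nu) _) !cutE.
  by rewrite (component_mul ee eP (y := y)) // liftK.
have cut_linear : linear cut.
  by move=> a u v; apply: galgP => y; rewrite galgDE galgZE !cutE galgDE galgZE.
have cutI nu psi : psi \in I -> conj (cut nu) psi \in I.
  move=> /IP[hp rp]; have [nu0 ->] := cut_res nu; apply/IP.
  by split; [exact: conj_homN|rewrite stab0 // rp mulr0].
have cz2 psi : psi \in I -> c psi \in (z * z)%VS.
  move=> Ipsi; have [hp rp] := (IP _).1 Ipsi.
  pose cf i nu := coord (vbasis I) i (conj (cut nu) psi).
  have cf_linear i : linear (cf i : galg kG -> k^o).
    move=> a u v; rewrite /cf cut_linear (conj_linear psi a (cut u) (cut v)).
    by rewrite linearP.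
  pose b i := galg_repr (cf i).
  have bE i nu : galg_app nu (b i) = cf i nu by apply: galg_reprE.
  (* Paired with [mu1] and [nu], the left side is the residue of [mu1] acting on the conjugate of
     psi by [cut nu], which again lies in [I] and is expanded in its basis. *)
  have key : \sum_(p <- comul (c psi)) pure p.1 (e * p.2) = \sum_i pure (x i) (b i).
    apply: tapp_sep => mu1 nu; rewrite !linear_sum.
    transitivity (galg_app (mu1 * cut nu) (c psi)).
      by rewrite galgM; apply: eq_bigr => p _; rewrite cutE; apply: tapp_pure.
    rewrite residue_coefE // conj_actM -residue_coefE ?c_comb ?cutI //; last exact: conj_homN.
    rewrite galg_app_sum; apply: eq_bigr => i _.
    by rewrite galg_appZ mulrC -[coord _ _ _]/(cf i nu) -bE; apply/esym/tapp_pure.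
  have bil : bilinear_map (fun u v : kG => u * theta v).
    split=> [? a ? ?|? a ? ?]; first by rewrite mulrDl -scalerAl.
    by rewrite theta_linear mulrDr -scalerAr.
  have := congr1 (tlift (fun u v : kG => u * theta v)) key.
  pose L : {linear tensor kG kG -> kG} := HB.pack (tlift (fun u v : kG => u * theta v))
    (GRing.isLinear.Build k (tensor kG kG) kG *:%R _ (@tlift_linear _ _ _ _ _)).
  have Lsum (J : Type) (s : seq J) F : tlift (fun u v : kG => u * theta v) (\sum_(i <- s) F i) =
      \sum_(i <- s) tlift (fun u v : kG => u * theta v) (F i) by exact: (linear_sum L).
  rewrite !Lsum.
  rewrite (eq_bigr (fun p => p.1 * theta (e * p.2))); last by move=> p _; rewrite /= tlift_pure.
  rewrite [X in _ = X](eq_bigr (fun i => x i * theta (b i))); last first.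
    by move=> i _; rewrite /= tlift_pure.
  (* Coassociativity and the antipode axiom collapse the sum to that of S(e_1) T(e_2 c psi), with S
     the antipode. As [T] is the identity on z, this is counit(e) c psi = c psi. *)
  suff -> : \sum_(p <- comul (c psi)) p.1 * theta (e * p.2) = c psi.
    move=> ->; rewrite memv_suml // => i _; rewrite memv_mul //.
    by rewrite -[x i]mulr1.
  have thetaM v : theta (e * v) =
      \sum_(p <- comul e) antipode p.1 * \sum_(q <- comul v) antipode q.1 * T (p.2 * q.2).
    rewrite /theta (comulM e v _ _ theta_bil) big_allpairs_dep; apply: eq_bigr => p _ /=.
    by rewrite mulr_sumr; apply: eq_bigr => q _; rewrite antipodeM mulrA.
  under eq_bigr => p _ do rewrite thetaM mulr_sumr.
  rewrite exchange_big /=.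
  transitivity (\sum_(p <- comul e) antipode p.1 * T (p.2 * c psi)).
    apply: eq_bigr => p _.
    under eq_bigr => u _ do rewrite mulrCA mulr_sumr.
    rewrite -mulr_sumr; congr (_ * _).
    pose tri (u v w : kG) := u * antipode v * T (p.2 * w).
    have triP : trilinear_map tri.
      rewrite /tri; split=> [v w a s t|u w a s t|u v a s t].
      - by rewrite mulrDl -scalerAl mulrDl -scalerAl.
      - by rewrite linearP mulrDr -scalerAr mulrDl -scalerAl.
      - by rewrite mulrDr -scalerAr linearP mulrDr -scalerAr.
    have := comulA (c psi) _ _ triP; rewrite !big_allpairs_dep /= /tri => E.
    under eq_bigr => u _ do (under eq_bigr => v _ do rewrite mulrA).
    rewrite -E.
    under eq_bigr => u _ do rewrite -mulr_suml antipoder mulr_algl -linearZ scalerAr.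
    by rewrite -linear_sum -mulr_sumr counitl.
  under eq_bigr => p _ do rewrite projv_id ?idz ?cz // mulrA.
  rewrite -mulr_suml antipodel (component_counit eP).
  by rewrite scale1r mul1r.
have zz : (z <= z * z)%VS.
  apply/prodvP => u v /(coord_span (X := in_tuple X)) -> _; rewrite mulr_suml memv_suml // => l _.
  rewrite -scalerAl memvZ //= .
  have /mapP[i _ ->] : (in_tuple X)`_l \in X by apply: mem_nth; exact: ltn_ord.
  have /subvP/(_ _ (cz2 _ (memI i))) : (z * z <= amulr v @^-1: (z * z))%VS.
    apply/prodvP => a b za zb; rewrite -memv_preim lfunE /= -mulrA memv_mul // mulrC.
    exact: idz.
  by rewrite -memv_preim lfunE.
have [Nil NilP] : exists Nil : {vspace kG}, forall u, u \in Nil <-> exists n, u ^+ n = 0.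
  apply: vspace_of_pred => [|a u v [n un] [m vm]]; first by exists 1%N.
  by apply: nilpotentD; [exists n; rewrite exprZn un scaler0|exists m].
have [N zN] : exists N, (z ^+ N)%VS = 0%VS.
  apply: nil_expv0 => y zy; apply/NilP; apply: subvP zy.
  apply/prodvP => u v Xu _; apply/NilP.
  have /NilP[n un] : u \in Nil.
    apply: subvP Xu; apply/span_subvP => _ /mapP[i _ ->]; apply/NilP.
    by have [hi ri] := (IP _).1 (memI i); apply: residue_coef_nilpotent.
  by exists n; rewrite exprMn un mul0r.
have zpow n : (z <= z ^+ n.+1)%VS.
  elim: n => [|n IHn]; first by rewrite expv1.
  by apply: (subv_trans zz); rewrite expvSl prodvS.
have z0 : (z <= 0)%VS.
  by apply: (subv_trans (zpow N)); rewrite expvSl zN prodv0.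
move=> hp rp; have : c phi \in z by apply/cz/IP.
move=> /(subvP z0); rewrite memv0 -residue_coefE // => /eqP ->.
by rewrite raddf0.
Qed.

(** Subtract the scalar endomorphism with the same residue and apply [residue_conj0] to the rest. *)
Lemma residue_conj mu phi : homN phi -> residue (conj mu phi) = galg_app mu 1 * residue phi.
Proof.
move=> hp; have h1 : homN 1%:M by move=> a; rewrite mul1mx mulmx1.
have hB : homN (phi - (residue phi)%:M).
  by move=> a; rewrite mulmxBl mulmxBr hp scalar_mxC.
have rB : residue (phi - (residue phi)%:M) = 0.
  by apply: (residue_uniq locV hB); rewrite scalar_mx0 subr0 residue_nunit // (local_gt0 locV).
have -> : conj mu phi = residue phi *: conj mu 1%:M + conj mu (phi - (residue phi)%:M).
  rewrite -(conj_linearr mu (residue phi) 1%:M (phi - (residue phi)%:M)); congr (conj_act mu _).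
  by rewrite scalemx1 addrC subrK.
rewrite (residueP locV _ (conj_homN mu h1) (conj_homN mu hB)) (residue_conj0 mu hB rB) addr0.
have -> : conj mu 1%:M = (galg_app mu 1)%:M.
  by rewrite conj_actE Gam1 -(cst1 kG) ev_cst scalemx1.
by rewrite (residue_scalar locV) mulrC.
Qed.

End Descent.

(** * Almost split maps and tensor products *)

Section Homs.
Variables (k : fieldType) (A : falgType k).
Implicit Types X Y Z : fdmodule A.

Lemma mod_hom0 X Y : @mod_hom k A X Y 0.
Proof. by move=> a; rewrite mul0mx mulmx0. Qed.

Lemma mod_hom1 X : @mod_hom k A X X 1%:M.
Proof. by move=> a; rewrite mul1mx mulmx1. Qed.

Lemma mod_homD X Y (f g : 'M[k]_(mdim Y, mdim X)) :
  mod_hom f -> mod_hom g -> @mod_hom k A X Y (f + g).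
Proof. by move=> hf hg a; rewrite mulmxDl mulmxDr hf hg. Qed.

Lemma mod_homN X Y (f : 'M[k]_(mdim Y, mdim X)) : mod_hom f -> @mod_hom k A X Y (- f).
Proof. by move=> hf a; rewrite mulNmx mulmxN hf. Qed.

Lemma mod_hom_sum X Y (I : Type) (s : seq I) (F : I -> 'M[k]_(mdim Y, mdim X)) :
  (forall i, mod_hom (F i)) -> @mod_hom k A X Y (\sum_(i <- s) F i).
Proof.
move=> hF; elim/big_rec: _ => [|i f _ hf]; first exact: mod_hom0.
exact: mod_homD.
Qed.

End Homs.

Section Elimination.
Variables (k : closedFieldType) (A : falgType k) (U Z : fdmodule A) (s : nat).
Hypothesis locU : local_end U.

Let homM := @mod_homM k A.

(** Gaussian elimination over a local ring: the matrix of the h_j q_i is the identity modulo the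
    radical, and column operations make one more row exact at each step. *)
Lemma elimination_right (h : 'I_s -> 'M[k]_(mdim U, mdim Z)) (q : 'I_s -> 'M[k]_(mdim Z, mdim U)) :
  (forall j, mod_hom (h j)) -> (forall i, mod_hom (q i)) ->
  (forall j i, residue (h j *m q i) = (i == j)%:R) ->
  exists q' : 'I_s -> 'M[k]_(mdim Z, mdim U),
    (forall i, mod_hom (q' i)) /\ forall j i, h j *m q' i = (i == j)%:R%:M.
Proof.
move=> hh hq rq.
suff /(_ s (leqnn s))[q' [hq' Eq' _]] : forall t, (t <= s)%N ->
    exists q' : 'I_s -> 'M[k]_(mdim Z, mdim U), [/\ forall i, mod_hom (q' i),
      forall j i : 'I_s, (j < t)%N -> h j *m q' i = (i == j)%:R%:M
    & forall j i, residue (h j *m q' i) = (i == j)%:R].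
  by exists q'; split=> // j i; apply: Eq'.
elim=> [|t IHt] lt_ts; first by exists q.
have [p [hp Ep rp]] := IHt (ltnW lt_ts); pose T := Ordinal lt_ts.
pose a := h T *m p T.
have hhp j i : @mod_hom k A U U (h j *m p i) by apply: homM.
have Ua : a \in unitmx by rewrite (residue_unit locU (hhp T T)) rp eqxx oner_neq0.
have ha : @mod_hom k A U U (invmx a).
  by apply: (mod_hom_inv (hhp T T)); rewrite ?mulVmx ?mulmxV.
(* The defect in row [T]. Adding p_T a^-1 d_i to column i removes it, leaves earlier rows intact
   since h_j p_T = 0 there, and keeps all residues since d_i has residue 0. *)
pose d i : 'M[k]_(mdim U) := (i == T)%:R%:M - h T *m p i.
have hd i : @mod_hom k A U U (d i).
  by apply: mod_homD; [exact: mod_hom_scalar|exact/mod_homN/hhp].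
have hpd i : @mod_hom k A U Z (p T *m invmx a *m d i).
  by apply: (homM (hd i)); apply: (homM ha).
have E j i : h j *m (p i + p T *m invmx a *m d i) =
    h j *m p i + h j *m p T *m (invmx a *m d i).
  by rewrite mulmxDr !mulmxA.
exists (fun i => p i + p T *m invmx a *m d i); split=> [i|j i|j i].
- exact: mod_homD.
- rewrite ltnS leq_eqVlt E => /predU1P[jt|lt_jt].
    have -> : j = T by apply: val_inj.
    by rewrite mulmxA mulmxV // mul1mx addrC subrK.
  rewrite !Ep // [T == j]eq_sym (_ : (j == T) = false) ?scalar_mx0 ?mul0mx ?addr0 //.
  by apply/negbTE; rewrite -val_eqE /= ltn_eqF.
rewrite E addrC -[h j *m p T *m _]scale1r (residueP locU) ?hhp //; last first.
  by apply: (homM _ (hhp j T)); apply: (homM (hd i) ha).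
have hid : @mod_hom k A U U (invmx a *m d i) by apply: (homM (hd i) ha).
rewrite mul1r (residueM locU (hhp j T) hid) (residueM locU ha (hd i)).
have -> : residue (d i) = 0.
  rewrite /d addrC -scaleN1r (residueP locU _ (hhp T i) (mod_hom_scalar U _)).
  by rewrite (residue_scalar locU) rp mulN1r addNr.
by rewrite !mulr0 add0r rp.
Qed.

Lemma elimination_left (h : 'I_s -> 'M[k]_(mdim Z, mdim U)) (q : 'I_s -> 'M[k]_(mdim U, mdim Z)) :
  (forall j, mod_hom (h j)) -> (forall i, mod_hom (q i)) ->
  (forall j i, residue (q i *m h j) = (i == j)%:R) ->
  exists q' : 'I_s -> 'M[k]_(mdim U, mdim Z),
    (forall i, mod_hom (q' i)) /\ forall j i, q' i *m h j = (i == j)%:R%:M.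
Proof.
move=> hh hq rq.
suff /(_ s (leqnn s))[q' [hq' Eq' _]] : forall t, (t <= s)%N ->
    exists q' : 'I_s -> 'M[k]_(mdim U, mdim Z), [/\ forall i, mod_hom (q' i),
      forall j i : 'I_s, (j < t)%N -> q' i *m h j = (i == j)%:R%:M
    & forall j i, residue (q' i *m h j) = (i == j)%:R].
  by exists q'; split=> // j i; apply: Eq'.
elim=> [|t IHt] lt_ts; first by exists q.
have [p [hp Ep rp]] := IHt (ltnW lt_ts); pose T := Ordinal lt_ts.
pose a := p T *m h T.
have hph j i : @mod_hom k A U U (p i *m h j) by apply: homM.
have Ua : a \in unitmx by rewrite (residue_unit locU (hph T T)) rp eqxx oner_neq0.
have ha : @mod_hom k A U U (invmx a).
  by apply: (mod_hom_inv (hph T T)); rewrite ?mulVmx ?mulmxV.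
pose d i : 'M[k]_(mdim U) := (i == T)%:R%:M - p i *m h T.
have hd i : @mod_hom k A U U (d i).
  by apply: mod_homD; [exact: mod_hom_scalar|exact/mod_homN/hph].
have hda i : @mod_hom k A U U (d i *m invmx a) by apply: (homM ha (hd i)).
have E j i : (p i + d i *m invmx a *m p T) *m h j =
    p i *m h j + d i *m invmx a *m (p T *m h j).
  by rewrite mulmxDl !mulmxA.
exists (fun i => p i + d i *m invmx a *m p T); split=> [i|j i|j i].
- by apply: mod_homD => //; apply: (homM (hp T)).
- rewrite ltnS leq_eqVlt E => /predU1P[jt|lt_jt].
    have -> : j = T by apply: val_inj.
    by rewrite -mulmxA mulVmx // mulmx1 addrC subrK.
  rewrite !Ep // [T == j]eq_sym (_ : (j == T) = false) ?scalar_mx0 ?mulmx0 ?addr0 //.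
  by apply/negbTE; rewrite -val_eqE /= ltn_eqF.
rewrite E addrC -[d i *m _ *m _]scale1r (residueP locU) ?hph //; last first.
  exact: (homM (hph j T) (hda i)).
rewrite mul1r (residueM locU (hda i) (hph j T)) (residueM locU (hd i) ha).
have -> : residue (d i) = 0.
  rewrite /d addrC -scaleN1r (residueP locU _ (hph T i) (mod_hom_scalar U _)).
  by rewrite (residue_scalar locU) rp mulN1r addNr.
by rewrite !mul0r add0r rp.
Qed.

End Elimination.

Section Transport.
Variables (k : fieldType) (A : falgType k).
Variables (E E' : mod_seq A).
Hypothesis isoE : seq_isomorphic E' E.
Hypothesis homE' : mod_hom (seq_inj E') /\ mod_hom (seq_surj E').

Let homM := @mod_homM k A.

Lemma right_almost_split_iso :
  right_almost_split (seq_surj E) -> right_almost_split (seq_surj E').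
Proof.
move=> [homg nsplit fact].
have [u1 [u2 [u3 [_ [h2 [v2 [hv2 v2u2 u2v2]]] [h3 [v3 [hv3 v3u3 u3v3]]] _ E3]]]] := isoE.
split=> [|[s [hs Es]]|Z h hh nh]; first by case: homE'.
  apply: nsplit; exists (u2 *m s *m v3); split; first by apply: homM => //; apply: homM.
  by rewrite !mulmxA -E3 -[u3 *m _ *m s]mulmxA Es mulmx1 u3v3.
have [||v [hv Ev]] := fact Z (u3 *m h); first exact: homM.
  move=> [s [hs Es]]; apply: nh; exists (s *m u3); split; first exact: homM.
  by rewrite -[_ *m _]mul1mx -v3u3 -mulmxA (mulmxA u3) (mulmxA _ s) Es mul1mx.
exists (v2 *m v); split; first exact: homM.
rewrite -[h]mul1mx -v3u3 -mulmxA Ev -[seq_surj E]mulmx1 -u2v2 !mulmxA.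
by rewrite -[v3 *m _ *m u2]mulmxA -E3 !mulmxA v3u3 mul1mx.
Qed.

Lemma left_almost_split_iso :
  left_almost_split (seq_inj E) -> left_almost_split (seq_inj E').
Proof.
move=> [homg nsplit fact].
have [u1 [u2 [u3 [[h1 [v1 [hv1 v1u1 u1v1]]] [h2 [v2 [hv2 v2u2 u2v2]]] _ E1 _]]]] := isoE.
split=> [|[s [hs Es]]|Z h hh nh]; first by case: homE'.
  apply: nsplit; exists (u1 *m s *m v2); split; first by apply: homM => //; apply: homM.
  have -> : u1 *m s *m v2 *m seq_inj E = u1 *m s *m (v2 *m (seq_inj E *m u1) *m v1).
    by rewrite !mulmxA -[_ *m u1 *m v1]mulmxA u1v1 mulmx1.
  by rewrite -E1 (mulmxA v2) v2u2 mul1mx mulmxA -[u1 *m s *m _]mulmxA Es mulmx1.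
have [||v [hv Ev]] := fact Z (h *m v1); first exact: homM.
  move=> [s [hs Es]]; apply: nh; exists (v1 *m s); split; first exact: homM.
  have -> : v1 *m s *m h = v1 *m (s *m (h *m v1)) *m u1.
    by rewrite !mulmxA -[_ *m v1 *m u1]mulmxA v1u1 mulmx1.
  by rewrite Es mulmx1.
exists (v *m u2); split; first exact: homM.
by rewrite -mulmxA E1 mulmxA -Ev -mulmxA v1u1 mulmx1.
Qed.

End Transport.

Section Slices.
Variables (k : fieldType) (kG kN kQ : finCommHopfType k).
Variables (f : hopfMorphism kG kN) (j : hopfMorphism kQ kG).
Hypothesis jP : quotient_by j f.
Variable S : fdmodule (galg kQ).
Local Notation SG := (res j S).
Implicit Types M V W : fdmodule (galg kG).

Lemma slice_tens1 m n s (A : 'M[k]_(m, n)) (l : 'I_s) :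
  slice m l *m (A *t 1%:M) = A *m slice n l.
Proof.
rewrite slice_tens (bigD1 l) //= mxE eqxx scale1r big1 ?addr0 // => i /negbTE nil.
by rewrite mxE eq_sym nil scale0r.
Qed.

Lemma tens1_slice m n s (A : 'M[k]_(m, n)) (l : 'I_s) :
  (A *t 1%:M) *m (slice n l)^T = (slice m l)^T *m A.
Proof.
rewrite tens_slice (bigD1 l) //= mxE eqxx scale1r big1 ?addr0 // => i /negbTE nil.
by rewrite mxE nil scale0r.
Qed.

(** N acts trivially on S, so over N this is a sum of copies of M, with the slices as projections
    and their transposes as inclusions. *)
Lemma gen_res_tens M : gen (res f (tens M SG)) = gen (res f M) *t 1%:M.
Proof.
rewrite !gen_res gen_tens map_mxT; congr (_ *t _).
apply/matrixP => a b; rewrite gen_res -map_mx_comp mxE [gen S a b]mxE.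
rewrite [LHS](quotient_triv jP) counit_mcoef mxE.
by case: (a == b); rewrite ?scale1r ?scale0r.
Qed.

Lemma mod_hom_slice M l :
  @mod_hom k (galg kN) (res f (tens M SG)) (res f M) (slice (mdim M) l).
Proof.
apply/mod_hom_gen; rewrite gen_res_tens /cst map_slice slice_tens.
rewrite (bigD1 l) //= mxE eqxx scale1r big1 ?addr0 // => i /negbTE nil.
by rewrite mxE eq_sym nil scale0r.
Qed.

Lemma mod_hom_sliceT M l :
  @mod_hom k (galg kN) (res f M) (res f (tens M SG)) (slice (mdim M) l)^T.
Proof.
apply/mod_hom_gen; rewrite gen_res_tens /cst -map_trmx map_slice tens_slice.
rewrite (bigD1 l) //= mxE eqxx scale1r big1 ?addr0 // => i /negbTE nil.
by rewrite mxE nil scale0r.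
Qed.

Lemma mod_hom_tens V W T (g : 'M[k]_(mdim W, mdim V)) :
  mod_hom g -> @mod_hom k (galg kG) (tens V T) (tens W T) (g *t 1%:M).
Proof.
move=> /mod_hom_gen Eg; apply/mod_hom_gen.
rewrite !gen_tens /cst map_mxT map_mx1 !tensmx_mul mulmx1 mul1mx.
by rewrite -/(cst kG g) Eg.
Qed.

Lemma slice_conj V M mu (phi : 'M[k]_(mdim (tens M SG), mdim V)) l :
  slice (mdim M) l *m conj_act (X := V) (Y := tens M SG) mu phi =
  \sum_l' \sum_(p <- gcomul mu) galg_app p.1 (gen SG l l') *:
    conj_act (X := V) (Y := M) p.2 (slice (mdim M) l' *m phi).
Proof.
rewrite conj_actE -ev_cst_mull /cst map_slice /Gam gen_tens !mulmxA slice_tens !mulmx_suml.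
apply/matrixP => a b; rewrite mxE !summxE galg_app_sum; apply: eq_bigr => l' _.
rewrite -!scalemxAl mxE -gcomulE summxE; apply: eq_bigr => p _.
by rewrite [RHS]mxE conj_act_coef /Gam cstM /cst map_slice !mulmxA.
Qed.

Lemma conj_slice V M mu (phi : 'M[k]_(mdim V, mdim (tens M SG))) l :
  conj_act (X := tens M SG) (Y := V) mu phi *m (slice (mdim M) l)^T =
  \sum_l' \sum_(p <- gcomul mu) galg_app p.1 (igen SG l' l) *:
    conj_act (X := M) (Y := V) p.2 (phi *m (slice (mdim M) l')^T).
Proof.
rewrite conj_actE -ev_cst_mulr /cst -map_trmx map_slice /Gam igen_tens -!mulmxA tens_slice.
rewrite !mulmx_sumr.
apply/matrixP => a b; rewrite mxE !summxE galg_app_sum; apply: eq_bigr => l' _.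
rewrite -!scalemxAr mxE -gcomulE summxE; apply: eq_bigr => p _.
by rewrite [RHS]mxE conj_act_coef /Gam cstM /cst -map_trmx map_slice !mulmxA.
Qed.

End Slices.

Section TensorAlmostSplit.
Variables (k : closedFieldType) (kG kN kQ : finCommHopfType k).
Variables (f : hopfMorphism kG kN) (j : hopfMorphism kQ kG).
Hypothesis jP : quotient_by j f.
Variables (eQ : galg kQ) (eG : galg kG).
Hypothesis eQint : forall nu, nu * eQ = galg_app nu 1 *: eQ.
Hypotheses (eGP : galg_map j eG = eQ) (eQ1 : galg_app eQ 1 = 1).
Variable S : fdmodule (galg kQ).
Hypothesis simS : simple_mod S.
Local Notation SG := (res j S).
Implicit Types M V W Y Z : fdmodule (galg kG).
Local Notation homN V W phi := (@mod_hom k (galg kN) (res f V) (res f W) phi).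

Let homM (V W Z : fdmodule (galg kN)) := @mod_homM k (galg kN) V W Z.

Lemma mod_hom_res V W phi : @mod_hom k (galg kG) V W phi -> homN V W phi.
Proof. by move=> homphi nu; apply: homphi. Qed.

Lemma average_id V W (phi : 'M[k]_(mdim W, mdim V)) :
  mod_hom phi -> conj_act (X := V) (Y := W) eG phi = phi.
Proof.
by move=> /hom_conj_act ->; rewrite -(rmorph1 j) -galg_mapE eGP eQ1 scale1r.
Qed.

(** G-equivariance of the residue vector with values in S: conjugation mixes the components by the
    matrix coefficients of S, and invariance of residues removes the remaining action on
    End_N(M). *)
Lemma residue_conj_slice M V mu (q : 'M[k]_(mdim V, mdim M)) (h : 'M[k]_(mdim (tens M SG), mdim V)) :
  local_end (res f M) ->
  (forall nu phi, homN M M phi ->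
     residue (conj_act (X := M) (Y := M) nu phi) = galg_app nu 1 * residue phi) ->
  mod_hom h -> homN M V q ->
  \col_l residue (slice (mdim M) l *m h *m conj_act (X := M) (Y := V) mu q) =
  mact SG mu *m \col_l residue (slice (mdim M) l *m h *m q).
Proof.
move=> locM resM homh homq; apply/matrixP => l a; rewrite !mxE.
have homs (l' : 'I_(mdim SG)) : homN M M (slice (mdim M) l' *m (h *m q)).
  exact: (homM (homM homq (mod_hom_res homh)) (mod_hom_slice jP M l')).
have homc nu (l' : 'I_(mdim SG)) :
    homN M M (conj_act (X := M) (Y := M) nu (slice (mdim M) l' *m (h *m q))).
  exact: (conj_act_hom jP (homs l')).
rewrite -mulmxA -(conj_act_homl _ _ homh) slice_conj.
have homZ c phi : homN M M phi -> homN M M (c *: phi).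
  by move=> hp nu; rewrite -scalemxAl -scalemxAr hp.
have homF (l' : 'I_(mdim SG)) := residue_sum locM (gcomul mu)
  (fun p => homZ (galg_app p.1 (gen SG l l')) _ (homc p.2 l')).
have [_ ->] := residue_sum locM (index_enum _) (fun l' => (homF l').1).
apply: eq_bigr => l' _; have [_ ->] := homF l'; rewrite [in RHS]mxE.
have -> : mact SG mu l l' =
    \sum_(p <- gcomul mu) galg_app p.1 (gen SG l l') * galg_app p.2 1.
  by rewrite gcomulE mulr1 -ev_gen mxE.
rewrite mulr_suml; apply: eq_bigr => p _.
rewrite (residueZ locM _ (homc p.2 l')) (resM _ _ (homs l')) mulmxA.
exact: mulrA.
Qed.

Lemma right_almost_split_tens Y M (g : 'M[k]_(mdim M, mdim Y)) :
  local_end (res f M) ->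
  (forall nu phi, homN M M phi ->
     residue (conj_act (X := M) (Y := M) nu phi) = galg_app nu 1 * residue phi) ->
  @mod_hom k (galg kG) Y M g -> @right_almost_split k (galg kN) (res f Y) (res f M) g ->
  @right_almost_split k (galg kG) (tens Y SG) (tens M SG) (g *t 1%:M).
Proof.
move=> locM resM homg [homNg nsplit fact].
have sl V (l : 'I_(mdim SG)) := mod_hom_slice jP V l (S := S).
have slT V (l : 'I_(mdim SG)) := mod_hom_sliceT jP V l (S := S).
have homgS : @mod_hom k (galg kG) (tens Y SG) (tens M SG) (g *t 1%:M) by apply: mod_hom_tens.
split=> // [[s [homs Es]]|Z h homh nsplith].
  have [nz_S _] := simS; have S0 : (0 < mdim SG)%N by rewrite lt0n; apply/eqP.
  pose l := Ordinal S0; apply: nsplit; exists (slice (mdim Y) l *m s *m (slice (mdim M) l)^T).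
  split; first exact: (homM (slT M l) (homM (mod_hom_res homs) (sl Y l))).
  by rewrite !mulmxA -slice_tens1 -[_ *m (g *t _) *m s]mulmxA Es mulmx1 slice_trT eqxx.
have homsh (l : 'I_(mdim SG)) : homN Z M (slice (mdim M) l *m h).
  exact: (homM (mod_hom_res homh) (sl M l)).
have [facts|nfact] := classic (forall l : 'I_(mdim SG), exists u : 'M[k]_(mdim Y, mdim Z),
    homN Z Y u /\ slice (mdim M) l *m h = g *m u).
  have [u uP] := fin_all_exists facts.
  (* The average of this N-linear factorization still factors h, because both g (x) 1 and h are
     G-linear. *)
  pose u0 : 'M[k]_(mdim (tens Y SG), mdim Z) := \sum_l (slice (mdim Y) l)^T *m u l.
  have homu0 : homN Z (tens Y SG) u0.
    by apply: mod_hom_sum => l; have [homu _] := uP l; apply: (homM homu (slT Y l)).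
  exists (conj_act (X := Z) (Y := tens Y SG) eG u0); split; first exact: (average_hom jP eQint eGP homu0).
  rewrite -(conj_act_homl _ _ homgS) (_ : (g *t 1%:M) *m u0 = h) ?average_id //.
  apply: slice_sep => l; rewrite mulmxA slice_tens1 (uP l).2 -mulmxA; congr (_ *m _).
  rewrite mulmx_sumr (bigD1 l) //= mulmxA slice_trT eqxx mul1mx big1 ?addr0 // => i nil.
  by rewrite mulmxA slice_trT eq_sym (negbTE nil) scalar_mx0 mul0mx.
have [l nfactl] := not_all_ex_not _ _ nfact.
have [q [homq Eq]] : @split_epi k (galg kN) (res f Z) (res f M) (slice (mdim M) l *m h).
  by apply: NNPP => nse; apply: nfactl; have [u] := fact _ _ (homsh l) nse; exists u.
pose vec (p : 'M[k]_(mdim Z, mdim M)) : 'cV[k]_(mdim S) :=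
  \col_i residue (slice (mdim M) (i : 'I_(mdim SG)) *m h *m p).
have nz_v : vec q <> 0.
  move=> /matrixP/(_ l 0)/eqP; rewrite !mxE Eq (residue_scalar locM).
  by rewrite oner_eq0.
have [inj_j _] := jP.
(* By equivariance the residue vectors of the conjugates of q form the submodule generated by
   [vec q], which is all of S. *)
have /fin_all_exists[p pP] (i : 'I_(mdim SG)) : exists p : 'M[k]_(mdim Z, mdim M),
    homN M Z p /\ vec p = delta_mx i 0.
  have [a Ea] := simple_col simS (delta_mx i 0) nz_v.
  have [mu Emu] := galg_map_surj a inj_j.
  exists (conj_act (X := M) (Y := Z) mu q); split; first exact: (conj_act_hom jP homq).
  by rewrite /vec (residue_conj_slice mu locM resM homh homq) -Ea -Emu.
have [i l'|p' [homp' Ep']] := elimination_right locM homsh (fun i => (pP i).1).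
  by have [_ /matrixP/(_ i 0)] := pP l'; rewrite !mxE eqxx andbT => ->; rewrite eq_sym.
pose w : 'M[k]_(mdim Z, mdim (tens M SG)) := \sum_i p' i *m slice (mdim M) i.
have homw : homN (tens M SG) Z w.
  by apply: mod_hom_sum => i; apply: (homM (sl M i) (homp' i)).
case: nsplith; exists (conj_act (X := tens M SG) (Y := Z) eG w); split.
  exact: (average_hom jP eQint eGP homw).
rewrite -(conj_act_homl _ _ homh) (_ : h *m w = 1%:M) ?average_id //; first exact: mod_hom1.
apply: slice_sep => i; rewrite mulmxA mulmx1 mulmx_sumr (bigD1 i) //= mulmxA Ep' eqxx mul1mx.
rewrite big1 ?addr0 // => i' nii.
by rewrite mulmxA Ep' (negbTE nii) scalar_mx0 mul0mx.
Qed.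

(** The residues now form a row, on which S acts from the right; the antipode turns the left action
    by conjugation into a right one. *)
Lemma residue_conj_sliceT M V mu (q : 'M[k]_(mdim M, mdim V)) (h : 'M[k]_(mdim V, mdim (tens M SG))) :
  local_end (res f M) ->
  (forall nu phi, homN M M phi ->
     residue (conj_act (X := M) (Y := M) nu phi) = galg_app nu 1 * residue phi) ->
  mod_hom h -> homN V M q ->
  \row_l residue (conj_act (X := V) (Y := M) (gantipode mu) q *m h *m (slice (mdim M) l)^T) =
  (\row_l residue (q *m h *m (slice (mdim M) l)^T)) *m mact SG mu.
Proof.
move=> locM resM homh homq; apply/matrixP => a l; rewrite !mxE.
have homs (l' : 'I_(mdim SG)) : homN M M (q *m h *m (slice (mdim M) l')^T).
  exact: (homM (mod_hom_sliceT jP M l') (homM (mod_hom_res homh) homq)).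
have homc nu (l' : 'I_(mdim SG)) :
    homN M M (conj_act (X := M) (Y := M) nu (q *m h *m (slice (mdim M) l')^T)).
  exact: (conj_act_hom jP (homs l')).
rewrite -(conj_act_homr _ _ homh) conj_slice.
have homZ c phi : homN M M phi -> homN M M (c *: phi).
  by move=> hp nu; rewrite -scalemxAl -scalemxAr hp.
have homF (l' : 'I_(mdim SG)) := residue_sum locM (gcomul (gantipode mu))
  (fun p => homZ (galg_app p.1 (igen SG l' l)) _ (homc p.2 l')).
have [_ ->] := residue_sum locM (index_enum _) (fun l' => (homF l').1).
apply: eq_bigr => l' _; have [_ ->] := homF l'; rewrite [in RHS]mxE.
have -> : mact SG mu l' l =
    \sum_(p <- gcomul (gantipode mu)) galg_app p.1 (igen SG l' l) * galg_app p.2 1.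
  rewrite gcomulE mulr1 -ev_gen -antipode_igen 2!mxE.
  by rewrite /gantipode /galg_app comp_lfunE lfunE.
rewrite mulr_sumr; apply: eq_bigr => p _.
rewrite (residueZ locM _ (homc p.2 l')) (resM _ _ (homs l')).
by rewrite mulrA mulrC.
Qed.

Lemma left_almost_split_tens Y M (g : 'M[k]_(mdim Y, mdim M)) :
  local_end (res f M) ->
  (forall nu phi, homN M M phi ->
     residue (conj_act (X := M) (Y := M) nu phi) = galg_app nu 1 * residue phi) ->
  @mod_hom k (galg kG) M Y g -> @left_almost_split k (galg kN) (res f M) (res f Y) g ->
  @left_almost_split k (galg kG) (tens M SG) (tens Y SG) (g *t 1%:M).
Proof.
move=> locM resM homg [homNg nsplit fact].
have sl V (l : 'I_(mdim SG)) := mod_hom_slice jP V l (S := S).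
have slT V (l : 'I_(mdim SG)) := mod_hom_sliceT jP V l (S := S).
have homgS : @mod_hom k (galg kG) (tens M SG) (tens Y SG) (g *t 1%:M) by apply: mod_hom_tens.
split=> // [[s [homs Es]]|Z h homh nsplith].
  have [nz_S _] := simS; have S0 : (0 < mdim SG)%N by rewrite lt0n; apply/eqP.
  pose l := Ordinal S0; apply: nsplit; exists (slice (mdim M) l *m s *m (slice (mdim Y) l)^T).
  split; first exact: (homM (slT Y l) (homM (mod_hom_res homs) (sl M l))).
  rewrite -[LHS]mulmxA -[_ *m g]tens1_slice -[LHS]mulmxA (mulmxA s) Es mul1mx slice_trT eqxx.
  by [].
have homsh (l : 'I_(mdim SG)) : homN M Z (h *m (slice (mdim M) l)^T).
  exact: (homM (slT M l) (mod_hom_res homh)).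
have [facts|nfact] := classic (forall l : 'I_(mdim SG), exists u : 'M[k]_(mdim Z, mdim Y),
    homN Y Z u /\ h *m (slice (mdim M) l)^T = u *m g).
  have [u uP] := fin_all_exists facts.
  pose u0 : 'M[k]_(mdim Z, mdim (tens Y SG)) := \sum_l u l *m slice (mdim Y) l.
  have homu0 : homN (tens Y SG) Z u0.
    by apply: mod_hom_sum => l; have [homu _] := uP l; apply: (homM (sl Y l) homu).
  exists (conj_act (X := tens Y SG) (Y := Z) eG u0); split.
    exact: (average_hom jP eQint eGP homu0).
  rewrite -(conj_act_homr _ _ homgS) (_ : u0 *m (g *t 1%:M) = h) ?average_id //.
  rewrite mulmx_suml -[RHS]mulmx1 -slice_sum mulmx_sumr; apply: eq_bigr => l _.
  by rewrite -mulmxA slice_tens1 mulmxA -(uP l).2 mulmxA.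
have [l nfactl] := not_all_ex_not _ _ nfact.
have [q [homq Eq]] : @split_mono k (galg kN) (res f M) (res f Z) (h *m (slice (mdim M) l)^T).
  by apply: NNPP => nse; apply: nfactl; have [u] := fact _ _ (homsh l) nse; exists u.
pose vec (p : 'M[k]_(mdim M, mdim Z)) : 'rV[k]_(mdim S) :=
  \row_i residue (p *m h *m (slice (mdim M) (i : 'I_(mdim SG)))^T).
have nz_v : vec q <> 0.
  move=> /matrixP/(_ 0 l)/eqP; rewrite !mxE -mulmxA Eq (residue_scalar locM).
  by rewrite oner_eq0.
have [inj_j _] := jP.
have /fin_all_exists[p pP] (i : 'I_(mdim SG)) : exists p : 'M[k]_(mdim M, mdim Z),
    homN Z M p /\ vec p = delta_mx 0 i.
  have [a Ea] := simple_row simS (delta_mx 0 i) nz_v.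
  have [mu Emu] := galg_map_surj a inj_j.
  exists (conj_act (X := Z) (Y := M) (gantipode mu) q); split; first exact: (conj_act_hom jP homq).
  by rewrite /vec (residue_conj_sliceT mu locM resM homh homq) -Ea -Emu.
have [i l'|p' [homp' Ep']] := elimination_left locM homsh (fun i => (pP i).1).
  by have [_ /matrixP/(_ 0 i)] := pP l'; rewrite !mxE eqxx mulmxA => ->; rewrite eq_sym.
pose w : 'M[k]_(mdim (tens M SG), mdim Z) := \sum_i (slice (mdim M) i)^T *m p' i.
have homw : homN Z (tens M SG) w.
  by apply: mod_hom_sum => i; apply: (homM (homp' i) (slT M i)).
case: nsplith; exists (conj_act (X := Z) (Y := tens M SG) eG w); split.
  exact: (average_hom jP eQint eGP homw).
rewrite -(conj_act_homr _ _ homh) (_ : w *m h = 1%:M) ?average_id //; first exact: mod_hom1.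
rewrite -[LHS]mulmx1 -slice_sum mulmx_sumr; apply: eq_bigr => i _.
rewrite mulmx_suml mulmx_suml (bigD1 i) //= big1 ?addr0 => [|i' nii].
  by rewrite -!mulmxA (mulmxA h) (mulmxA (p' i)) Ep' eqxx mul1mx.
by rewrite -!mulmxA (mulmxA h) (mulmxA (p' i')) Ep' (negbTE nii) scalar_mx0 mul0mx mulmx0.
Qed.

End TensorAlmostSplit.

(** Exactness is checked on each slice, where the maps of the tensored sequence are those of [E]. *)
Lemma short_exact_tens (k : fieldType) (B : finCommHopfType k) (E : mod_seq (galg B))
    (T : fdmodule (galg B)) : short_exact E -> short_exact (tens_seq E T).
Proof.
case: E => V W Z f g [/= homf homg injf exfg surjg]; split=> /=.
- exact: mod_hom_tens.
- exact: mod_hom_tens.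
- move=> x Ex; apply: slice_sep => l; rewrite mulmx0; apply: injf.
  by rewrite mulmxA -slice_tens1 -mulmxA Ex mulmx0.
- move=> y; split=> [Ey|[x <-]]; last first.
    rewrite mulmxA tensmx_mul (_ : g *m f = 0) ?mulmx1 ?tens0mx ?mul0mx //.
    apply/matrixP => a b.
    have : g *m (f *m delta_mx b 0) = (0 : 'cV_(mdim Z)).
      by apply/exfg; exists (delta_mx b 0).
    by rewrite mulmxA -colE => /matrixP/(_ a 0); rewrite [LHS]mxE => ->; rewrite !mxE.
  have /fin_all_exists[x xP] (l : 'I_(mdim T)) : exists x, f *m x = slice (mdim W) l *m y.
    by apply/exfg; rewrite mulmxA -slice_tens1 -mulmxA Ey mulmx0.
  exists (\sum_l (slice (mdim V) l)^T *m x l); rewrite mulmx_sumr.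
  rewrite -[RHS]mul1mx -slice_sum mulmx_suml; apply: eq_bigr => l _.
  by rewrite mulmxA tens1_slice -!mulmxA xP.
move=> z; have /fin_all_exists[y yP] (l : 'I_(mdim T)) := surjg (slice (mdim Z) l *m z).
exists (\sum_l (slice (mdim W) l)^T *m y l); rewrite mulmx_sumr.
rewrite -[RHS]mul1mx -slice_sum mulmx_suml; apply: eq_bigr => l _.
by rewrite mulmxA tens1_slice -!mulmxA yP.
Qed.

(** * Regularity makes residues invariant; conclusion *)

Section Residues.
Variables (k : closedFieldType) (kG kG0 kN kQ kQ0 : finCommHopfType k).
Variables (r : hopfMorphism kG kG0) (f0 : hopfMorphism kG0 kN).
Variables (j : hopfMorphism kQ kG) (q : hopfMorphism kQ0 kG0).
Hypotheses (compG0 : identity_component r).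
Hypotheses (jP : quotient_by j (hopf_comp f0 r)) (qP : quotient_by q f0).
Hypothesis lrQ : linearly_reductive kQ.
Local Notation f := (hopf_comp f0 r).

Lemma component_characters_span (U : {vspace kQ0}) :
  (forall l, is_character l -> l \in U) -> U = fullv.
Proof.
have [surj_r [e [ee eP]] connG0] := compG0.
have [e0 [e0int e01]] := component_integral connG0 ee eP surj_r jP qP lrQ.
by apply: (characters_span _ e0int e01) => c; exact: (connected_quotient connG0 qP).
Qed.

Lemma mact_res_res (V : fdmodule (galg kG)) nu :
  mact (res f0 (res r V)) nu = mact (res f V) nu.
Proof. by congr (mact V _); apply: galgP => x; rewrite !galg_mapE. Qed.

(** The weight argument for V restricted to G0 gives invariance under G0, and [residue_conj] extends
    it to G. *)
Lemma regular_residue_conj (V : fdmodule (galg kG)) :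
  local_end (res f V) -> regular q (res r V) ->
  forall mu phi, @mod_hom k (galg kN) (res f V) (res f V) phi ->
  residue (conj_act (X := V) (Y := V) mu phi) = galg_app mu 1 * residue phi.
Proof.
move=> locV regV mu phi homphi; have [surj_r [e [ee eP]] _] := compG0.
have hom_res psi : @mod_hom k (galg kN) (res f0 (res r V)) (res f0 (res r V)) psi <->
    @mod_hom k (galg kN) (res f V) (res f V) psi.
  by split=> hompsi nu; have := hompsi nu; rewrite !mact_res_res.
have locV0 : local_end (res f0 (res r V)).
  by have [nz_V loc] := locV; split=> // x y /hom_res homx /hom_res homy; apply: loc.
apply: (residue_conj surj_r ee eP jP locV) => // psi nu /hom_res hompsi.
have := residue_conj_weights qP locV0 regV component_characters_span nu hompsi.
by rewrite conj_act_res.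
Qed.

End Residues.

Theorem proposition1p5
  (k : closedFieldType)
  (kH : commHopfType k) (kG kG0 kN kGmodN kG0modN : finCommHopfType k)
  (G_in_H : hopfMorphism kH kG) (G0_in_G : hopfMorphism kG kG0)
  (N_in_G0 : hopfMorphism kG0 kN)
  (N_in_G := hopf_comp N_in_G0 G0_in_G : hopfMorphism kG kN)
  (quoG : hopfMorphism kGmodN kG) (quoG0 : hopfMorphism kG0modN kG0)
  (redH : reduced kH)
  (subG : closed_subgroup G_in_H)
  (compG0 : identity_component G0_in_G)
  (subN : closed_subgroup N_in_G0)
  (normalN : normal_subgroup (hopf_comp N_in_G G_in_H))
  (quoGP : quotient_by quoG N_in_G)
  (quoG0P : quotient_by quoG0 N_in_G0)
  (linredG : linearly_reductive kGmodN)
  (X M : fdmodule (galg kG))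
  (indecX : indecomposable_mod X) (indecM : indecomposable_mod M)
  (* the almost split sequence E *)
  (n : nat) (tauM : fdmodule (galg kN))
  (tauMP : is_AR_translate tauM (res N_in_G M))
  (f : 'M[k]_(mdim (dpow (res N_in_G X) n), mdim tauM))
  (g : 'M[k]_(mdim (res N_in_G M), mdim (dpow (res N_in_G X) n)))
  (E := ModSeq f g)
  (arE : almost_split E)
  (* the sequence E~ of G-modules *)
  (Irr : fdmodule (galg kG))
  (iota : {linear 'cV[k]_(mdim Irr) -> 'M[k]_(mdim M, mdim X)})
  (irrP : irr_embedding N_in_G iota)
  (N' : fdmodule (galg kG))
  (f' : 'M[k]_(mdim (tens X Irr), mdim N'))
  (g' : 'M[k]_(mdim M, mdim (tens X Irr)))
  (E' := ModSeq f' g')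
  (exactE' : short_exact E')
  (evalE' : is_evaluation iota g')
  (resE' : seq_isomorphic (res_seq N_in_G E') E)
  (regM : regular quoG0 (res G0_in_G M))
  (regN' : regular quoG0 (res G0_in_G N'))
  (S : fdmodule (galg kGmodN)) (simpleS : simple_mod S) :
  almost_split (tens_seq E' (res quoG S)).


Proof.
have [surj_r _ _] := compG0; have [inj_j _] := quoGP.
(* The integral of k(G/N) is lifted to kG in order to average N-linear maps between G-modules. *)
have [eQ [eQint eQ1]] := galg_integral linredG; have [eG eGP] := galg_map_surj eQ inj_j.
have [_ leftE rightE] := arE; have [homf' homg' _ _ _] := exactE'.
have homNE' : @mod_hom k (galg kN) _ _ (seq_inj (res_seq N_in_G E')) /\
              @mod_hom k (galg kN) _ _ (seq_surj (res_seq N_in_G E')).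
  by split=> nu; [apply: homf'|apply: homg'].
have leftE' := left_almost_split_iso resE' homNE' leftE.
have rightE' := right_almost_split_iso resE' homNE' rightE.
(* Almost splitness over N makes the N-endomorphism rings of both end terms local, so residues are
   defined on them. *)
have locM := right_almost_split_local rightE'.
have locN' := left_almost_split_local leftE'.
have resM := regular_residue_conj compG0 quoGP quoG0P linredG locM regM.
have resN' := regular_residue_conj compG0 quoGP quoG0P linredG locN' regN'.
split; first exact: short_exact_tens.
  exact: (left_almost_split_tens quoGP eQint eGP eQ1 simpleS locN' resN' homf' leftE').
exact: (right_almost_split_tens quoGP eQint eGP eQ1 simpleS locM resM homg' rightE').
Qed.
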